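(* For $n\ge 0$ let $\Omega(n)$ denote the number of Schur rings over the cyclic group $Z_{2^n}$ of order $2^n$, and set $\Omega(-1)=0$. Let $c_k=\frac{1}{k+1}\binom{2k}{k}$ be the $k$th Catalan number and $s_k=\sum_{j=0}^k\frac{1}{j+1}\binom{2j}{j}\binom{k+j}{2j}$ the $k$th Schröder number. Then $\Omega(0)=1$, $\Omega(1)=1$, $\Omega(2)=3$, $\Omega(3)=10$, and for every integer $n\ge 2$, $$\Omega(n)=\sum_{k=1}^{3}2^k\,\Omega(n-k)-(c_{n-1}+s_{n-1})+\sum_{k=4}^{n}\left(c_{k-1}+s_{k-1}-\sum_{j=1}^{k-3}(c_j+s_j)\right)\Omega(n-k),$$ where the sum over $k$ from $4$ to $n$ is taken to be empty when $n<4$.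
   Context: For a finite group $G$ and a subset $C\subseteq G$, write $\overline{C}=\sum_{g\in C} g\in \mathbb{Q}[G]$. A Schur ring over $G$ is a subspace $S$ of the group algebra $\mathbb{Q}[G]$ spanned by $\overline{C_1},\dots,\overline{C_r}$, where $\{C_1,\dots,C_r\}$ is a partition of $G$ such that: (1) $C_1=\{1\}$; (2) for each $i$ there is a $j$ with $\{g^{-1}: g\in C_i\}=C_j$; (3) for all $i,j$, $\overline{C_i}\cdot\overline{C_j}=\sum_{k=1}^r\lambda_{ijk}\overline{C_k}$ for some scalars $\lambda_{ijk}$. A Schur ring is uniquely determined by its partition, so counting Schur rings over $G$ is counting such partitions of $G$. *)

(* Defs.v *)
From HB Require Import structures.
From mathcomp Require Import all_boot all_order all_fingroup all_algebra.
From mathcomp Require Import all_character.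

Set Implicit Arguments.
Unset Strict Implicit.
Unset Printing Implicit Defensive.

Import Order.TTheory GRing.Theory Num.Theory.

Local Open Scope ring_scope.

(* The group algebra Q[G] is MathComp's [group_ring rat G], realized inside
   'M[rat]_#|G| by the (faithful) regular representation; its product is [*m],
   and [gset_mx rat G C] is the formal sum of the elements of C. *)

Section SchurRings.

Variables (gT : finGroupType) (G : {group gT}).

Definition schur_span (P : {set {set gT}}) : {vspace 'M[rat]_#|G|} :=
  <<[seq gset_mx rat G C | C in P]>>%VS.

(* Membership of the product in the span says that it is a linear combination
   of the class sums, i.e. that the structure constants exist. *)
Definition schur_partition (P : {set {set gT}}) : bool :=
  [&& partition P G,
      [set 1%g] \in P,
      [forall C in P, [set x^-1%g | x in C] \in P] &
      [forall A in P, forall B in P,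
         gset_mx rat G A *m gset_mx rat G B \in schur_span P]].

(* The duplicate-free list of all Schur rings over G, as subspaces of Q[G]. *)
Definition schur_rings : seq {vspace 'M[rat]_#|G|} :=
  undup [seq schur_span P | P in schur_partition].

Lemma schur_ringsP (S : {vspace 'M[rat]_#|G|}) :
  reflect (exists2 P, schur_partition P & S = schur_span P)
          (S \in schur_rings).
Proof.
rewrite mem_undup; apply: (iffP imageP) => -[P PP ->]; exists P => //.
Qed.

End SchurRings.

(* [Zp m] is cyclic of order m for every m > 0; it is the trivial group for
   m = 1, unlike the type 'Z_1.  Omega is 0 at all negative integers, of which
   only -1 matters. *)
Definition Omega (m : int) : nat :=
  if m is Posz n then size (schur_rings (Zp_group (2 ^ n))) else 0%N.

Definition catalan (k : nat) : rat :=
  (k.+1)%:R^-1 * ('C(2 * k, k))%:R.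

Definition schroeder (k : nat) : rat :=
  \sum_(0 <= j < k.+1) (j.+1)%:R^-1 * ('C(2 * j, j))%:R * ('C(k + j, 2 * j))%:R.

(* Main.v *)
Require Import Defs.
From HB Require Import structures.
From mathcomp Require Import all_boot all_order all_fingroup all_algebra.
From mathcomp Require Import all_solvable all_character.
From mathcomp Require Import zify ring lra.

(** Why the recurrence holds.

    A Schur ring is determined by its partition, and a partition of G is that
    of a Schur ring exactly when the number of factorizations z = a b, with a
    and b in two given classes, only depends on the class of z
    ([schur_partitionP], [schur_span_inj]).  The rest is about such partitions.

    Classification.  Let G be cyclic of order 2^m, T the class of a generator x
    and R = {g | g T = T} its radical, which is a union of classes.  Pushing the
    partition forward along the power map whose kernel is R reduces the study
    of T to the case R = 1.  Then two classical facts are used.  By Schur's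
    theorem on multipliers, powers with an odd exponent permute the classes
    ([cl_power]).  By a parity argument, the squares of the elements y of T
    with y e outside T, where e is the involution of G, form a union of
    classes ([square_lonely]).  Together they force T to be G minus 1, or {x},
    or {x, x^-1}, or {x, x^-1 e} ([trivial_radical]), and in the last three
    cases all other classes are known too ([trivial_radical_classes]).

    Back in G, call the set of generators the top layer and H the subgroup of
    index 2 ([structure]).  Either G minus R is a single class, with R of index
    at least 4, or the top layer is divided into the sets x R, or into the sets
    x R u x^-1 R, or into the sets x R u x^-1 R' where R' is the complement of
    R in the next subgroup of the chain; and in these cases the partition of H
    is discrete modulo R in the first case and consists of the pairs {y, y^-1}
    modulo R in the other two.  Conversely every Schur partition of H (or of R)
    satisfying this condition extends in each of these ways
    ([schur_ext_block], [schur_ext_coset], [schur_ext_fold]).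

    Counting.  Let D m r and E m r be the numbers of Schur partitions of the
    group of order 2^m that are discrete, respectively made of the pairs
    {y, y^-1}, modulo the subgroup of order 2^r.  Peeling off the top layer
    gives
      Omega m   = sum of Omega a over a < m - 1, plus D m (m-1),
      D m (m-1) = sum of D (m-1) r over r < m,
                  plus twice the sum of E (m-1) r over r < m - 2,
      D m r     = sum of D (m-1) r' over r' <= r             (r <= m - 2),
      E m r     = sum of E (m-1) r' over r' <= r,
                  plus the same sum over r' < r              (r <= m - 2),
    while B m = D m (m-1) = E m (m-1) and D m m = Omega m.  The recursions for
    D and E count lattice paths below a diagonal, without and with diagonal
    steps; unrolled from the boundary values B j ([path_sum]) they express
    D n (n-2) and E n (n-2) as convolutions of B with the Catalan and the
    Schroeder numbers.  Eliminating B ([eliminate_boundary]) leaves the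
    recurrence for Omega. *)

Set Implicit Arguments.
Unset Strict Implicit.
Unset Printing Implicit Defensive.

Import Order.TTheory GRing.Theory Num.Theory.

(** * Lattice paths and the elimination of the boundary values *)

Section Arithmetic.

Local Open Scope ring_scope.

(** Ballot numbers by the reflection formula; unlike a recursive definition it
    also gives the value 0 just beyond the diagonal, see [ballot_boundary]. *)
Definition ballot (i r : nat) : rat :=
  if r is r'.+1 then ('C(i + r, r))%:R - ('C(i + r, r'))%:R else 1.

(** Paths with f diagonal steps: a ballot path of the remaining steps, into which
    the diagonal ones are inserted at any of the i + r - f positions. *)
Definition weighted_ballot (i r : nat) : rat :=
  \sum_(0 <= f < r.+1) ('C(i + r - f, f))%:R * ballot (i - f) (r - f).

Lemma ballot_rec i r : ballot i.+1 r.+1 = ballot i.+1 r + ballot i r.+1.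
Proof.
rewrite /ballot; case: r => [|r].
  by rewrite !addn1 !bin1 !bin0 -[i.+2]addn1 natrD; ring.
rewrite !addSn !addnS (binS (i + r).+2 r.+1) (binS (i + r).+2 r) !natrD; ring.
Qed.

Lemma ballot_boundary i : ballot i i.+1 = 0.
Proof.
rewrite /ballot addnS.
have -> : 'C((i + i).+1, i.+1) = 'C((i + i).+1, i).
  by rewrite -bin_sub ?ltnS ?leq_addl // subSS addnK.
by rewrite subrr.
Qed.

Lemma ballot_diag i : ballot i i = catalan i.
Proof.
rewrite /ballot /catalan; case: i => [|i]; first by rewrite bin0 invr1 mulr1.
have h : (i.+2 * 'C(2 * i.+1, i) = i.+1 * 'C(2 * i.+1, i.+1))%N.
  have := mul_bin_left (2 * i.+1) i; rewrite (_ : 2 * i.+1 - i = i.+2)%N; last lia.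
  by move=> ->.
have h' : ((i.+2)%:R * ('C(2 * i.+1, i))%:R = (i.+1)%:R * ('C(2 * i.+1, i.+1))%:R :> rat).
  by rewrite -!natrM h.
have n0 : (i.+2)%:R != 0 :> rat by rewrite pnatr_eq0.
rewrite addnn -mul2n; apply: (mulfI n0); rewrite mulrA mulfV // mul1r mulrBr h'.
by rewrite -mulrBl -natrB // subSnn mul1r.
Qed.

Lemma weighted_ballot0 i : weighted_ballot i 0 = 1.
Proof. by rewrite /weighted_ballot big_nat1 bin0 mul1r subn0. Qed.

(** The last step is horizontal, vertical or diagonal.  In the sum over the number
    f of diagonal steps, Pascal's rule on the binomial separates the paths that
    end with a diagonal step from the others. *)
Lemma weighted_ballot_rec i r : (r <= i)%N -> weighted_ballot i.+1 r.+1 =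
  weighted_ballot i.+1 r + weighted_ballot i r.+1 + weighted_ballot i r.
Proof.
move=> le; rewrite {1}/weighted_ballot big_nat_recl // bin0 mul1r !subn0.
pose F f : rat := ('C(i + r - f, f.+1))%:R * ballot (i - f) (r - f).
have -> : \sum_(0 <= f < r.+1) ('C(i.+1 + r.+1 - f.+1, f.+1))%:R
     * ballot (i.+1 - f.+1) (r.+1 - f.+1) =
     \sum_(0 <= f < r.+1) F f + weighted_ballot i r.
  rewrite -big_split /=; apply: eq_big_nat => f /andP[_]; rewrite ltnS => lef.
  rewrite /F (_ : i.+1 + r.+1 - f.+1 = (i + r - f).+1)%N; last lia.
  rewrite (subSS f i) (subSS f r).
  by rewrite binS natrD mulrDl.
rewrite addrA; congr (_ + _).
have e2 : \sum_(0 <= f < r.+1) ('C(i.+1 + r - f, f))%:R * ballot (i.+1 - f) (r - f) +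
   \sum_(0 <= f < r.+1) ('C(i + r.+1 - f, f))%:R * ballot (i - f) (r.+1 - f) =
   \sum_(0 <= f < r.+1) ('C((i + r).+1 - f, f))%:R * ballot (i.+1 - f) (r.+1 - f).
  rewrite -big_split /=; apply: eq_big_nat => f /andP[_]; rewrite ltnS => lef.
  have lei := leq_trans lef le.
  by rewrite addSn addnS -mulrDr (subSn lef) (subSn lei) -ballot_rec.
rewrite /weighted_ballot [in X in _ = _ + X]big_nat_recr // addrA e2 [X in _ = X + _]big_nat_recl //.
rewrite bin0 mul1r !subn0 -[RHS]addrA; congr (_ + _).
rewrite big_nat_recr //= /F; congr (_ + _).
by rewrite !subnn /= !mulr1 addnK addnS subSS addnK.
Qed.

Lemma weighted_ballot_boundary i : weighted_ballot i i.+1 = 0.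
Proof.
rewrite /weighted_ballot big_nat_recr //= big_nat big1 ?add0r => [|f].
  by rewrite addnK bin_small // mul0r.
by case/andP=> _; rewrite ltnS => lef; rewrite subSn // ballot_boundary mulr0.
Qed.

Lemma weighted_ballot_diag i : weighted_ballot i i = schroeder i.
Proof.
rewrite /weighted_ballot /schroeder big_nat_rev /= add0n.
apply: eq_big_nat => f /andP[_]; rewrite ltnS => lef.
rewrite subSS subKn // ballot_diag /catalan [RHS]mulrC; congr (_ * _).
have -> : (i + i - (i - f) = i + f)%N by lia.
by rewrite -bin_sub; [congr (_%:R); congr 'C(_, _); lia | lia].
Qed.

(** In v k.+1 r the index k is the distance to the boundary, which is the row
    v 0.  Both sides obey the same recursion, because the vanishing of F beyond
    the diagonal takes care of k = 0; the weight w of the diagonal steps is 0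
    for D and 1 for E. *)
Lemma path_sum (N : nat) (w : rat) (F v : nat -> nat -> rat) :
    (forall a, F a 0%N = 1) ->
    (forall a i, (i <= a)%N -> F a.+1 i.+1 = F a.+1 i + F a i.+1 + w * F a i) ->
    (forall i, F i i.+1 = 0) ->
    (forall k, (k.+2 <= N)%N -> v k.+1 0%N = v k 0%N) ->
    (forall k r, ((r.+1 + k).+2 <= N)%N ->
       v k.+1 r.+1 = v k r.+1 + v k.+2 r + w * v k.+1 r) ->
  forall k r, ((r + k).+2 <= N)%N ->
    v k.+1 r = \sum_(i < r.+1) v 0%N (r - i)%N * F (i + k)%N i.
Proof.
move=> F0 Frec Fb v0 vrec k r; elim: r k => [|r IHr] k.
  elim: k => [|k IHk] le; rewrite v0 // big_ord1 ?F0 ?mulr1 //.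
  by rewrite IHk 1?ltnW // big_ord1 !F0 mulr1.
elim: k => [|k IHk] le; rewrite vrec //.
  rewrite !IHr; try lia.
  rewrite [RHS]big_ord_recl /= F0 mulr1 subn0 -addrA; congr (_ + _).
  rewrite mulr_sumr -big_split /=; apply: eq_bigr => i _.
  by rewrite /bump /= add1n subSS addn1 !addn0 Frec // Fb addr0; ring.
rewrite IHk; last by lia.
rewrite !IHr; try lia.
rewrite [RHS]big_ord_recl [X in X + _ + _]big_ord_recl /= !F0 -!addrA; congr (_ + _).
rewrite mulr_sumr -!big_split /=; apply: eq_bigr => i _.
rewrite /bump /= add1n subSS !addSn !addnS (Frec (i + k).+1 i) ?leqW ?leq_addr //; ring.
Qed.

Lemma sum_widen (M K : nat) (f : nat -> rat) : (M <= K)%N ->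
  \sum_(0 <= i < M) f i = \sum_(0 <= i < K) (i < M)%N%:R * f i.
Proof.
move=> le; rewrite (big_nat_widen _ _ _ _ _ le) big_mkcond /=.
by apply: eq_bigr => i _; case: ifP; rewrite ?mul1r ?mul0r.
Qed.

(** In terms of generating functions: for k > 0 the coefficient of x^k in
    x - (1 - x^2/(1-x)) (1 + x - x Q), with Q the series of q. *)
Definition layer_coef (q : nat -> rat) (k : nat) : rat :=
  q k.-1 + (1 < k)%N%:R + (2 < k)%N%:R - \sum_(0 <= i < k - 2) q i.

(** In generating functions the hypotheses read b = (1 - x^2/(1-x)) o and
    (1 + x - x Q) (b - 1) = x o up to the lowest terms; substituting the first into the second leaves a
    linear equation for o alone. *)
Lemma eliminate_boundary (N : nat) (o b q : nat -> rat) :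
    b 0%N = 1 ->
    (forall n, (n <= N)%N -> b n = o n - \sum_(0 <= a < n.-1) o a) ->
    (forall p, (0 < p)%N -> (p.+1 <= N)%N ->
       b p.+1 + b p = o p + \sum_(0 <= i < p) q i * b (p - i)%N) ->
  forall p, (0 < p)%N -> (p.+1 <= N)%N ->
    o p.+1 = \sum_(1 <= k < p.+2) layer_coef q k * o (p.+1 - k)%N - q p.
Proof.
move=> b0 bo rec p p0 le.
have := rec p p0 le.
have -> : \sum_(0 <= i < p) q i * b (p - i)%N =
    \sum_(0 <= i < p.+1) q i * b (p - i)%N - q p.
  by rewrite big_nat_recr //= subnn b0 mulr1 addrK.
have -> : \sum_(0 <= i < p.+1) q i * b (p - i)%N =
    \sum_(0 <= i < p.+1) q i * o (p - i)%N -
    \sum_(0 <= i < p.+1) q i * \sum_(0 <= a < (p - i).-1) o a.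
  rewrite -sumrB; apply: eq_big_nat => i _; rewrite -mulrBr bo //.
  by apply: leq_trans (ltnW le); apply: leq_subr.
rewrite !bo ?(ltnW le) //=.
have rev (g : nat -> rat) : \sum_(0 <= j < p.+1) g j * o (p - j)%N =
    \sum_(0 <= a < p.+1) g (p - a)%N * o a.
  rewrite big_nat_rev /= add0n; apply: eq_big_nat => a /andP[_].
  by rewrite ltnS subSS => lea; rewrite subKn.
have -> : \sum_(1 <= k < p.+2) layer_coef q k * o (p.+1 - k)%N =
    \sum_(0 <= i < p.+1) q i * o (p - i)%N + \sum_(0 <= a < p) o a +
    \sum_(0 <= a < p.-1) o a -
    \sum_(0 <= i < p.+1) q i * \sum_(0 <= a < (p - i).-1) o a.
  rewrite big_add1 /=.
  transitivity (\sum_(0 <= j < p.+1) (q j * o (p - j)%N + (0 < j)%N%:R * o (p - j)%N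
      + (1 < j)%N%:R * o (p - j)%N - (\sum_(0 <= i < j.-1) q i) * o (p - j)%N)).
    apply: eq_big_nat => j _; rewrite /layer_coef !subSS subn1 /=.
    by ring.
  rewrite sumrB !big_split /=; congr (_ + _ + _ - _).
  - rewrite (rev (fun j => (0 < j)%N%:R)) (sum_widen _ (leqnSn p)).
    by apply: eq_bigr => a _; rewrite subn_gt0.
  - rewrite (rev (fun j => (1 < j)%N%:R)) (@sum_widen p.-1 p.+1); last by lia.
    by apply: eq_bigr => a _; congr (_%:R * _); congr nat_of_bool; lia.
  rewrite (rev (fun j => \sum_(0 <= i < j.-1) q i)).
  transitivity (\sum_(0 <= a < p.+1) \sum_(0 <= i < p.+1) (a + i.+1 < p)%N%:R * q i * o a).
    apply: eq_bigr => a _; rewrite (@sum_widen _ p.+1); last by lia.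
    rewrite mulr_suml; apply: eq_bigr => i _; congr (_%:R * _ * _); congr nat_of_bool; lia.
  rewrite exchange_big /=; apply: eq_bigr => i _.
  rewrite [X in _ = _ * X](@sum_widen _ p.+1); last by lia.
  rewrite mulr_sumr; apply: eq_bigr => a _.
  rewrite mulrAC [RHS]mulrCA -mulrA [o a * _]mulrC; congr (_%:R * _); congr nat_of_bool; lia.
by lra.
Qed.

Arguments ballot : simpl never.

Section CountRecurrence.

Variables (N : nat) (om : nat -> nat) (D E : nat -> nat -> nat).
Hypothesis om0 : om 0 = 1%N.
Hypothesis om_rec : forall m, (0 < m <= N)%N ->
  om m = (\sum_(a < m.-1) om a + D m m.-1)%N.
Hypothesis D_top : forall m, (0 < m <= N)%N ->
  D m m.-1 = (\sum_(r < m) D m.-1 r + 2 * \sum_(r < m - 2) E m.-1 r)%N.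
Hypothesis D_rec : forall m r, (m <= N)%N -> (r.+1 < m)%N ->
  D m r = (\sum_(r' < r.+1) D m.-1 r')%N.
Hypothesis E_rec : forall m r, (m <= N)%N -> (r.+1 < m)%N ->
  E m r = (\sum_(r' < r.+1) E m.-1 r' + \sum_(r' < r) E m.-1 r')%N.
Hypothesis E_top : forall m, (0 < m <= N)%N -> E m m.-1 = D m m.-1.
Hypothesis D_full : forall m, (m <= N)%N -> D m m = om m.

Let b n : rat := (om n)%:R - \sum_(0 <= a < n.-1) (om a)%:R.

Let bE m : (0 < m <= N)%N -> b m = (D m m.-1)%:R.
Proof. by move=> le; rewrite /b om_rec // natrD natr_sum big_mkord addrC addKr. Qed.

Let D_path p : (0 < p)%N -> (p.+1 <= N)%N ->
  (D p.+1 p.-1)%:R = \sum_(0 <= i < p) catalan i * b (p - i)%N.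
Proof.
move=> p0 le.
have := @path_sum N 0 ballot (fun k r => (D (r + k).+1 r)%:R) _ _ ballot_boundary _ _ 0%N p.-1.
rewrite /= addn0 addn1 prednK // big_mkord => ->; rewrite ?prednK //.
- apply: eq_bigr => i _; rewrite !addn0 ballot_diag mulrC; congr (_ * _).
  have lti := ltn_ord i.
  by rewrite bE; [rewrite (_ : p.-1 - i = (p - i).-1)%N ?prednK; [|lia|lia] | lia].
- by move=> a i _; rewrite ballot_rec mul0r addr0.
- by move=> k lek; rewrite !add0n D_rec // big_ord1.
move=> k r lek; rewrite mul0r addr0 -natrD; congr (_%:R).
rewrite !addSn !addnS D_rec //; last by lia.
rewrite big_ord_recr /= addnC; congr (_ + _)%N.
by rewrite D_rec //; lia.
Qed.

Let E_path p : (0 < p)%N -> (p.+1 <= N)%N ->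
  (E p.+1 p.-1)%:R = \sum_(0 <= i < p) schroeder i * b (p - i)%N.
Proof.
move=> p0 le.
have := @path_sum N 1 weighted_ballot (fun k r => (E (r + k).+1 r)%:R) weighted_ballot0
  _ weighted_ballot_boundary _ _ 0%N p.-1.
rewrite /= addn0 addn1 prednK // big_mkord => ->; rewrite ?prednK //.
- apply: eq_bigr => i _; rewrite !addn0 weighted_ballot_diag mulrC; congr (_ * _).
  have lti := ltn_ord i.
  rewrite bE -?E_top; [|lia|lia].
  by rewrite (_ : p.-1 - i = (p - i).-1)%N ?prednK; [|lia|lia].
- by move=> a i lea; rewrite weighted_ballot_rec // mul1r.
- by move=> k lek; rewrite !add0n E_rec // big_ord1 big_ord0 addn0.
move=> k r lek; rewrite mul1r -!natrD; congr (_%:R).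
rewrite !addSn !addnS E_rec //; last by lia.
rewrite [X in (X + _)%N]big_ord_recr [X in (_ + X)%N]big_ord_recr /=.
rewrite (@E_rec (r + k).+3 r) //=; last by lia.
by lia.
Qed.

(** Adding E (n-1) (n-2) = B (n-1) to the formula for B n completes the sum over
    E (n-1) r to E n (n-2), so that both path sums apply. *)
Lemma count_recurrence p : (0 < p)%N -> (p.+1 <= N)%N ->
  (om p.+1)%:R = \sum_(1 <= k < p.+2)
    layer_coef (fun i => catalan i + schroeder i) k * (om (p.+1 - k))%:R
    - (catalan p + schroeder p).
Proof.
apply: (@eliminate_boundary N (fun n => (om n)%:R) b) => //.
- by rewrite /b /= big_nil subr0 om0.
move=> {}p p0 le.
have -> : \sum_(0 <= i < p) (catalan i + schroeder i) * b (p - i)%N =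
    (D p.+1 p.-1)%:R + (E p.+1 p.-1)%:R :> rat.
  by rewrite D_path // E_path // -big_split; apply: eq_bigr => i _; rewrite mulrDl.
rewrite !bE ?le ?p0 ?(ltnW le) //= -!natrD; congr (_%:R).
have -> : D p.+1 p = (\sum_(r < p) D p r + om p + 2 * \sum_(r < p.-1) E p r)%N.
  rewrite -[in LHS](erefl p : p.+1.-1 = p) D_top //= big_ord_recr /= D_full 1?ltnW //.
  by rewrite (_ : p.+1 - 2 = p.-1)%N //; lia.
rewrite (@D_rec p.+1 p.-1) //= ?prednK // (@E_rec p.+1 p.-1) //= ?prednK //.
rewrite -E_top ?p0 ?(ltnW le) //.
have -> : (\sum_(r' < p) E p r' = \sum_(r' < p.-1) E p r' + E p p.-1)%N.
  by move: p0; clear; case: p => // p _; rewrite big_ord_recr.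
set a := (\sum_(r < p) D p r)%N; set c := (\sum_(r < p.-1) E p r)%N.
by clearbody a c; lia.
Qed.

End CountRecurrence.

(** Abstracting over the counting function keeps conversion from unfolding it.
    The first three coefficients are 2, 4 and 8, and the value at -1 only serves
    the case n = 2. *)
Lemma recurrence_shape (O : int -> nat) : O (-1) = 0%N -> O 0 = 1%N -> O 1 = 1%N ->
    (forall p : nat, (0 < p)%N -> (O p.+1)%:R = \sum_(1 <= k < p.+2)
      layer_coef (fun i => catalan i + schroeder i) k * (O (p.+1 - k)%N)%:R
      - (catalan p + schroeder p) :> rat) ->
  [/\ O 0 = 1%N, O 1 = 1%N, O 2 = 3%N & O 3 = 10%N] /\
  forall n : nat, (2 <= n)%N ->
    (O n%:Z)%:R =
      \sum_(1 <= k < 4) 2%:R ^+ k * (O (n%:Z - k%:Z))%:R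
      - (catalan (n - 1)%N + schroeder (n - 1)%N)
      + \sum_(4 <= k < n.+1)
          (catalan (k - 1)%N + schroeder (k - 1)%N
           - \sum_(1 <= j < (k - 3).+1) (catalan j + schroeder j))
          * (O (n%:Z - k%:Z))%:R :> rat.
Proof.
pose q i := catalan i + schroeder i; rewrite -/q => Om1 O0 O1 Orec.
have cs0 : q 0%N = 2.
  by rewrite /q /catalan /schroeder big_nat1 !bin0 invr1 !mul1r.
have cs1 : q 1%N = 3.
  by rewrite /q /catalan /schroeder !big_nat_recr //= big_geq.
have cs2 : q 2%N = 8.
  by rewrite /q /catalan /schroeder !big_nat_recr //= big_geq.
have {}Orec p : (0 < p)%N -> (O p.+1)%:R =
  \sum_(1 <= k < p.+2) layer_coef q k * (O (p.+1 - k)%N)%:R - q p by apply: Orec.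
have qE i : catalan i + schroeder i = q i by [].
move: q qE cs0 cs1 cs2 Orec => q qE cs0 cs1 cs2 Orec.
have c1 : layer_coef q 1 = 2.
  rewrite /layer_coef big_geq //; change (q 0%N + 0 + 0 - 0 = 2); rewrite cs0; ring.
have c2 : layer_coef q 2 = 4.
  rewrite /layer_coef big_geq //; change (q 1%N + 1 + 0 - 0 = 4); rewrite cs1; ring.
have c3 : layer_coef q 3 = 8.
  rewrite /layer_coef big_nat1; change (q 2%N + 1 + 1 - q 0%N = 8); rewrite cs2 cs0; ring.
have c4 k : (4 <= k)%N -> layer_coef q k =
    q (k - 1)%N - \sum_(1 <= j < (k - 3).+1) q j.
  move=> k4; have k1 : (1 < k)%N by apply: leq_trans k4.
  have k2 : (2 < k)%N by apply: leq_trans k4.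
  have e : (k - 2 = (k - 3).+1)%N by move: k4; clear; lia.
  rewrite /layer_coef e big_ltn // k1 k2 cs0 subn1.
  set S := \sum_(1 <= i < _) _; change (q k.-1 + 1 + 1 - (2 + S) = q k.-1 - S); ring.
have s3 (F : nat -> rat) : \sum_(1 <= k < 3) F k = F 1%N + F 2%N.
  by rewrite 2?big_ltn // big_geq // addr0.
have s4 (F : nat -> rat) : \sum_(1 <= k < 4) F k = F 1%N + F 2%N + F 3%N.
  by rewrite 3?big_ltn // big_geq // addr0 addrA.
have sub_int (n k : nat) : (k <= n)%N -> n%:Z - k%:Z = (n - k)%N.
  by move=> le; rewrite subzn.
have main n : (2 <= n)%N ->
    (O n%:Z)%:R =
      \sum_(1 <= k < 4) 2%:R ^+ k * (O (n%:Z - k%:Z))%:R - q (n - 1)%N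
      + \sum_(4 <= k < n.+1)
          (q (k - 1)%N - \sum_(1 <= j < (k - 3).+1) q j) * (O (n%:Z - k%:Z))%:R :> rat.
  case: n => // n n1; have n0 : (0 < n)%N by [].
  rewrite (Orec n n0) subn1 -pred_Sn addrAC; congr (_ - _).
  have [n2|n2] := ltnP 1 n; last first.
    have -> : n = 1%N by move: n0 n2; clear; lia.
    have -> (F : nat -> rat) : \sum_(4 <= k < 3) F k = 0 by rewrite big_geq.
    rewrite s3 s4 c1 c2 (sub_int 2%N 1%N isT) (sub_int 2%N 2%N isT).
    rewrite -[2%N%:Z - 3%N%:Z]/(-1 : int) Om1 (subnn 2).
    by move: (O (2 - 1)%N) (O 0%N) => u v; ring.
  rewrite (@big_cat_nat _ _ _ 4 _ _ _ _ (isT : (1 <= 4)%N) (n2 : (4 <= n.+2)%N)).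
  congr (_ + _).
    apply: eq_big_nat => k /andP[k1 k4]; rewrite sub_int; last by move: k4 n2; clear; lia.
    congr (_ * _).
    by case: k k1 k4 => [|[|[|[|]]]] // _ _; rewrite ?c1 ?c2 ?c3 ?exprS ?expr0; ring.
  apply: eq_big_nat => k /andP[k4 kn]; rewrite sub_int; last by move: kn; clear; lia.
  by rewrite c4.
have O2 : O 2 = 3%N.
  apply/eqP; rewrite -(eqr_nat rat) (Orec 1%N isT) s3 c1 c2 (subnn 2) O0.
  by rewrite -[(2 - 1)%N]/1%N O1 cs1; apply/eqP; ring.
have O3 : O 3 = 10%N.
  apply/eqP; rewrite -(eqr_nat rat) (Orec 2%N isT) s4 c1 c2 c3 (subnn 3) O0.
  by rewrite -[(3 - 1)%N]/2%N -[(3 - 2)%N]/1%N O1 O2 cs2; apply/eqP; ring.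
split=> // n n2; rewrite (main n n2) qE; congr (_ + _).
apply: eq_bigr => k _; rewrite qE; congr ((_ - _) * _).
by apply: eq_bigr => j _; rewrite qE.
Qed.

End Arithmetic.

Import GroupScope.

(** * Schur partitions as partitions with constant structure functions *)

Section Conv.

Variables (gT : finGroupType) (G : {group gT}).
Implicit Types (A B C X Y : {set gT}) (P Q : {set {set gT}}) (x y z : gT).

(** The coefficient of z in the product of the sums of A and B. *)
Definition conv A B z := #|[set a in A | a^-1 * z \in B]|.

(** Unions of classes of P, called S-sets in the literature. *)
Definition is_pset P X :=
  (X \subset G) && [forall x in X, pblock P x \subset X].

Definition schur P :=
  [/\ partition P G, [set 1] \in P,
      forall C, C \in P -> [set x^-1 | x in C] \in P
    & forall A B C, A \in P -> B \in P -> C \in P ->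
        {in C &, forall z w, conv A B z = conv A B w}].

Lemma is_psetP P X :
  reflect (X \subset G /\ forall x, x \in X -> pblock P x \subset X)
          (is_pset P X).
Proof.
apply: (iffP andP) => -[sXG]; first by move/forall_inP.
by move=> h; split=> //; apply/forall_inP.
Qed.

End Conv.

Section Coef.

Variables (gT : finGroupType) (G : {group gT}).
Local Notation M := 'M[rat]_#|G|.
Local Notation aG := (regular_repr rat G).
Local Open Scope ring_scope.

(** The coordinate of a group ring element at x. *)
Definition coef (x : gT) (A : M) : rat := @gring_proj rat gT G x A 0 0.

Lemma coef_is_linear x : scalar (coef x).
Proof. by move=> a A B; rewrite /coef linearP !mxE. Qed.
HB.instance Definition _ x :=
  GRing.isLinear.Build rat M rat *%R (coef x) (coef_is_linear x).

Lemma coef_repr x y : x \in G -> y \in G -> coef x (aG y) = (x == y)%:R.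
Proof.
by move=> Gx Gy; rewrite /coef gring_projE //; case: (x == y); rewrite !mxE.
Qed.

Lemma coef_gset x (A : {set gT}) :
  x \in G -> A \subset G -> coef x (gset_mx rat G A) = (x \in A)%:R.
Proof.
move=> Gx sAG; rewrite linear_sum.
rewrite (eq_bigr (fun y => (x == y)%:R)) => [|y Ay]; last first.
  exact: coef_repr (subsetP sAG y Ay).
case: (boolP (x \in A)) => xA.
  rewrite (bigD1 x) //= eqxx big1 ?addr0 // => y /andP[_ /negPf].
  by rewrite eq_sym => ->.
by rewrite big1 // => y yA; case: eqP => // e; rewrite e yA in xA.
Qed.

Lemma gset_mul (A B : {set gT}) : A \subset G -> B \subset G ->
  gset_mx rat G A *m gset_mx rat G B = \sum_(z in G) (conv A B z)%:R *: aG z.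
Proof.
move=> sAG sBG; rewrite mulmx_suml.
transitivity (\sum_(a in A) \sum_(z in G) (a^-1 * z \in B)%g%:R *: aG z).
  apply: eq_bigr => a Aa; have Ga := subsetP sAG _ Aa.
  rewrite mulmx_sumr [RHS](eq_bigr (fun z => if (a^-1 * z \in B)%g then aG z else 0));
    last by move=> z _; case: ifP; rewrite ?scale1r ?scale0r.
  rewrite -big_mkcondr /=.
  rewrite (reindex_inj (mulgI a^-1%g)) /=.
  apply: eq_big => [z|z Bz].
    apply/idP/andP=> [Bz|[]//]; split=> //.
    by rewrite -(groupMl _ (groupVr Ga)) (subsetP sBG).
  by rewrite -repr_mxM ?mulKVg // (subsetP sBG).
rewrite exchange_big /=; apply: eq_bigr => z _.
rewrite -scaler_suml; congr (_ *: _).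
rewrite /conv -sum1_card natr_sum big_mkcond [RHS]big_mkcond /=.
by apply: eq_bigr => a _; rewrite inE; case: (a \in A) => //=; case: (_ \in B).
Qed.

Lemma coef_mul (A B : {set gT}) x : A \subset G -> B \subset G -> x \in G ->
  coef x (gset_mx rat G A *m gset_mx rat G B) = (conv A B x)%:R.
Proof.
move=> sAG sBG Gx; rewrite gset_mul // linear_sum (bigD1 x) //= big1 => [|y].
  by rewrite addr0 linearZ /= coef_repr // eqxx mulr1.
case/andP=> Gy /negPf nxy; rewrite linearZ /= coef_repr // eq_sym nxy.
by rewrite mulr0.
Qed.

Section Partition.

Variable P : {set {set gT}}.
Hypothesis partP : partition P G.

Lemma class_sub C : C \in P -> C \subset G.
Proof. by move=> PC; rewrite -(cover_partition partP) (bigcup_max C). Qed.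

(** A class sum has coordinates 0 or 1, constant on each class, and so has any
    combination. *)
Lemma coef_span (A : M) : A \in schur_span G P ->
  forall C, C \in P -> {in C &, forall x y, coef x A = coef y A}.
Proof.
rewrite /schur_span => SA C PC x y Cx Cy.
have [u ->] : exists u : nat -> rat, A = \sum_(i < size [seq gset_mx rat G C | C in P])
     u i *: [seq gset_mx rat G C | C in P]`_i.
  exists (fun i => if insub i is Some j then coord (in_tuple [seq gset_mx rat G C | C in P]) j A else 0).
  rewrite {1}(coord_span (X := in_tuple _) SA) /=.
  by apply: eq_bigr => i _; rewrite valK.
rewrite !linear_sum; apply: eq_bigr => i _; rewrite !linearZ /=; congr (_ * _).
have: [seq gset_mx rat G C | C in P]`_i \in [seq gset_mx rat G C | C in P].
  exact: mem_nth.
case/imageP=> D PD ->.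
have sDG := class_sub PD; have sCG := class_sub PC.
rewrite !coef_gset ?(subsetP sCG) //; congr (_%:R).
case/and3P: partP => _ tP _.
have E z : z \in C -> (z \in D) = (D == C).
  move=> Cz; apply/idP/eqP=> [Dz | -> //].
  by rewrite -(def_pblock tP PD Dz) (def_pblock tP PC Cz).
by rewrite !E.
Qed.

(** Grouping the terms of A by class turns it into a combination of class sums. *)
Lemma spanP (A : M) f :
    A = \sum_(z in G) (f z) *: aG z ->
    (forall C, C \in P -> {in C &, forall x y, f x = f y}) ->
  A \in schur_span G P.
Proof.
move=> -> fP; rewrite (set_partition_big _ partP) /=; apply: memv_suml => C PC.
have [->|[x Cx]] := set_0Vmem C; first by rewrite big_set0 mem0v.
rewrite (eq_bigr (fun z => f x *: aG z)) => [|z Cz]; last by rewrite (fP C PC z x).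
rewrite -scaler_sumr memvZ //; apply: memv_span.
by apply/imageP; exists C.
Qed.

End Partition.

Lemma schur_partitionP P : reflect (schur G P) (schur_partition G P).
Proof.
apply: (iffP and4P) => [[pP P1 Pv Pm] | [pP P1 Pv Pm]].
  split=> //; first by move=> C; exact: (forall_inP Pv).
  move=> A B C PA PB PC x y Cx Cy; have sub := class_sub pP.
  have /forall_inP/(_ B PB) := forall_inP Pm A PA.
  move/coef_span => /(_ pP C PC x y Cx Cy).
  rewrite !coef_mul ?sub ?(subsetP (sub _ PC)) //.
  by move/eqP; rewrite eqr_nat => /eqP.
split=> //; first exact/forall_inP.
apply/forall_inP=> A PA; apply/forall_inP=> B PB; have sub := class_sub pP.
apply: (spanP pP); first by apply: gset_mul; exact: sub.
by move=> C PC x y Cx Cy; rewrite (Pm A B C PA PB PC x y).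
Qed.

Lemma schur_span_sub P Q : partition P G -> partition Q G ->
  schur_span G P = schur_span G Q ->
  forall A B x, A \in P -> B \in Q -> x \in A -> x \in B -> B \subset A.
Proof.
move=> pP pQ e A B x PA QB Ax Bx; apply/subsetP=> y By.
have: gset_mx rat G A \in schur_span G Q.
  by rewrite -e; apply: memv_span; apply/imageP; exists A.
have sub := class_sub pP; have subQ := class_sub pQ.
move/(coef_span pQ) => /(_ _ QB x y Bx By).
rewrite !coef_gset ?sub ?(subsetP (subQ _ QB)) // Ax => /eqP.
by rewrite eqr_nat; case: (y \in A).
Qed.

(** The classes can be read off the span: the sum of a class A of P lies in the
    span of Q only if A is a union of classes of Q. *)
Lemma schur_span_inj :
  {in [pred P | schur_partition G P] &, injective (schur_span G)}.
Proof.
have main P Q : partition P G -> partition Q G ->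
    schur_span G P = schur_span G Q -> P \subset Q.
  move=> pP pQ e; apply/subsetP=> A PA.
  have [x Ax] : exists x, x \in A.
    by apply/set0Pn; case/and3P: pP => _ _; apply: contraNneq => <-.
  have Gx: x \in G by apply: (subsetP (class_sub pP PA)).
  have Gx' : x \in cover Q by rewrite (cover_partition pQ).
  have QB : pblock Q x \in Q by rewrite pblock_mem.
  have Bx : x \in pblock Q x by rewrite mem_pblock.
  suff -> : A = pblock Q x by [].
  apply/eqP; rewrite eqEsubset.
  by rewrite (schur_span_sub pP pQ e PA QB Ax Bx) (schur_span_sub pQ pP _ QB PA Bx Ax).
move=> P Q /schur_partitionP[pP _ _ _] /schur_partitionP[pQ _ _ _] e.
by apply/eqP; rewrite eqEsubset !main.
Qed.

Lemma size_schur_rings :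
  size (schur_rings G) = #|[set P | schur_partition G P]|.
Proof.
rewrite /schur_rings undup_id.
  by rewrite size_map -cardE; apply: eq_card => P; rewrite inE.
rewrite map_inj_in_uniq ?enum_uniq // => P Q.
by rewrite !mem_enum; apply: schur_span_inj.
Qed.

End Coef.

(** * Unions of classes of a Schur partition *)

Section Theory.

Variables (gT : finGroupType) (G : {group gT}) (P : {set {set gT}}).
Hypothesis SP : schur G P.
Implicit Types (A B C X Y : {set gT}) (x y z : gT).

Local Notation cl := (pblock P).
Local Notation pset := (is_pset G P).

Let partP : partition P G. Proof. by case: SP. Qed.
Let trivP : trivIset P. Proof. by case/and3P: partP. Qed.

Lemma mem_cl x : x \in G -> x \in cl x.
Proof. by rewrite mem_pblock (cover_partition partP). Qed.

Lemma cl_class x : x \in G -> cl x \in P.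
Proof. by move=> Gx; rewrite pblock_mem ?(cover_partition partP). Qed.

Lemma cl_eq x y : y \in cl x -> cl y = cl x.
Proof. by move/(same_pblock trivP). Qed.

Lemma cl_def C x : C \in P -> x \in C -> cl x = C.
Proof. exact: def_pblock. Qed.

Lemma class_nonempty C : C \in P -> exists x, x \in C.
Proof.
by move=> PC; apply/set0Pn; case/and3P: partP => _ _; apply: contraNneq => <-.
Qed.

Lemma psetT : pset G.
Proof.
apply/is_psetP; split=> // x Gx.
exact: (class_sub partP) (cl_class Gx).
Qed.

Lemma cl_subG x : x \in G -> cl x \subset G.
Proof. by case/is_psetP: psetT => _; apply. Qed.

Lemma pset_subG X : pset X -> X \subset G.
Proof. by case/is_psetP. Qed.

Lemma pset_cl X x y : pset X -> x \in X -> y \in cl x -> y \in X.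
Proof. by case/is_psetP=> _ h /h/subsetP; apply. Qed.

Lemma psetE X x y : pset X -> x \in G -> y \in cl x -> (y \in X) = (x \in X).
Proof.
move=> pX Gx yx; apply/idP/idP => [Xy|Xx]; last exact: pset_cl yx.
by apply: (pset_cl pX Xy); rewrite (cl_eq yx) mem_cl.
Qed.

Lemma class_pset C : C \in P -> pset C.
Proof.
move=> PC; apply/is_psetP; split; first exact: (class_sub partP).
by move=> x Cx; rewrite (cl_def PC Cx).
Qed.

Lemma pset_class C X : C \in P -> pset X -> X \subset C -> X != set0 -> X = C.
Proof.
move=> PC pX sXC /set0Pn[x Xx]; apply/eqP; rewrite eqEsubset sXC /=.
apply/subsetP=> y Cy; apply: (pset_cl pX Xx).
by rewrite (cl_def PC (subsetP sXC _ Xx)).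
Qed.

Lemma psetD X Y : pset X -> pset Y -> pset (X :\: Y).
Proof.
move=> pX pY; apply/is_psetP; split.
  by apply: subset_trans (pset_subG pX); apply: subsetDl.
move=> x /setDP[Xx Yx]; apply/subsetP=> y yx.
have Gx := subsetP (pset_subG pX) _ Xx.
by rewrite inE (pset_cl pX Xx yx) (psetE pY Gx yx) Yx.
Qed.

Lemma pset1 : pset [set 1].
Proof. by apply: class_pset; case: SP. Qed.

Lemma psetV X : pset X -> pset X^-1.
Proof.
move=> pX; apply/is_psetP; split; first by rewrite -(invGid G) invSg pset_subG.
move=> x; rewrite inE => Xx; apply/subsetP=> y yx; rewrite inE.
have Gx: x \in G by rewrite -groupV (subsetP (pset_subG pX)).
apply: (pset_cl pX Xx).
have PC : [set z^-1 | z in cl x] \in P by case: SP => _ _ h _; apply/h/cl_class.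
by rewrite (cl_def PC) ?imset_f ?mem_cl.
Qed.

Lemma conv_sum A B z : conv A B z = (\sum_(a in A) ((a^-1 * z)%g \in B))%N.
Proof.
rewrite /conv -sum1_card big_mkcond [RHS]big_mkcond /=.
by apply: eq_bigr => a _; rewrite inE; case: (a \in A); case: (_ \in B).
Qed.

Lemma pset_partition X : pset X -> partition [set A in P | A \subset X] X.
Proof.
move=> pX; apply/and3P; split.
- rewrite eqEsubset; apply/andP; split.
    by apply/bigcupsP=> A; rewrite inE => /andP[].
  apply/subsetP=> x Xx; have Gx := subsetP (pset_subG pX) _ Xx.
  apply/bigcupP; exists (cl x); last exact: mem_cl.
  by rewrite inE cl_class //; apply/subsetP=> y; apply: pset_cl.
- by apply: trivIsetS trivP; apply/subsetP=> A; rewrite inE => /andP[].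
- by rewrite inE; case/and3P: partP => _ _ /negPf->.
Qed.

(** Sum the structure constants over the classes contained in X and in Y. *)
Lemma conv_class X Y z w : pset X -> pset Y -> z \in G -> w \in cl z ->
  conv X Y w = conv X Y z.
Proof.
move=> pX pY Gz wz; rewrite !conv_sum.
rewrite !(set_partition_big _ (pset_partition pX)) /=.
apply: eq_bigr => A; rewrite inE => /andP[PA _].
have E u : (\sum_(a in A) ((a^-1 * u)%g \in Y))%N =
   (\sum_(B in [set B in P | B \subset Y]) conv A B u)%N.
  under [RHS]eq_bigr do rewrite conv_sum.
  rewrite exchange_big /=; apply: eq_bigr => a Aa.
  case: (boolP (a^-1 * u \in Y)) => Yu.
    have Gu := subsetP (pset_subG pY) _ Yu.
    rewrite (bigD1 (cl (a^-1 * u))) /=; last first.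
      by rewrite inE cl_class //; apply/subsetP=> y; apply: pset_cl.
    rewrite mem_cl // big1 // => B; rewrite inE => /andP[/andP[PB _] nB].
    case: (boolP (_ \in B)) => // uB.
    by rewrite (cl_def PB uB) eqxx in nB.
  rewrite big1 // => B; rewrite inE => /andP[_ /subsetP sBY].
  by case: (boolP (_ \in B)) => // /sBY; rewrite (negPf Yu).
rewrite !E; apply: eq_bigr => B; rewrite inE => /andP[PB _].
case: SP => _ _ _ h; exact: (h A B (cl z) PA PB (cl_class Gz) w z wz (mem_cl Gz)).
Qed.

Lemma pset_fun (T : eqType) (f : gT -> T) (q : pred T) :
    (forall z w, z \in G -> w \in cl z -> f w = f z) ->
  pset [set z in G | q (f z)].
Proof.
move=> h; apply/is_psetP; split; first by apply/subsetP=> x; rewrite inE => /andP[].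
move=> x; rewrite inE => /andP[Gx qx]; apply/subsetP=> y yx.
by rewrite inE (h x y) // qx (subsetP (cl_subG Gx)).
Qed.

Lemma pset_conv X Y (q : pred nat) : pset X -> pset Y ->
  pset [set z in G | q (conv X Y z)].
Proof. by move=> pX pY; apply: pset_fun => z w; apply: conv_class. Qed.

(** X Y is the support of a function that is constant on classes. *)
Lemma psetM X Y : pset X -> pset Y -> pset (X * Y).
Proof.
move=> pX pY; suff -> : X * Y = [set z in G | (conv X Y z > 0)%N].
  exact: (pset_conv (fun n => (n > 0)%N)).
apply/setP=> z; rewrite inE; apply/idP/andP.
  case/mulsgP=> x y Xx Yy ->.
  rewrite groupM ?(subsetP (pset_subG pX) _ Xx) ?(subsetP (pset_subG pY) _ Yy) //.
  by split=> //; apply/card_gt0P; exists x; rewrite inE Xx mulKg.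
case=> Gz /card_gt0P[a]; rewrite inE => /andP[Xa Ya].
by apply/mulsgP; exists a (a^-1 * z) => //; rewrite mulKVg.
Qed.

(** The largest union of classes inside the generated subgroup contains X and is
    closed under products, hence is the whole subgroup. *)
Lemma pset_gen X : pset X -> pset <<X>>.
Proof.
move=> pX; have sG : <<X>> \subset G by rewrite gen_subG pset_subG.
pose Y := [set y in G | cl y \subset <<X>>].
have pY : pset Y.
  by apply: (pset_fun (f := cl) (fun C => C \subset <<X>>)) => z w _; apply: cl_eq.
have sYX : Y \subset <<X>>.
  apply/subsetP=> y; rewrite inE => /andP[Gy /subsetP]; apply.
  exact: mem_cl.
have maxY Z : pset Z -> Z \subset <<X>> -> Z \subset Y.
  move=> pZ sZ; apply/subsetP=> z Zz; rewrite inE (subsetP (pset_subG pZ)) //=.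
  by apply: subset_trans sZ; case/is_psetP: pZ => _; apply.
have gY : group_set Y.
  apply/group_setP; split.
    by apply: (subsetP (maxY _ pset1 _)); rewrite ?sub1set ?inE.
  move=> x y Yx Yy; apply: (subsetP (maxY _ (psetM pY pY) _)); last exact: mem_mulg.
  by apply: subset_trans (mulgSS sYX sYX) _; rewrite mulGid.
suff <- : Y = <<X>> by [].
apply/eqP; rewrite eqEsubset sYX /= (gen_subG X (Group gY)) /=.
exact/maxY/subset_gen.
Qed.

(** g stabilizes C exactly when all elements of C yield a factorization of g in
    C C^-1, that is when g occurs #|C| times. *)
Lemma pset_stab C : pset C -> pset [set g in G | g *: C == C].
Proof.
move=> pC; have sCG := pset_subG pC.
suff -> : [set g in G | g *: C == C] = [set g in G | conv C C^-1 g == #|C|].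
  by apply: (pset_conv (fun n => n == #|C|)) => //; apply: psetV.
apply/setP=> g; rewrite !inE; case Gg: (g \in G) => //=.
apply/eqP/eqP=> [e|e].
  congr #|pred_of_set _|; apply/setP=> a; rewrite !inE invMg invgK.
  case Ca: (a \in C) => //=.
  by rewrite -{1}e mem_lcoset in Ca.
have /eqP e2: [set a in C | a^-1 * g \in C^-1] == C.
  by rewrite eqEcard -/(conv _ _ _) e leqnn andbT; apply/subsetP=> a; rewrite inE => /andP[].
apply/eqP; rewrite eq_sym eqEcard card_lcoset leqnn andbT.
apply/subsetP=> a; rewrite -{1}e2 !inE invMg invgK => /andP[_].
by rewrite mem_lcoset.
Qed.

(** The intersection of C with z H counts the factorizations of z in C H. *)
Lemma card_class_coset (H : {group gT}) C z w : pset H -> C \in P -> z \in C -> w \in C ->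
  #|C :&: z *: H| = #|C :&: w *: H|.
Proof.
move=> pH PC Cz Cw; have sCG := pset_subG (class_pset PC).
have E u : conv C H u = #|C :&: u *: H|.
  apply: eq_card => a; rewrite !inE mem_lcoset -(groupV H) invMg invgK.
  by [].
rewrite -!E; apply: conv_class => //.
- exact: class_pset.
- exact: (subsetP sCG).
- by rewrite (cl_def PC Cw).
Qed.

End Theory.

(** * Images of Schur partitions under morphisms *)

Section Push.

Variables (gT rT : finGroupType) (G : {group gT}) (f : {morphism G >-> rT}).
Implicit Types (P : {set {set gT}}) (A B C : {set gT}).

Definition push P : {set {set rT}} := [set f @: C | C : {set gT} in P].

Variable P : {set {set gT}}.
Hypotheses (SP : schur G P) (kerP : is_pset G P ('ker f)).

Local Notation cl := (pblock P).

Lemma mem_push C y : C \subset G -> y \in G ->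
  (f y \in f @: C) = (y \in C * 'ker f).
Proof.
move=> sCG Gy; apply/imsetP/mulsgP => [[x Cx]|[x k Cx Kk ->]].
  have Gx := subsetP sCG _ Cx.
  case/(rcoset_kerP f Gy Gx)/rcosetP=> k Kk ->; exists x (k ^ x) => //.
    by rewrite memJ_norm // (subsetP (ker_norm f)).
  exact: conjgC.
exists x => //; have Gx := subsetP sCG _ Cx; have Gk := dom_ker Kk.
by rewrite morphM // (mker Kk) mulg1.
Qed.

(** The preimage of the image of C is C K with K the kernel, again a union of
    classes; so images of classes are equal as soon as they meet. *)
Lemma push_eq C y : C \in P -> y \in G -> f y \in f @: C -> f @: cl y = f @: C.
Proof.
have main D z : D \in P -> z \in G -> f z \in f @: D -> f @: cl z \subset f @: D.
  move=> PD Gz; have sDG := pset_subG (class_pset SP PD).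
  rewrite mem_push // => Dz; apply/subsetP=> _ /imsetP[w wz ->].
  rewrite mem_push ?(subsetP (cl_subG SP Gz)) //.
  exact: (pset_cl (psetM SP (class_pset SP PD) kerP) Dz wz).
move=> PC Gy Cy; apply/eqP; rewrite eqEsubset main //=.
case/imsetP: Cy => c Cc e; rewrite -(cl_def SP PC Cc).
have Gc := subsetP (pset_subG (class_pset SP PC)) _ Cc.
apply: (main _ _ (cl_class SP Gy) Gc); rewrite -e.
exact: imset_f (mem_cl SP Gy).
Qed.

Lemma push_partition : partition (push P) (f @* G).
Proof.
apply/and3P; split.
- rewrite eqEsubset; apply/andP; split.
    apply/bigcupsP=> _ /imsetP[C PC ->].
    rewrite morphimEdom imsetS //; exact: pset_subG (class_pset SP PC).
  rewrite morphimEdom; apply/subsetP=> _ /imsetP[x Gx ->].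
  apply/bigcupP; exists (f @: cl x); last by rewrite imset_f ?(mem_cl SP).
  by rewrite imset_f ?(cl_class SP).
- apply/trivIsetP=> _ _ /imsetP[A PA ->] /imsetP[B PB ->] nAB.
  apply/pred0Pn=> -[_ /andP[/imsetP[x Ax ->] /= Bx]].
  have Gx := subsetP (pset_subG (class_pset SP PA)) _ Ax.
  by rewrite -(push_eq PA Gx (imset_f _ Ax)) -(push_eq PB Gx Bx) eqxx in nAB.
apply/imsetP=> -[C PC e]; have [x Cx] := class_nonempty SP PC.
by have := imset_f f Cx; rewrite -e inE.
Qed.

Lemma pblock_push x : x \in G -> pblock (push P) (f x) = f @: cl x.
Proof.
move=> Gx; have /and3P[_ tP _] := push_partition.
by apply: (def_pblock tP); rewrite imset_f ?(cl_class SP) ?(mem_cl SP).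
Qed.

Lemma card_preim_morphism (R : {set rT}) : R \subset f @* G ->
  #|f @*^-1 R| = (#|'ker f| * #|R|)%N.
Proof.
move=> sR; rewrite -sum1_card (partition_big f (mem R)) /=; last first.
  by move=> x; rewrite !inE => /andP[].
rewrite mulnC -sum_nat_const; apply: eq_bigr => b Rb.
have /imsetP[x Gx eb] : b \in f @: G by rewrite -morphimEdom (subsetP sR).
rewrite sum1_card -(card_rcoset ('ker f) x); apply: eq_card => y.
rewrite -[LHS]/((y \in f @*^-1 R) && (f y == b)).
have -> : (y \in f @*^-1 R) = (y \in G) && (f y \in R) by rewrite !inE.
apply/andP/idP=> [[/andP[Gy _] /eqP e]|yx].
  by apply/(rcoset_kerP f Gy Gx); rewrite e.
have Gy : y \in G.
  by case/rcosetP: yx => k Kk ->; rewrite groupM // (dom_ker Kk).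
have e : f y = b by rewrite eb; apply/(rcoset_kerP f Gy Gx).
by rewrite Gy e Rb eqxx.
Qed.

(** Factorizations in the image lift to the sets A K and B K, each one to as many
    as there are elements in the kernel K. *)
Lemma conv_push A B z : A \in P -> B \in P -> z \in G ->
  (#|'ker f| * conv (f @: A) (f @: B) (f z))%N = conv (A * 'ker f) (B * 'ker f) z.
Proof.
move=> PA PB Gz.
have sAG := pset_subG (class_pset SP PA).
have sBG := pset_subG (class_pset SP PB).
rewrite -card_preim_morphism.
  apply: eq_card => a; rewrite !inE.
  case Ga: (a \in G) => /=.
    by rewrite mem_push // -morphV // -morphM ?groupV // mem_push ?groupM ?groupV.
  apply/esym/negbTE; rewrite negb_and; apply/orP; left; apply/negP=> h.
  case/mulsgP: h Ga => x k Ax Kk ->.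
  by rewrite groupM ?(subsetP sAG _ Ax) // (dom_ker Kk).
apply/subsetP=> a; rewrite inE => /andP[/imsetP[x Ax ->] _].
by rewrite mem_morphim ?(subsetP sAG).
Qed.

Lemma schur_push : schur (f @* G) (push P).
Proof.
split; first exact: push_partition.
- apply/imsetP; exists [set 1]; first by case: SP.
  by rewrite imset_set1 morph1.
- move=> _ /imsetP[C PC ->]; apply/imsetP; exists [set x^-1 | x in C].
    by case: SP => _ _ h _; apply: h.
  rewrite -!imset_comp; apply: eq_in_imset => x Cx /=.
  by rewrite morphV // (subsetP (pset_subG (class_pset SP PC))).
move=> _ _ _ /imsetP[A PA ->] /imsetP[B PB ->] /imsetP[C PC ->].
move=> _ _ /imsetP[x Cx ->] /imsetP[y Cy ->].
have sCG := subsetP (pset_subG (class_pset SP PC)).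
apply/eqP; rewrite -(eqn_pmul2l (cardG_gt0 ('ker f)%G)) !conv_push ?sCG //; apply/eqP.
apply: (conv_class SP); rewrite ?sCG //; last by rewrite (cl_def SP PC Cy).
  by apply: psetM => //; apply: class_pset.
by apply: psetM => //; apply: class_pset.
Qed.

End Push.

(** Pushing forward along an injective morphism is injective on partitions. *)
Lemma card_schur_isog (gT rT : finGroupType) (G : {group gT}) (H : {group rT}) :
  G \isog H ->
  #|[set P | schur_partition G P]| = #|[set P | schur_partition H P]|.
Proof.
have main (aT bT : finGroupType) (A : {group aT}) (B : {group bT}) : A \isog B ->
  (#|[set P | schur_partition A P]| <= #|[set P | schur_partition B P]|)%N.
  case/isogP=> f injf e.
  have {}e : (f @* A)%G = B by apply: val_inj.
  have kP P : schur A P -> is_pset A P ('ker f).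
    by move=> SP; have /trivgP -> := injf; apply: pset1.
  rewrite -(card_in_imset (f := push f)).
    apply/subset_leq_card/subsetP=> _ /imsetP[P hP ->]; rewrite inE in hP.
    have SP := schur_partitionP _ _ hP.
    by rewrite inE -e; apply/schur_partitionP/schur_push => //; apply: kP.
  move=> P Q; rewrite !inE => /schur_partitionP SP /schur_partitionP SQ ePQ.
  have sub P1 Q1 : schur A P1 -> schur A Q1 -> push f P1 = push f Q1 -> P1 \subset Q1.
    move=> S1 S2 e1; apply/subsetP=> C PC.
    have : f @: C \in push f Q1 by rewrite -e1 imset_f.
    case/imsetP=> D QD eCD; suff -> : C = D by [].
    have sCA := pset_subG (class_pset S1 PC); have sDA := pset_subG (class_pset S2 QD).
    apply: (injm_morphim_inj injf) => //.
    by rewrite !morphimEsub.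
  by apply/eqP; rewrite eqEsubset !sub.
by move=> iGH; apply/eqP; rewrite eqn_leq !main // isog_sym.
Qed.

(** * Schur's theorem on multipliers *)

Section Multiplier.

Variables (gT : finGroupType) (G : {group gT}) (P : {set {set gT}}).
Hypotheses (SP : schur G P) (cycG : cyclic G).

Local Notation cl := (pblock P).
Local Notation pset := (is_pset G P).

Definition pow_set (k : nat) (A : {set gT}) := [set x ^+ k | x in A].

Definition class_fun (T : Type) (u : gT -> T) :=
  forall z w, z \in G -> w \in cl z -> u w = u z.

Lemma class_fun_conv (R : pzRingType) (u : gT -> R) (X : {set gT}) :
  class_fun u -> pset X -> class_fun (fun z => \sum_(b in X) u (b^-1 * z)%g)%R.
Proof.
move=> cu pX z w Gz wz; have sXG := pset_subG pX.
have E y : y \in G -> (\sum_(b in X) u (b^-1 * y)%g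
     = \sum_(C in P) u (repr C) * (conv C X y)%:R)%R.
  move=> Gy; transitivity (\sum_(c in G) u c * (c^-1 * y \in X)%g%:R)%R.
    rewrite (reindex_inj (h := fun c => y * c^-1)) /=; last first.
      by move=> a b /mulgI/invg_inj.
    rewrite big_mkcond [RHS]big_mkcond /=; apply: eq_bigr => c _.
    rewrite invMg invgK mulgKV.
    case Gc: (c \in G); last first.
      case: ifP => // yX; move: (subsetP sXG _ yX).
      by rewrite groupMl // groupV Gc.
    have -> : y * c^-1 = c^-1 * y.
      by apply: (centsP (cyclic_abelian cycG)); rewrite ?groupV.
    by case: ifP; rewrite ?mulr1 ?mulr0.
  case: SP => pP _ _ _; rewrite (set_partition_big _ pP) /=.
  apply: eq_bigr => C PC; rewrite conv_sum natr_sum mulr_sumr.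
  apply: eq_bigr => c Cc; congr (_ * _)%R.
  have [x Cx] := class_nonempty SP PC; have rC := mem_repr x Cx.
  apply: cu; first exact: subsetP (pset_subG (class_pset SP PC)) _ rC.
  by rewrite (cl_def SP PC rC).
have Gw := subsetP (cl_subG SP Gz) _ wz.
rewrite !E //; apply: eq_bigr => C PC; congr (_ * _%:R)%R.
exact: (conv_class SP (class_pset SP PC) pX Gz wz).
Qed.

(** Modulo p the p-th power of the sum of T is the sum of the p-th powers of the
    elements of T, and its coefficients are constant on classes.  The group
    algebra is handled as polynomials in a generator g: [phi] reads off the
    coefficient at z of the element that a polynomial represents. *)
Lemma pset_power_prime p T : prime p -> coprime #|G| p -> pset T ->
  pset (pow_set p T).
Proof.
move=> pr_p cop pT; have sTG := pset_subG pT.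
case/cyclicP: (cycG) => g eG.
have [e eE] : exists e : gT -> nat, forall x, x \in G -> g ^+ e x = x.
  suff : forall x, exists i, x \in G -> g ^+ i = x by apply: fin_all_exists.
  move=> x; case Gx: (x \in G); last by exists 0%N.
  by move: (Gx); rewrite eG => /cycleP[i ->]; exists i.
pose phi (h : {poly 'F_p}) (z : gT) : 'F_p := (\sum_(k < size h) h`_k * (g ^+ k == z)%g%:R)%R.
have phiE n (h : {poly 'F_p}) z : (size h <= n)%N -> (phi h z = \sum_(k < n) h`_k * (g ^+ k == z)%g%:R)%R.
  move=> le; rewrite /phi (big_ord_widen n (fun k => h`_k * (g ^+ k == z)%g%:R)%R) //.
  rewrite big_mkcond /=; apply: eq_bigr => k _; case: ltnP => // ?.
  by rewrite nth_default ?mul0r.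
have phiD (h1 h2 : {poly 'F_p}) z : (phi (h1 + h2) z = phi h1 z + phi h2 z)%R.
  pose n := maxn (size h1) (size h2).
  rewrite !(phiE n) ?leq_maxl ?leq_maxr // ?(leq_trans (size_polyD _ _)) //.
  by rewrite -big_split; apply: eq_bigr => k _; rewrite coefD mulrDl.
have phi0 z : (phi 0 z = 0)%R by rewrite /phi size_poly0 big_ord0.
have phi_sum I (s : seq I) (Q : pred I) (F : I -> {poly 'F_p}) z :
    (phi (\sum_(i <- s | Q i) F i) z = \sum_(i <- s | Q i) phi (F i) z)%R.
  by apply: (big_morph (fun h => phi h z)) => // *; apply: phiD.
have phiX (h : {poly 'F_p}) i z : (phi (h * 'X^i) z = phi h (g ^- i * z)%g)%R.
  have le : (size (h * 'X^i)%R <= i + size h)%N.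
    by apply: leq_trans (size_polyMleq _ _) _; rewrite size_polyXn addnS addnC.
  rewrite (phiE _ _ _ le) big_split_ord /= big1 ?add0r => [|k _]; last first.
    by rewrite coefMXn ltn_ord mul0r.
  apply: eq_bigr => k _; rewrite coefMXn ltnNge leq_addr /= addKn.
  by rewrite expgD (can2_eq (mulKg _) (mulKVg _)).
have phi1 z : (phi 1 z = (1 == z)%g%:R)%R.
  by rewrite /phi size_poly1 big_ord1 coef1 mul1r expg0.
pose f : {poly 'F_p} := (\sum_(x in T) 'X^(e x))%R.
have phif k : class_fun (phi (f ^+ k.+1)%R).
  have phiM (h : {poly 'F_p}) z : (phi (h * f) z = \sum_(b in T) phi h (b^-1 * z)%g)%R.
    rewrite mulr_sumr phi_sum; apply: eq_bigr => b Tb.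
    by rewrite phiX eE // (subsetP sTG).
  have ext (u v : gT -> 'F_p) : (forall z, u z = v z) -> class_fun u -> class_fun v.
    by move=> uv cu z w Gz wz; rewrite -!uv; apply: cu.
  elim: k => [|k IHk].
    apply: (ext (fun z => \sum_(b in T) phi 1 (b^-1 * z)%g)%R) => [z|].
      by rewrite -phiM mul1r.
    apply: class_fun_conv => // z w Gz wz; rewrite !phi1 ![1 == _]eq_sym.
    have := psetE SP (pset1 SP) Gz wz; rewrite !inE => ->.
    by [].
  apply: (ext (fun z => \sum_(b in T) phi (f ^+ k.+1)%R (b^-1 * z)%g)%R) => [z|].
    by rewrite -phiM -exprSr.
  exact: (class_fun_conv (u := phi (f ^+ k.+1)%R) IHk pT).
have chp : (p \in [pchar {poly 'F_p}])%R by rewrite pchar_poly pchar_Fp.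
have phip z : (phi (f ^+ p)%R z = \sum_(x in T) (x ^+ p == z)%g%:R)%R.
  rewrite -(pFrobenius_autE chp) /f rmorph_sum phi_sum /=.
  apply: eq_bigr => x Tx; rewrite pFrobenius_autE -exprM -[('X^_)%R]mul1r phiX phi1.
  by rewrite expgM eE ?(subsetP sTG) // [1 == _]eq_sym -eq_mulVg1.
have injp : {in G &, injective (fun x => x ^+ p)}.
  move=> x y Gx Gy exy; have [k Ek] : exists k, forall x, x \in G -> (x ^+ p) ^+ k = x.
    exists (expg_invn G p) => u Gu; exact: expgK.
  by rewrite -(Ek x) // exy Ek.
have -> : pow_set p T = [set z in G | (phi (f ^+ p) z == 1)%R].
  apply/setP=> z; rewrite inE; apply/imsetP/andP.
    case=> x Tx ->; have Gx := subsetP sTG _ Tx; rewrite groupX //; split=> //.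
    rewrite phip (bigD1 x) //= eqxx big1 ?addr0 // => y /andP[Ty nyx].
    case: eqP => // /injp e1; rewrite e1 ?eqxx ?(subsetP sTG) // in nyx.
  case=> Gz /eqP e1; case: (pickP [pred x in T | x ^+ p == z]) => [x|none].
    by case/andP=> Tx /eqP <-; exists x.
  have := e1; rewrite phip big1 => [/eqP|x Tx]; first by rewrite eq_sym oner_eq0.
  by have := none x; rewrite /= Tx /= => ->.
have := phif p.-1; rewrite (prednK (prime_gt0 pr_p)) => cp.
exact: (pset_fun SP (fun c => c == 1)%R cp).
Qed.

Lemma pset_power k T : coprime #|G| k -> pset T -> pset (pow_set k T).
Proof.
have [n le_kn] := ubnP k; elim: n k T le_kn => // n IHn k T le_kn cop pT.
have [k1|] := leqP k 1.
  move: cop; case: k k1 {le_kn} => [|[|//]] _ cop.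
    have G1 : G :=: 1 by apply/trivgP; rewrite -(card_le1_trivg (G := G)) ?subxx //; move: cop; rewrite /coprime gcdn0 => /eqP->.
    have [->|nT] := eqVneq T set0.
      rewrite /pow_set imset0; apply/is_psetP; split; first exact: sub0set.
      by move=> x; rewrite inE.
    rewrite /pow_set; have -> : [set x ^+ 0 | x in T] = [set 1].
      apply/setP=> y; rewrite inE; apply/imsetP/eqP=> [[x _ ->]|->]; first by rewrite expg0.
      by case/set0Pn: nT => x Tx; exists x.
    exact: pset1.
  have -> // : pow_set 1 T = T by rewrite /pow_set -[RHS]imset_id; apply: eq_imset => x; rewrite expg1.
move=> k1; pose p := pdiv k; have pr_p : prime p by apply: pdiv_prime.
have /dvdnP[q ek] : p %| k by apply: pdiv_dvd.
have q_gt0 : (0 < q)%N by case: q ek k1 => // ->.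
have -> : pow_set k T = pow_set p (pow_set q T).
  rewrite /pow_set -imset_comp; apply: eq_imset => x /=.
  by rewrite ek expgM.
move: cop; rewrite ek coprimeMr => /andP[copq copp].
apply: pset_power_prime => //; apply: IHn => //.
rewrite -ltnS; apply: leq_trans le_kn; rewrite ltnS ek -{1}(muln1 q) ltn_pmul2l //.
exact: prime_gt1.
Qed.

(** The power map is invertible by a power map, so the union of classes obtained
    from C cannot be larger than one class. *)
Lemma power_class k C : coprime #|G| k -> C \in P -> pow_set k C \in P.
Proof.
move=> cop PC; have pC := class_pset SP PC; have sCG := pset_subG pC.
have pk := pset_power cop pC; have sk := pset_subG pk.
have [x Cx] := class_nonempty SP PC; have Gx := subsetP sCG _ Cx.
have Gxk : x ^+ k \in G by rewrite groupX.
have copi : coprime #|G| (expg_invn G k).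
  rewrite /expg_invn; have [k0|k0] := posnP k.
    by move: cop; rewrite k0 /coprime gcdn0 => /eqP->; rewrite gcd1n.
  have [km kn e _] := egcdnP #|G| k0; rewrite /=.
  have e1 : (km * k = kn * #|G| + 1)%N by rewrite e gcdnC (eqnP cop).
  apply/eqP; have d := dvdn_gcdr #|G| km; have d' := dvdn_gcdl #|G| km.
  apply/eqP; rewrite -dvdn1 -(dvdn_addr _ (dvdn_mull kn d')) -e1.
  exact: dvdn_mulr.
have sub : cl (x ^+ k) \subset pow_set k C.
  by apply/subsetP=> y; apply: (pset_cl pk); apply: imset_f.
have pi := pset_power copi (class_pset SP (cl_class SP Gxk)).
have e : pow_set (expg_invn G k) (cl (x ^+ k)) = C.
  apply: (pset_class SP PC pi).
    apply/subsetP=> _ /imsetP[y yx ->].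
    have /imsetP[c Cc ->] := subsetP sub _ yx.
    by rewrite expgK // (subsetP sCG).
  by apply/set0Pn; exists ((x ^+ k) ^+ expg_invn G k); apply: imset_f; apply: (mem_cl SP).
suff <- : cl (x ^+ k) = pow_set k C by exact: (cl_class SP Gxk).
apply/eqP; rewrite eqEcard sub /= -{1}e.
apply: leq_trans (leq_imset_card _ _) (leq_imset_card _ _).
Qed.

Lemma cl_power k x : coprime #|G| k -> x \in G -> cl (x ^+ k) = pow_set k (cl x).
Proof.
move=> cop Gx; apply: (cl_def SP).
  exact: (power_class cop (cl_class SP Gx)).
by apply: imset_f; apply: (mem_cl SP).
Qed.

End Multiplier.

(** * The chain of subgroups of a cyclic 2-group *)

(** The subgroup of order 2^i, presented by an equation so that subgroups of
    subgroups ([tors_tors]) and images under power maps compare at once. *)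
Definition torsion (gT : finGroupType) (G : {group gT}) (i : nat) : {group gT} :=
  <<'Ldiv_(2 ^ i)(G)>>%G.
Arguments torsion : simpl never.

Section Torsion.

Variables (gT : finGroupType) (G : {group gT}) (n : nat).
Hypotheses (cycG : cyclic G) (cardG : #|G| = (2 ^ n)%N).
Implicit Types (x y z u w : gT) (i j k : nat).
Local Notation tors := (torsion G).

Lemma commG x y : x \in G -> y \in G -> x * y = y * x.
Proof. by move=> Gx Gy; apply: (centsP (cyclic_abelian cycG)). Qed.

Lemma mem_tors x i : (x \in tors i) = (x \in G) && (x ^+ (2 ^ i) == 1).
Proof.
rewrite /tors /= gen_set_id; first by rewrite !inE.
apply/group_setP; split=> [|y z]; first by rewrite !inE group1 expg1n eqxx.
rewrite !inE => /andP[Gy /eqP y1] /andP[Gz /eqP z1]; rewrite groupM //=.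
by rewrite expgMn ?y1 ?z1 ?mulg1 //; apply: commG.
Qed.

Lemma tors_subG i : tors i \subset G.
Proof. by apply/subsetP=> x; rewrite mem_tors => /andP[]. Qed.

Lemma torsG x i : x \in tors i -> x \in G.
Proof. exact: subsetP (tors_subG i) x. Qed.

Lemma torsS i j : (i <= j)%N -> tors i \subset tors j.
Proof.
move=> le; apply/subsetP=> x; rewrite !mem_tors => /andP[-> /eqP x1] /=.
by rewrite -(subnKC le) expnD expgM x1 expg1n.
Qed.

Lemma tors_le x i j : (i <= j)%N -> x \in tors i -> x \in tors j.
Proof. by move/torsS/subsetP; apply. Qed.

Lemma tors_top i : (n <= i)%N -> tors i = G.
Proof.
move=> le; apply/val_inj/eqP; rewrite /= eqEsubset tors_subG /=.
apply/subsetP=> x Gx; apply: (tors_le le); rewrite mem_tors Gx.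
by rewrite -cardG expg_cardG ?eqxx.
Qed.

Lemma tors0 : tors 0 = 1%G.
Proof.
apply/val_inj/setP=> x; rewrite mem_tors inE expg1; apply: andb_idl.
by move/eqP->.
Qed.

Lemma mem_tors0 x : (x \in tors 0) = (x == 1).
Proof. by rewrite tors0 inE. Qed.

Lemma card_tors i : (i <= n)%N -> #|tors i| = (2 ^ i)%N.
Proof.
move=> le; case/cyclicP: (cycG) => g eG.
have og : #[g] = (2 ^ n)%N by rewrite orderE -eG.
have oh : #[g ^+ (2 ^ (n - i))] = (2 ^ i)%N.
  rewrite orderXdiv ?og ?dvdn_exp2l ?leq_subr // -{1}(subnKC le) expnD.
  by rewrite mulnK ?expn_gt0.
have hi : g ^+ (2 ^ (n - i)) \in tors i.
  have h1 : (g ^+ (2 ^ (n - i))) ^+ (2 ^ i) = 1 by rewrite -oh expg_order.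
  by rewrite mem_tors h1 eqxx eG mem_cycle.
have d1 : (2 ^ i %| #|tors i|)%N by rewrite -oh order_dvdG.
have /cyclicP[h eh] := cyclicS (tors_subG i) cycG.
have d2 : (#|tors i| %| 2 ^ i)%N.
  have : h \in tors i by rewrite eh cycle_id.
  by rewrite mem_tors => /andP[_]; rewrite -order_dvdn orderE -eh.
by apply/eqP; rewrite eqn_dvd d1 d2.
Qed.

Lemma sub_tors (H : {group gT}) : H \subset G ->
  exists2 i, (i <= n)%N & H = tors i.
Proof.
move=> sHG; have := cardSg sHG; rewrite cardG => /(dvdn_pfactor _ _ (isT : prime 2))[i le e].
exists i => //; apply/val_inj/eqP.
rewrite (eq_subG_cyclic cycG) ?tors_subG //.
by rewrite card_tors // e.
Qed.

Lemma tors_inj i j : (i <= n)%N -> (j <= n)%N -> tors i = tors j -> i = j.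
Proof.
move=> li lj e; apply/eqP.
by rewrite -(eqn_exp2l i j (isT : 1 < 2)%N) -!card_tors // e.
Qed.

Lemma sub_torsE i j : (i <= n)%N -> (tors i \subset tors j) = (i <= j)%N.
Proof.
move=> li; apply/idP/idP; last exact: torsS.
move=> s; rewrite leqNgt; apply/negP=> ji.
have := subset_leq_card s; rewrite !card_tors ?(leq_trans (ltnW ji)) //.
by rewrite leq_exp2l // leqNgt ji.
Qed.

Lemma sq_tors x i : x \in G -> (x ^+ 2 \in tors i) = (x \in tors i.+1).
Proof. by move=> Gx; rewrite !mem_tors groupX // Gx -expgM -expnS. Qed.

Lemma odd_tors x k i : odd k -> x \in G -> (x ^+ k \in tors i) = (x \in tors i).
Proof.
move=> ok Gx; rewrite !mem_tors groupX // Gx /= -expgM mulnC expgM.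
have cop : coprime #|G| k by rewrite cardG coprimeXl // coprime2n.
have Gy : x ^+ (2 ^ i) \in G by rewrite groupX.
apply/eqP/eqP=> [e|->]; last exact: expg1n.
by rewrite -(expgK cop Gy) /= e expg1n.
Qed.

Lemma gen_tors x i : x \in tors i.+1 -> x \notin tors i -> <[x]> = tors i.+1.
Proof.
move=> xi nx; have Gx := torsG xi.
have [j lej ej] : exists2 j, (j <= n)%N & <[x]>%G = tors j.
  by apply: sub_tors; rewrite cycle_subG.
have -> : <[x]> = tors j by rewrite -ej.
apply/eqP; rewrite eqEsubset -{1}ej /= cycle_subG xi /=.
apply: torsS; rewrite ltnNge; apply: contra nx => lji.
by apply: (tors_le lji); rewrite -ej /= cycle_id.
Qed.

Lemma top_gen x : (0 < n)%N -> x \in G -> x \notin tors n.-1 -> <[x]> = G.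
Proof.
move=> n0 Gx nx; have e := prednK n0.
have -> : G :=: tors n.-1.+1 by rewrite e tors_top.
by apply: gen_tors => //; rewrite e tors_top.
Qed.

Lemma pow_tors x k i : <[x]> = G -> (i <= n)%N ->
  (x ^+ k \in tors i) = (2 ^ (n - i) %| k)%N.
Proof.
move=> ex le; rewrite mem_tors groupX /=; last by rewrite -ex cycle_id.
rewrite -expgM -order_dvdn orderE ex cardG -{1}(subnK le) expnD.
by rewrite dvdn_pmul2r // expn_gt0.
Qed.

Lemma rank_tors x : x \in G -> x != 1 ->
  exists i, [/\ (i < n)%N, x \in tors i.+1 & x \notin tors i].
Proof.
move=> Gx nx; have ex : exists i, x \in tors i by exists n; rewrite tors_top.
case: (ex_minnP ex) => -[|i] xi mini; first by rewrite mem_tors0 (negPf nx) in xi.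
exists i; split=> //; first by apply: mini; rewrite tors_top.
by apply/negP=> /mini; rewrite ltnn.
Qed.

Lemma tors_diff x y i : x \in tors i.+1 -> x \notin tors i ->
  y \in tors i.+1 -> y \notin tors i -> x^-1 * y \in tors i.
Proof.
move=> xi nx yi ny; have := gen_tors xi nx => ex.
have : y \in <[x]> by rewrite ex.
case/cycleP=> k ek; have Gx := torsG xi.
have ok : odd k.
  apply: contraR ny => ek2; rewrite ek -[k]odd_double_half (negPf ek2) add0n -mul2n.
  by rewrite expgM groupX // sq_tors.
rewrite ek -[k]odd_double_half ok expgD expg1 mulKg -mul2n expgM groupX //.
by rewrite sq_tors.
Qed.

(** The unique involution, together with the description of the subgroup of order
    2 by which it is used. *)
Lemma involution : (0 < n)%N ->
  exists e, [/\ e != 1, e \in G, e * e = 1 & forall x, (x \in tors 1) = (x == 1) || (x == e)].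
Proof.
move=> n0; have := card_tors n0; rewrite expn1 => c2.
have /cards2P[a [b [nab eab]]] : #|tors 1| == 2 by rewrite c2.
have [e ne ee] : exists2 e, e != 1 & tors 1 = [set 1; e] :> {set gT}.
  have : 1 \in [set a; b] by rewrite -eab group1.
  rewrite !inE => /orP[]/eqP e1.
    by exists b; rewrite e1 // eq_sym.
  by exists a; rewrite e1 // setUC.
have e1 : e \in tors 1 by rewrite ee !inE eqxx orbT.
exists e; split=> //; first exact: torsG e1.
  by move: e1; rewrite mem_tors expn1 => /andP[_ /eqP].
by move=> x; rewrite ee !inE.
Qed.

End Torsion.

Lemma tors_tors (gT : finGroupType) (G : {group gT}) i j : cyclic G -> (i <= j)%N ->
  torsion (torsion G j) i = torsion G i.
Proof.
move=> cycG le; apply/val_inj/setP=> x /=.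
rewrite !mem_tors ?(cyclicS (tors_subG cycG j)) //.
by case Gx: (x \in G) => //=; apply: andb_idl => /eqP x1;
  rewrite -(subnKC le) expnD expgM x1 expg1n.
Qed.

(** * Classes of generators with trivial radical *)

(** The other elements of D come in pairs. *)
Lemma odd_card_fixed (T : finType) (D : {set T}) (f : T -> T) :
    {in D, forall x, f x \in D} -> {in D, involutive f} ->
  odd #|D| = odd #|[set x in D | f x == x]|.
Proof.
have [m] := ubnP #|D|; elim: m D => // m IHm D ltm fD ffD.
case: (pickP [pred x in D | f x != x]) => [x /andP[/= Dx nfx]|fix_all]; last first.
  congr (odd _); apply: eq_card => x; rewrite inE.
  by have /= := fix_all x; case: (x \in D) => //= /negbFE ->.
have Dfx := fD x Dx.
have e1 : #|D| = #|D :\ x :\ f x|.+2.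
  by rewrite (cardsD1 x) Dx (cardsD1 (f x) (D :\ x)) !inE nfx Dfx.
have fD' : {in D :\ x :\ f x, forall y, f y \in D :\ x :\ f x}.
  move=> y; rewrite !inE => /and3P[nyf nyx Dy]; rewrite fD // andbT.
  rewrite (inj_in_eq (can_in_inj ffD)) // nyx /=.
  by apply: contra nyf => /eqP <-; rewrite ffD.
rewrite e1 /= negbK IHm //; last first.
- by move=> y; rewrite !inE => /and3P[_ _ Dy]; apply: ffD.
- by move: ltm; rewrite e1; lia.
congr (odd _); apply: eq_card => y; rewrite !inE.
have [->|nyf] /= := eqVneq y (f x); first by rewrite ffD // [x == _]eq_sym (negPf nfx) andbF.
by have [->|] //= := eqVneq y x; rewrite (negPf nfx) andbF.
Qed.

Section TrivialRadical.

Variables (gT : finGroupType) (G : {group gT}) (n : nat).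
Hypotheses (cycG : cyclic G) (cardG : #|G| = (2 ^ n)%N) (n_gt0 : (0 < n)%N).
Variable P : {set {set gT}}.
Hypothesis SP : schur G P.
Variables (e x : gT).
Hypotheses (ne1 : e != 1) (Ge : e \in G) (ee : e * e = 1).
Hypothesis tors1E : forall y, (y \in torsion G 1) = (y == 1) || (y == e).
Hypotheses (Gx : x \in G) (x_top : x \notin torsion G n.-1).

Local Notation cl := (pblock P).
Local Notation T := (cl x).
Local Notation tors := (torsion G).
Local Notation mem_tors := (mem_tors cycG).
Implicit Types (y z u w a : gT) (i j k : nat).

Hypothesis radT : e *: T != T.

Let sTG : T \subset G. Proof. exact: cl_subG. Qed.
Let TG y : y \in T -> y \in G. Proof. exact: subsetP sTG y. Qed.
Let Tx : x \in T. Proof. exact: (mem_cl SP). Qed.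
Let PT : T \in P. Proof. exact: (cl_class SP). Qed.
Let comm y z : y \in G -> z \in G -> y * z = z * y.
Proof. exact: commG. Qed.

(** The power map maps T onto a class, which is T as soon as it meets T. *)
Let pow_closed k z y : odd k -> z \in T -> z ^+ k \in T -> y \in T -> y ^+ k \in T.
Proof.
move=> ok Tz Tzk Ty; have cop : coprime #|G| k by rewrite cardG coprimeXl // coprime2n.
rewrite -(cl_eq SP Tzk) (cl_power SP cycG cop) ?TG // (cl_eq SP Tz).
exact: imset_f.
Qed.

Let top_pow a u j : a \in G -> a \notin tors n.-1 -> u \in tors j -> (j <= n)%N ->
  exists q, u = a ^+ (2 ^ (n - j) * q).
Proof.
move=> Ga na uj le; have ea := top_gen cycG cardG n_gt0 Ga na.
have : u \in <[a]> by rewrite ea (torsG cycG uj).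
case/cycleP=> k ek; move: uj; rewrite ek (pow_tors cycG cardG) // => /dvdnP[q ->].
by exists q; rewrite mulnC.
Qed.

(** In terms of multipliers: the powers with exponent 1 modulo 2^(n - j) map T to
    itself, see [pow_stable]. *)
Let stable j := [forall u in tors j, x * u \in T].

Let stableP j : reflect (forall u, u \in tors j -> x * u \in T) (stable j).
Proof. exact: forall_inP. Qed.

Let odd_form j q : (j < n)%N -> odd (2 ^ (n - j) * q).+1.
Proof. by move=> lj; rewrite /= oddM oddX subn_eq0 leqNgt lj. Qed.

Let pow_stable j q y : (j < n)%N -> stable j -> y \in T -> y ^+ (2 ^ (n - j) * q).+1 \in T.
Proof.
move=> lj /stableP Sj; apply: (pow_closed (z := x)) => //; first exact: odd_form.
rewrite expgS Sj // (pow_tors cycG cardG) ?dvdn_mulr //; last exact: ltnW.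
exact: (top_gen cycG cardG).
Qed.

Let top_stable a u j : (j < n)%N -> stable j -> a \in T -> a \notin tors n.-1 ->
  u \in tors j -> a * u \in T.
Proof.
move=> lj Sj Ta na uj; have [q ->] := top_pow (TG Ta) na uj (ltnW lj).
by rewrite -expgS pow_stable.
Qed.

(** Exponents that are 1 modulo the order of y fix y. *)
Let low y i : y \in T -> y \in tors i -> (0 < i < n)%N -> stable (n - i).
Proof.
move=> Ty yi /andP[i0 li]; apply/stableP=> u ui.
have [q ->] := top_pow Gx x_top ui (leq_subr _ _).
rewrite subKn ?(ltnW li) // -expgS; apply: (pow_closed (z := y)) => //.
  by have := odd_form q (_ : n - i < n)%N; rewrite subKn ?(ltnW li) //; apply; lia.
by move: yi; rewrite mem_tors expgS expgM => /andP[_ /eqP->]; rewrite expg1n mulg1.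
Qed.

Let T1 : 1 \notin T.
Proof.
apply/negP=> h; have := Tx; rewrite -(cl_eq SP h).
have P1 : [set 1] \in P by case: SP.
rewrite (cl_def SP P1) ?inE // => /eqP x1.
by move: x_top; rewrite x1 group1.
Qed.

(** The obstruction to e being in the radical.  Squaring turns it into a union of
    classes, see [square_lonely]. *)
Definition lonely := [set y in T | y * e \notin T].
Local Notation L := lonely.

Let L_ne : exists y, y \in L.
Proof.
apply/set0Pn; apply: contra radT => /eqP L0.
rewrite eq_sym eqEcard card_lcoset leqnn andbT; apply/subsetP=> y Ty.
rewrite mem_lcoset.
have -> : e^-1 = e by apply/eqP; rewrite eq_invg_mul ee.
have := in_set0 y; rewrite -L0 inE Ty /= (comm (TG Ty) Ge) => /negbFE.
by [].
Qed.

(** The number of factorizations g = a b in T T has the parity of the number of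
    square roots of g in T, as exchanging a and b is an involution.  The square
    roots of g in G are of the form a, a e, so both lie in T or g is the square
    of a lonely element. *)
Lemma square_lonely :
  [set g in G | odd (conv T T g)] = [set y ^+ 2 | y in L].
Proof.
have E g : g \in G -> odd (conv T T g) = odd #|[set a in T | a ^+ 2 == g]|.
  move=> Gg; rewrite /conv (odd_card_fixed (f := fun a => a^-1 * g)).
  - congr (odd _); apply: eq_card => a; rewrite !inE.
    case Ta: (a \in T) => //=; have Ga := TG Ta.
    rewrite -(inj_eq (mulgI a)) mulKVg -expg2 [g == _]eq_sym.
    by case: eqP => [<-|]; rewrite ?andbF // expg2 mulKg Ta.
  - move=> a; rewrite !inE => /andP[Ta ->] /=; have Ga := TG Ta.
    by rewrite invMg invgK -mulgA (comm Ga Gg) mulKg.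
  move=> a; rewrite inE => /andP[Ta _]; have Ga := TG Ta.
  by rewrite invMg invgK -mulgA (comm Ga Gg) mulKg.
have root a b : a \in T -> b \in T -> a ^+ 2 = b ^+ 2 -> (b == a) || (b == a * e).
  move=> Ta Tb eab; have Ga := TG Ta; have Gb := TG Tb.
  have : a^-1 * b \in tors 1.
    rewrite mem_tors groupM ?groupV // expn1 expgMn; last first.
      by apply: comm; rewrite ?groupV.
    by rewrite expgVn eab mulVg eqxx.
  rewrite tors1E => /orP[]/eqP eb; apply/orP; [left|right]; apply/eqP.
    by rewrite -(mulKVg a b) eb mulg1.
  by rewrite -eb mulKVg.
have sqe a : a \in T -> (a * e) ^+ 2 = a ^+ 2.
  by move=> Ta; rewrite expgMn ?[e ^+ 2]expg2 ?ee ?mulg1 //; apply: comm (TG Ta) Ge.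
apply/setP=> g; rewrite inE; apply/andP/imsetP => [[Gg]|[a]].
  rewrite E // => og.
  have [a] : exists a, a \in [set a in T | a ^+ 2 == g].
    by apply/set0Pn; apply: contraTneq og => ->; rewrite cards0.
  rewrite inE => /andP[Ta /eqP eg]; exists a => //.
  rewrite inE Ta; apply: contraL og => Tae.
  have -> : [set a in T | a ^+ 2 == g] = [set a; a * e].
    apply/setP=> b; rewrite !inE; apply/andP/orP=> [[Tb /eqP eb]|].
      by apply/orP; apply: root; rewrite ?eg.
    by case=> /eqP->; rewrite ?Ta ?Tae ?sqe // eg.
  rewrite cards2; have -> // : a != a * e.
  by rewrite -{1}[a]mulg1 (inj_eq (mulgI a)) eq_sym.
rewrite inE => /andP[Ta Tae] ->; rewrite groupX ?TG //; split=> //.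
rewrite E ?groupX ?TG //.
have -> : [set b in T | b ^+ 2 == a ^+ 2] = [set a].
  apply/setP=> b; rewrite !inE; apply/andP/eqP=> [[Tb /eqP eb]|->]; last by rewrite Ta.
  have := root a b Ta Tb (esym eb); case/orP=> /eqP // eba.
  by rewrite -eba Tb in Tae.
by rewrite cards1.
Qed.

Section Level.

Variable s : nat.
Hypotheses (lt_sn : (s < n)%N) (Ss : stable s).
Hypothesis s_max : forall j, (j < n)%N -> stable j -> (j <= s)%N.

(** If the order of y exceeds 2^(n - s) then y e is a power of y with an exponent
    that preserves T; if it is smaller, [low] contradicts the maximality of s. *)
Lemma lonely_level y : y \in L -> y \in tors (n - s) /\ y \notin tors (n - s).-1.
Proof.
rewrite inE => /andP[Ty Tye]; have Gy := TG Ty.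
have ny1 : y != 1 by apply: contraNneq T1 => <-.
have [i [lin yi nyi]] := rank_tors cycG cardG Gy ny1.
have up : (i < n - s)%N.
  rewrite ltnNge; apply: contra Tye => le.
  have ey : y ^+ (2 ^ i) = e.
    have : y ^+ (2 ^ i) \in tors 1.
      by move: yi; rewrite !mem_tors groupX ?Gy //= -expgM expn1 -expnSr.
    rewrite tors1E => /orP[]/eqP // y1.
    by rewrite mem_tors Gy y1 eqxx in nyi.
  by rewrite -{1}ey -expgS -(subnKC le) expnD pow_stable.
have down : (n - s <= i.+1)%N.
  have [li|le] := ltnP i.+1 n; last by apply: leq_trans le; apply: leq_subr.
  have h : (i.+1 <= n)%N := ltnW li.
  have l2 : (n - i.+1 < n)%N by rewrite ltn_subrL.
  have := s_max l2 (low Ty yi (li : (0 < i.+1 < n)%N)).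
  by rewrite !leq_subLR addnC.
by rewrite (_ : n - s = i.+1)%N //; apply/eqP; rewrite eqn_leq up down.
Qed.

(** In terms of multipliers: an exponent that is 1 modulo 4 and preserves T is 1
    modulo 2^(n - s), since squaring any other one repeatedly would reach an element
    of order 2 modulo 2^(n - s), against the maximality of s. *)
Lemma step_top a u : a \in T -> a \notin tors n.-1 -> (1 < n)%N ->
  u \in tors (n - 2) -> a * u \in T -> u \in tors s.
Proof.
move=> Ta na n_gt1.
have main d v : (s + d.+1 <= n - 2)%N -> v \in tors (s + d.+1) -> v \notin tors (s + d) ->
    a * v \in T -> False.
  elim: d v => [|d IHd] v le vi nvi Tav.
    rewrite addn1 addn0 in le vi nvi.
    have lt1 : (s.+1 < n)%N by move: le n_gt1; clear; lia.
    suff /s_max : stable s.+1 by move/(_ lt1); rewrite ltnn.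
    have aw w : w \in tors s.+1 -> a * w \in T.
      move=> wi; case: (boolP (w \in tors s)) => [ws|nws]; first exact: (top_stable lt_sn Ss).
      have -> : a * w = a * v * (v^-1 * w) by rewrite -mulgA mulKVg.
      apply: (top_stable lt_sn Ss) => //; last exact: (tors_diff cycG cardG).
      rewrite groupMr //; apply: (tors_le cycG _ vi); move: lt1; clear; lia.
    apply/stableP=> w wi; have [q ->] := top_pow Gx x_top wi (ltnW lt1).
    rewrite -expgS; apply: (pow_closed (z := a)) => //; first exact: odd_form.
    rewrite expgS; apply: aw; rewrite (pow_tors cycG cardG) ?dvdn_mulr ?(ltnW lt1) //.
    exact: (top_gen cycG cardG n_gt0 (TG Ta)).
  have lvn : (s + d.+2 <= n)%N by move: le; clear; lia.
  have [q eq] := top_pow (TG Ta) na vi lvn.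
  set k := (2 ^ (n - (s + d.+2)) * q)%N in eq.
  have ok : odd k.+1 by apply: odd_form; move: le n_gt1; clear; lia.
  have Gv := torsG cycG vi; have Ga := TG Ta.
  have ak : a ^+ k.+1 = a * v by rewrite expgS -eq.
  have Tk : (a * v) ^+ k.+1 \in T by apply: (pow_closed (z := a)); rewrite ?ak.
  have ev : (a * v) ^+ k.+1 = a * v ^+ k.+2.
    by rewrite expgMn ?ak -?mulgA -?expgS //; apply: comm.
  have [r er or'] : exists2 r, k.+2 = (2 * r)%N & odd r.
    exists (2 ^ (n - (s + d.+3)) * q).+1.
      rewrite /k mulnS mulnA -expnS; congr (_.+2); congr (2 ^ _ * _)%N; move: le n_gt1; clear; lia.
    by apply: odd_form; move: le n_gt1; clear; lia.
  have lv i : (v ^+ k.+2 \in tors i) = (v \in tors i.+1).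
    by rewrite er expgM (odd_tors cycG cardG _ or' (groupX 2 Gv)) (sq_tors cycG).
  apply: (IHd (v ^+ k.+2)); rewrite ?lv -?addnS //; first by move: le; clear; lia.
  by rewrite -ev.
move=> ul Tau; apply/negPn/negP=> nus.
have Gu := torsG cycG ul.
have nu1 : u != 1 by apply: contraNneq nus => ->; rewrite group1.
have [i [lin ui nui]] := rank_tors cycG cardG Gu nu1.
have si : (s <= i)%N.
  by rewrite leqNgt; apply: contra nus => lt; apply: (tors_le cycG _ ui).
have li : (i.+1 <= n - 2)%N.
  by rewrite ltnNge; apply: contra nui => lt; apply: (tors_le cycG _ ul).
by apply: (main (i - s)%N u) => //; rewrite ?addnS subnKC.
Qed.

(** The class T contains e, and so every nontrivial subgroup that is a union of
    classes contains T and is G; a class avoiding the top layer would generate a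
    smaller one. *)
Lemma case_full : s = n.-1 -> T = G :\ 1.
Proof.
move=> es; have Te : e \in T.
  have [y yL] := L_ne; have [yl nyl] := lonely_level yL.
  have e1 : (n - s = 1)%N by move: n_gt0; rewrite es; clear; lia.
  rewrite e1 tors1E in yl; rewrite e1 mem_tors0 // in nyl.
  rewrite (negPf nyl) /= in yl; rewrite -(eqP yl).
  by move: yL; rewrite inE => /andP[].
apply/eqP; rewrite eqEsubset subsetD1 sTG T1 /=.
apply/subsetP=> z; rewrite !inE => /andP[nz1 Gz].
apply/negPn/negP=> nTz.
have pc := class_pset SP (cl_class SP Gz).
have sub : cl z \subset tors n.-1.
  apply/subsetP=> w wz; apply/negPn/negP=> nw.
  have Gw := subsetP (cl_subG SP Gz) _ wz.
  have Tw : w \in T.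
    have exG := top_gen cycG cardG n_gt0 Gx x_top.
    have xw : x^-1 * w \in tors n.-1.
      by apply: (tors_diff cycG cardG); rewrite // prednK // (tors_top cycG cardG).
    by rewrite -(mulKVg x w); move/stableP: Ss; rewrite es; apply.
  by rewrite -(cl_eq SP Tw) (cl_eq SP wz) (mem_cl SP) in nTz.
have pg := pset_gen SP pc.
have [i lin ei] := sub_tors cycG cardG (pset_subG pg : <<cl z>>%G \subset G).
have zi : z \in tors i by rewrite -ei mem_gen ?(mem_cl SP).
have i0 : (0 < i)%N by rewrite lt0n; apply: contraNneq nz1 => i0; rewrite i0 mem_tors0 in zi.
have ei' : <<cl z>> = tors i :> {set gT} := congr1 (@gval gT) ei.
have eli : e \in <<cl z>>.
  by rewrite ei'; apply: (tors_le cycG i0); rewrite tors1E eqxx orbT.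
have xl : x \in <<cl z>>.
  by apply: (pset_cl pg eli); rewrite (cl_eq SP Te).
have : <<cl z>> \subset tors n.-1 by rewrite gen_subG.
by move/subsetP/(_ x xl); rewrite (negPf x_top).
Qed.

(** Now T consists of generators.  If x^k is in T with k not 1 then k = 3 modulo 4
    and x^(k^2) = x by [step_top], whence k + 1 is divisible by 2^(n-1). *)
Lemma case_zero : s = 0%N ->
  T = [set x] \/ (2 < n)%N /\ (T = [set x; x^-1] \/ T = [set x; x^-1 * e]).
Proof.
move=> s0.
have topT y : y \in T -> y \notin tors n.-1.
  move=> Ty; apply/negP=> yl.
  have n1 : (1 < n)%N.
    rewrite ltnNge; apply/negP=> n1; have n0 : n.-1 = 0%N by move: n1; clear; lia.
    by move: yl T1; rewrite n0 mem_tors0 // => /eqP <-; rewrite Ty.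
  have : stable (n - n.-1) by apply: (low Ty yl); move: n1; clear; lia.
  have l2 : (n - n.-1 < n)%N by move: n1; clear; lia.
  by move/(s_max l2); rewrite s0; move: n1; clear; lia.
have exG := top_gen cycG cardG n_gt0 Gx x_top.
have two y : y \in T -> y != x -> (2 < n)%N /\ (y = x^-1 \/ y = x^-1 * e).
  move=> Ty nyx; have Gy := TG Ty.
  have ul : x^-1 * y \in tors n.-1.
    by apply: (tors_diff cycG cardG); rewrite ?topT // prednK // (tors_top cycG cardG).
  have nul : x^-1 * y \notin tors 0.
    by rewrite mem_tors0 // -eq_mulVg1 eq_sym.
  have n1 : (1 < n)%N.
    by rewrite ltnNge; apply: contra nul => n1; apply: (tors_le cycG _ ul); move: n1; clear; lia.
  have nul2 : x^-1 * y \notin tors (n - 2).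
    apply: contra nul => ul2; rewrite -s0; apply: (step_top Tx) => //.
    by rewrite mulKVg.
  have n2 : (2 < n)%N.
    rewrite ltnNge; apply/negP=> n2; have en : n = 2%N by move: n1 n2; clear; lia.
    have : (1 <= s)%N.
      apply: s_max; first by rewrite en.
      have ue : x^-1 * y = e.
        move: ul nul; rewrite en tors1E mem_tors0 // => /orP[->|/eqP] //.
      apply/stableP=> w; rewrite tors1E => /orP[]/eqP->; first by rewrite mulg1.
      by rewrite -ue mulKVg.
    by rewrite s0.
  split=> //.
  have [q eq] := top_pow Gx x_top ul (leq_pred n).
  have e1 : (n - n.-1 = 1)%N by move: n1; clear; lia.
  rewrite e1 expn1 in eq.
  have ey : y = x ^+ (2 * q).+1 by rewrite expgS -eq mulKVg.
  have oq : odd q.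
    move: nul2; rewrite eq (pow_tors cycG cardG) ?leq_subr // subKn //.
    by rewrite -[X in ~~ (X %| _)]/(2 * 2)%N dvdn_pmul2l // dvdn2 negbK.
  have ok : odd (2 * q).+1 by rewrite /= oddM.
  have Tyk : y ^+ (2 * q).+1 \in T by apply: (pow_closed (z := x)); rewrite -?ey.
  have ew : y ^+ (2 * q).+1 = x * x ^+ (4 * (q * q.+1)).
    rewrite {1}ey -expgM -expgS; congr (x ^+ _); clear; nia.
  have : x ^+ (4 * (q * q.+1)) \in tors s.
    apply: (step_top Tx) => //; last by rewrite -ew.
    by rewrite (pow_tors cycG cardG) ?leq_subr // subKn // dvdn_mulr.
  rewrite s0 (pow_tors cycG cardG) // subn0 => d.
  have cop : coprime (2 ^ n) q by rewrite coprimeXl // coprime2n.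
  have d2 : (2 ^ n %| 4 * q.+1)%N.
    by rewrite -(Gauss_dvdr _ cop) mulnCA.
  have : x * y \in tors 1.
    rewrite ey -expgS (pow_tors cycG cardG) //.
    rewrite -(dvdn_pmul2l (isT : 0 < 2)%N) -expnS subn1 prednK //.
    by apply: etrans d2; congr (_ %| _)%N; clear; lia.
  rewrite tors1E => /orP[]/eqP exy; [left|right].
    by rewrite -(mulKg x y) exy mulg1.
  by rewrite -exy mulKg.
case: (pickP [pred y in T | y != x]) => [y /andP[/= Ty nyx]|none]; last first.
  left; apply/setP=> z; rewrite inE; apply/idP/eqP=> [Tz|->] //.
  by apply/eqP; have /= := none z; rewrite Tz /= => /negbFE.
have [n2 hy] := two y Ty nyx; right; split=> //.
have ninv : x^-1 \in T -> x^-1 * e \in T -> False.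
  move=> Ta Tae; have l1 : (1 <= n - 2)%N by move: n2; clear; lia.
  have : e \in tors s.
    apply: (step_top Ta _ (ltnW n2)) => //; first by rewrite groupV.
    by apply: (tors_le cycG l1); rewrite tors1E eqxx orbT.
  by rewrite s0 mem_tors0 // (negPf ne1).
have eT : T = [set x; y].
  apply/setP=> z; rewrite !inE; apply/idP/orP=> [Tz|[]/eqP->] //.
  have [|nzx] := eqVneq z x; [by left|right].
  have [_ hz] := two z Tz nzx; apply/eqP.
  case: hz hy => e1 [] e2; first by rewrite e1 e2.
  - by case: ninv; rewrite -?e2 -?e1.
  - by case: ninv; rewrite -?e1 -?e2.
  by rewrite e1 e2.
by case: hy => e1; rewrite eT e1; [left | right].
Qed.

(** The squares of the lonely elements generate H of order 2^(n-s-1), and by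
    [step_top] every nonempty intersection of T with a coset of H has 2^s elements.
    Then any g in H outside the subgroup of order 2^s moves more elements of T
    out of T than e does, so that the class of e lies in that subgroup.  It
    generates a subgroup contained in the radical of T, which is absurd. *)
Lemma case_mid : (0 < s)%N -> (s.+1 < n)%N -> False.
Proof.
move=> s0 sn.
have [y yL] := L_ne; have [yl nyl] := lonely_level yL.
have [Ty Tye] : y \in T /\ y * e \notin T by move: yL; rewrite inE => /andP[].
have Gy := TG Ty.
have [h eh] : exists h, (n - s = h.+2)%N.
  by exists (n - s).-2; move: sn; clear; lia.
rewrite eh /= in yl nyl.
have hn : (h.+2 < n)%N by move: s0 eh lt_sn; clear; lia.
pose Sq := [set g in G | odd (conv T T g)].
have pSq : is_pset G P Sq := pset_conv SP odd (class_pset SP PT) (class_pset SP PT).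
have eSq := square_lonely; rewrite -/Sq in eSq.
have pH := pset_gen SP pSq.
have eH : <<Sq>> = tors h.+1.
  apply/eqP; rewrite eqEsubset gen_subG; apply/andP; split.
    rewrite eSq; apply/subsetP=> _ /imsetP[z zL ->].
    have [] := lonely_level zL; rewrite eh => zl _.
    by rewrite (sq_tors cycG) ?(torsG cycG zl).
  have y2 : y ^+ 2 \in tors h.+1 by rewrite (sq_tors cycG).
  have ny2 : y ^+ 2 \notin tors h by rewrite (sq_tors cycG).
  rewrite -(gen_tors cycG cardG y2 ny2) cycle_subG mem_gen // eSq.
  exact: imset_f.
have {}pH : is_pset G P (tors h.+1) by rewrite -eH.
have hn2 : (h.+1 <= n - 2)%N by move: eh s0 sn; clear; lia.
have n1 : (1 < n)%N by move: sn; clear; lia.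
have top_coset a u : a \in T -> a \notin tors n.-1 -> u \in tors h.+1 -> a * u \in T -> u \in tors s.
  by move=> Ta na uh; apply: (step_top Ta na n1); apply: (tors_le cycG hn2).
have e_tors i : (0 < i)%N -> e \in tors i.
  by move=> i0; apply: (tors_le cycG i0); rewrite tors1E eqxx orbT.
(* by coset counting, T would also contain the coset of y, hence y e *)
have no_sub i : (0 < i)%N -> is_pset G P (tors i) -> ~~ (x *: tors i \subset T).
  move=> i0 pi; apply/negP=> sub.
  have := card_class_coset SP pi PT Tx Ty.
  rewrite (setIidPr sub) card_lcoset => c.
  have : T :&: y *: tors i == y *: tors i.
    by rewrite eqEcard subsetIr card_lcoset -c leqnn.
  move/eqP/setP/(_ (y * e)); rewrite inE (negPf Tye) /= mem_lcoset mulKg.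
  by rewrite e_tors.
have sub_s i : (i <= s)%N -> x *: tors i \subset T.
  move=> le; apply/subsetP=> z /lcosetP[u ui ->].
  by move/stableP: Ss; apply; apply: (tors_le cycG le).
have sh : (s < h.+1)%N.
  rewrite ltnNge; apply/negP=> le.
  by have := no_sub h.+1 (ltn0Sn h) pH; rewrite sub_s.
have cT z : z \in T -> #|T :&: z *: tors h.+1| = (2 ^ s)%N.
  move=> Tz; rewrite (card_class_coset SP pH PT Tz Tx).
  rewrite -(card_tors cycG cardG (ltnW lt_sn)) -(card_lcoset (tors s) x).
  apply: eq_card => w; rewrite inE !mem_lcoset; apply/andP/idP=> [[Tw wh]|ws].
    by apply: (top_coset x) => //; rewrite mulKVg.
  split; last exact: (tors_le cycG (ltnW sh)).
  by rewrite -(mulKVg x w); move/stableP: Ss; apply.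
have cL : (#|L| <= 2 ^ s)%N.
  rewrite -(cT y Ty); apply/subset_leq_card/subsetP=> z zL.
  have [] := lonely_level zL; rewrite eh /= => zl nzl.
  rewrite inE mem_lcoset (tors_diff cycG cardG) // andbT.
  by move: zL; rewrite inE => /andP[].
have cle : cl e \subset tors s.
  apply/subsetP=> g ge; have gh : g \in tors h.+1 by apply: (pset_cl pH _ ge); apply: e_tors.
  have Gg := torsG cycG gh.
  apply/negPn/negP=> ngs.
  have pT := class_pset SP PT.
  have E (k : gT) : k \in G -> conv T T^-1 k = #|[set a in T | k^-1 * a \in T]|.
    by move=> Gk; apply: eq_card => a; rewrite !inE invMg invgK.
  have := conv_class SP pT (psetV SP pT) Ge ge; rewrite !E //.
  have C (k : gT) : #|[set a in T | k^-1 * a \in T]| = (#|T| - #|[set a in T | (k^-1 * a)%g \notin T]|)%N.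
    rewrite -(cardsID [set a | k^-1 * a \in T] T) -setIdE.
    rewrite (_ : [set a in T | _ \notin T] = T :\: [set a | k^-1 * a \in T]) ?addnK //.
    by apply/setP=> a; rewrite !inE andbC.
  have subT (k : gT) : (#|[set a in T | (k^-1 * a)%g \notin T]| <= #|T|)%N.
    by apply/subset_leq_card/subsetP=> a; rewrite inE => /andP[].
  have eL : [set a in T | e^-1 * a \notin T] = L.
    apply/setP=> a; rewrite !inE; case Ta: (a \in T) => //=.
    have -> : e^-1 = e by apply/eqP; rewrite eq_invg_mul ee.
    by rewrite (comm Ge (TG Ta)).
  rewrite !C eL => ec.
  have {ec} : #|[set a in T | g^-1 * a \notin T]| = #|L|.
    by move: (subT g) (subT e) ec; rewrite eL; clear; lia.
  apply/eqP; rewrite neq_ltn; apply/orP; right.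
  apply: leq_ltn_trans cL _.
  (* otherwise T would contain the orbit of y under g, of which e is a power *)
  have [a0 [Ta0 ya0 na0]] : exists a0, [/\ a0 \in T, a0 \in y *: tors h.+1 & g^-1 * a0 \notin T].
    have : [exists a0, [&& a0 \in T, a0 \in y *: tors h.+1 & g^-1 * a0 \notin T]].
      apply: contraT; rewrite negb_exists => /forallP none.
      have stay k : (g ^- k * y \in T) && (g ^- k * y \in y *: tors h.+1).
        elim: k => [|k /andP[IH1 IH2]]; first by rewrite invg1 mul1g Ty lcoset_refl.
        have e1 : g ^- k.+1 * y = g^-1 * (g ^- k * y) by rewrite expgSr invMg mulgA.
        have := none (g ^- k * y); rewrite IH1 IH2 /= negbK -e1 => ->.
        have Gk : g ^- k.+1 \in G by rewrite groupV groupX.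
        by rewrite (comm Gk Gy) mem_lcoset mulKg groupV groupX.
      have ng1 : g != 1 by apply: contraNneq ngs => ->; rewrite group1.
      have [i [lin gi ngi]] := rank_tors cycG cardG Gg ng1.
      have : e \in <[g]>.
        rewrite (gen_tors cycG cardG gi ngi); exact: e_tors.
      case/cycleP=> k ek; have /andP[] := stay k.
      rewrite -ek; have -> : e^-1 = e by apply/eqP; rewrite eq_invg_mul ee.
      by rewrite comm // (negPf Tye).
    by case/existsP=> a0 /and3P[]; exists a0.
  have na0x : a0 \notin x *: tors s.
    rewrite mem_lcoset; apply: contra x_top => h1.
    have a0l : a0 \in tors n.-1.
      have : a0 \in tors h.+2.
        case/lcosetP: ya0 => u uh ->; rewrite groupM //.
        by apply: (tors_le cycG _ uh).
      by apply: (tors_le cycG); move: hn; clear; lia.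
    rewrite -groupV -(mulgK a0 x^-1) groupM ?groupV //.
    by apply: (tors_le cycG _ h1); move: lt_sn; clear; lia.
  have : a0 |: x *: tors s \subset [set a in T | g^-1 * a \notin T].
    rewrite subUset sub1set inE Ta0 na0 /=; apply/subsetP=> a ax.
    have Ta : a \in T := subsetP (sub_s s (leqnn s)) _ ax.
    rewrite inE Ta /=; apply: contra ngs => gaT.
    rewrite -groupV; apply: (top_coset a); rewrite ?groupV //.
      apply: contra x_top => al; case/lcosetP: ax => u us ea.
      rewrite -(mulgK u x) -ea groupM // groupV.
      by apply: (tors_le cycG _ us); move: lt_sn; clear; lia.
    have Gg1 : g^-1 \in G by rewrite groupV.
    by rewrite (comm (TG Ta) Gg1).
  move/subset_leq_card; rewrite cardsU1 na0x card_lcoset.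
  by rewrite (card_tors cycG cardG (ltnW lt_sn)).
have pe := pset_gen SP (class_pset SP (cl_class SP Ge)).
have [j ljn ej] := sub_tors cycG cardG (pset_subG pe : <<cl e>>%G \subset G).
have ej' : <<cl e>> = tors j :> {set gT} := congr1 (@gval gT) ej.
have ejl : e \in tors j by rewrite -ej' mem_gen ?(mem_cl SP).
have j0 : (0 < j)%N.
  by rewrite lt0n; apply: contraTneq ejl => ->; rewrite mem_tors0.
have js : (j <= s)%N.
  by rewrite -(sub_torsE cycG cardG _ ljn) -ej' gen_subG.
by have := no_sub j j0; rewrite -ej' pe ej' sub_s // => /(_ isT).
Qed.

End Level.

Theorem trivial_radical :
  [\/ T = G :\ 1, T = [set x]
    | (2 < n)%N /\ (T = [set x; x^-1] \/ T = [set x; x^-1 * e])].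
Proof.
have ex0 : exists j, (j < n)%N && stable j.
  by exists 0%N; rewrite n_gt0; apply/stableP=> u; rewrite mem_tors0 // => /eqP->; rewrite mulg1.
have ub j : (j < n)%N && stable j -> (j <= n)%N by case/andP=> /ltnW.
case: (ex_maxnP ex0 ub) => s /andP[lt_sn Ss] mx.
have s_max j : (j < n)%N -> stable j -> (j <= s)%N by move=> h1 h2; apply: mx; rewrite h1.
have [s0|s0] := posnP s.
  have := case_zero lt_sn Ss s_max s0.
  by case=> ?; [constructor 2 | constructor 3].
have [sn|] := ltnP s.+1 n; first by case: (case_mid lt_sn Ss s_max s0 sn).
move=> le; constructor 1; apply: (case_full lt_sn Ss s_max).
by move: le lt_sn; clear; lia.
Qed.

End TrivialRadical.

(** * The other classes when the radical is trivial *)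

Section Lower.

Variables (gT : finGroupType) (G : {group gT}) (P : {set {set gT}}).
Hypotheses (cycG : cyclic G) (SP : schur G P).
Local Notation cl := (pblock P).
Implicit Types x y w : gT.

Lemma pset_pow1 x j : is_pset G P [set x] -> is_pset G P [set x ^+ j].
Proof.
move=> px; elim: j => [|j IHj]; first by rewrite expg0; apply: pset1.
by rewrite expgS -mulg_set1; apply: psetM.
Qed.

(** The recursion of Dickson polynomials: the product of {x, w} and of the k-th pair
    is the union of the next pair and of x w times the previous one.  These two
    pairs are orbits of one involution, hence equal or disjoint. *)
Lemma pset_pow2 x w k : is_pset G P [set x; w] -> is_pset G P [set x * w] ->
  is_pset G P [set x ^+ k; w ^+ k].
Proof.
move=> p1 pf.
have [Gx Gw] : x \in G /\ w \in G.
  by have := pset_subG p1; rewrite subUset !sub1set => /andP[].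
have comm := commG cycG.
suff [] : is_pset G P [set x ^+ k; w ^+ k] /\ is_pset G P [set x ^+ k.+1; w ^+ k.+1] by [].
elim: k => [|k [IH0 IH1]].
  rewrite !expg0 !expg1 setUid; split=> //; exact: pset1.
split=> //; set A := [set x ^+ k.+2; w ^+ k.+2].
set B := [set x * w] * [set x ^+ k; w ^+ k].
have pB : is_pset G P B by apply: psetM.
have eAB : [set x; w] * [set x ^+ k.+1; w ^+ k.+1] = A :|: B.
  have exw : x * w ^+ k.+1 = x * w * w ^+ k by rewrite expgS mulgA.
  have ewx : w * x ^+ k.+1 = x * w * x ^+ k by rewrite expgS mulgA (comm w x).
  apply/setP=> z; apply/mulsgP/setUP => [[a b]|].
    rewrite !inE => /orP[]/eqP-> /orP[]/eqP-> ->.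
    - by left; rewrite -expgS eqxx.
    - by right; rewrite exw mem_mulg // !inE eqxx ?orbT.
    - by right; rewrite ewx mem_mulg // !inE eqxx ?orbT.
    by left; rewrite -expgS eqxx orbT.
  case=> [|/mulsgP[u v]]; rewrite !inE.
    case/orP=> /eqP->; [exists x (x ^+ k.+1) | exists w (w ^+ k.+1)];
      by rewrite -?expgS // !inE eqxx ?orbT.
  move/eqP=> -> /orP[]/eqP-> ->; rewrite -?exw -?ewx.
    by exists w (x ^+ k.+1); rewrite // !inE eqxx ?orbT.
  by exists x (w ^+ k.+1); rewrite // !inE eqxx ?orbT.
have pAB : is_pset G P (A :|: B) by rewrite -eAB; apply: psetM.
pose tau z := z^-1 * (x * w) ^+ k.+2.
have Gf j : (x * w) ^+ j = x ^+ j * w ^+ j by apply: expgMn; apply: comm.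
have tauA z : z \in A -> A = [set z; tau z].
  rewrite !inE => /orP[]/eqP->; rewrite /tau Gf ?mulKg //.
  by rewrite (comm (x ^+ _)) ?groupX // mulKg setUC.
have tauB z : z \in B -> B = [set z; tau z].
  have eB : B = [set x * w * x ^+ k; x * w * w ^+ k].
    apply/setP=> u; apply/mulsgP/set2P=> [[a b]|].
      by rewrite inE => /eqP-> /set2P[]-> ->; [left|right].
    by case=> ->; [exists (x * w) (x ^+ k) | exists (x * w) (w ^+ k)];
      rewrite // !inE eqxx ?orbT.
  have e1 : tau (x * w * x ^+ k) = x * w * w ^+ k.
    suff h : x * w * x ^+ k * (x * w * w ^+ k) = (x * w) ^+ k.+2 by rewrite /tau -h mulKg.
    rewrite 2!expgS Gf -[LHS]mulgA; congr (x * w * _).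
    rewrite mulgA (comm (x ^+ k)) ?groupM ?groupX //.
    by rewrite -[LHS]mulgA.
  have tauK z' : z' \in G -> tau (tau z') = z'.
    move=> Gz'; rewrite /tau invMg invgK (comm _ z') ?groupV ?groupX ?groupM //.
    by rewrite mulgKV.
  rewrite eB => /set2P[]->; rewrite ?e1 //.
  by rewrite -e1 tauK ?groupM ?groupX // setUC.
have [/set0Pn[z /setIP[Az Bz]]|] := boolP (A :&: B != set0).
  by rewrite (tauA z Az) -(tauB z Bz).
rewrite negbK setI_eq0 => dAB.
have -> : A = (A :|: B) :\: B.
  by rewrite setDUl setDv setU0; apply/esym/setDidPl.
exact: psetD.
Qed.

End Lower.

Section TrivialRadicalClasses.

Variables (gT : finGroupType) (G : {group gT}) (n : nat).
Hypotheses (cycG : cyclic G) (cardG : #|G| = (2 ^ n)%N) (n_gt0 : (0 < n)%N).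
Variable P : {set {set gT}}.
Hypothesis SP : schur G P.
Variables (e x : gT).
Hypotheses (ne1 : e != 1) (Ge : e \in G) (ee : e * e = 1).
Hypothesis tors1E : forall y, (y \in torsion G 1) = (y == 1) || (y == e).
Hypotheses (Gx : x \in G) (x_top : x \notin torsion G n.-1).
Local Notation cl := (pblock P).
Local Notation T := (cl x).
Local Notation tors := (torsion G).
Hypothesis radT : e *: T != T.

Lemma discrete_of_singleton : T = [set x] -> forall y, y \in G -> cl y = [set y].
Proof.
move=> eT y Gy; have exG := top_gen cycG cardG n_gt0 Gx x_top.
have : y \in <[x]> by rewrite exG.
case/cycleP=> k ey.
have p1 : is_pset G P [set x] by rewrite -eT; apply: (class_pset SP (cl_class SP Gx)).
have py : is_pset G P [set y] by rewrite ey; apply: pset_pow1.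
apply/eqP; rewrite eqEsubset sub1set (mem_cl SP) // andbT.
by apply/subsetP=> z; apply: (pset_cl py); rewrite inE.
Qed.

(** The pairs {y, y^-1} are unions of classes by [pset_pow2].  If {y} is
    a class then the union {y} T must contain with y x its whole class
    {y x, (y x)^-1 f}, which forces y^2 = 1. *)
Lemma pair_classes f : f \in tors 1 -> (2 < n)%N -> T = [set x; x^-1 * f] ->
  (forall y, y \in tors n.-1 -> cl y = [set y; y^-1]) /\
  (forall a, a \in G -> a \notin tors n.-1 -> cl a = [set a; a^-1 * f]).
Proof.
move=> f1 n2 eT; have exG := top_gen cycG cardG n_gt0 Gx x_top.
have Gf := torsG cycG f1; have comm := commG cycG.
have f2 : f ^+ 2 = 1 by move: f1; rewrite mem_tors // => /andP[_ /eqP].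
have pT := class_pset SP (cl_class SP Gx).
have topk k : (x ^+ k \in tors n.-1) = ~~ odd k.
  rewrite (pow_tors cycG cardG) ?leq_pred // -subn1 subKn // expn1 dvdn2.
  by [].
have fk k : odd k -> f ^+ k = f.
  by move=> ok; rewrite -[k]odd_double_half ok -mul2n expgD expgM f2 expg1n mulg1.
have tops a : a \in G -> a \notin tors n.-1 -> cl a = [set a; a^-1 * f].
  move=> Ga; have : a \in <[x]> by rewrite exG.
  case/cycleP=> k ->; rewrite topk negbK => ok.
  rewrite (cl_power SP cycG) //; last by rewrite cardG coprimeXl // coprime2n.
  rewrite eT /pow_set imsetU1 imset_set1 expgMn; last first.
    by apply: comm; rewrite ?groupV.
  by rewrite fk // expgVn.
split=> // y yl; have Gy := torsG cycG yl.
have sq4 a : a \in G -> a \notin tors n.-1 -> a ^+ 2 = f -> False.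
  move=> Ga /negP na ea; apply: na; apply: (tors_le cycG (_ : 2 <= n.-1)%N).
    by move: n2; clear; lia.
  by rewrite -(sq_tors cycG) // ea.
have pf : is_pset G P [set f].
  have := f1; rewrite tors1E => /orP[/eqP->|/eqP ef]; first exact: pset1.
  have topT a : a \in T -> a \notin tors n.-1.
    rewrite eT => /set2P[]-> //; rewrite groupMr ?groupV //.
    by apply: (tors_le cycG _ f1); move: n2; clear; lia.
  (* e is the only element of T T which is not the square of a lonely element *)
  have := psetD SP (psetM SP pT pT) (pset_conv SP odd pT pT).
  rewrite (square_lonely cycG SP ne1 Ge ee tors1E Gx).
  set D := _ :\: _; suff -> : D = [set f] by [].
  apply/setP=> z; rewrite inE in_set1; apply/andP/eqP=> [[nz /mulsgP[a b Ta Tb ez]]|->].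
    have [eab|nab] := eqVneq a b.
      case/imsetP: nz; exists a; last by rewrite ez -eab.
      have Ga := subsetP (cl_subG SP Gx) a Ta.
      rewrite inE Ta -(cl_eq SP Ta) (tops a Ga (topT a Ta)); apply/set2P=> -[].
        by move/eqP; rewrite -{2}[a]mulg1 (inj_eq (mulgI a)) (negPf ne1).
      rewrite ef => /mulIg ea; case/negP: (topT a Ta).
      apply: (tors_le cycG (_ : 1 <= n.-1)%N); first by move: n2; clear; lia.
      by rewrite mem_tors // Ga expn1 expg2 -eq_invg_mul -ea eqxx.
    move: Ta Tb nab; rewrite ez eT => /set2P[]-> /set2P[]->; rewrite ?eqxx //.
      by rewrite mulKVg.
    by rewrite -mulgA (comm f) // mulKg.
  split; last first.
    by apply/mulsgP; exists x (x^-1 * f); rewrite ?eT ?mulKVg ?inE ?eqxx ?orbT.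
  apply/imsetP=> -[a]; rewrite inE => /andP[Ta _] fa.
  exact: (sq4 a (subsetP (cl_subG SP Gx) a Ta) (topT a Ta)).
have py : is_pset G P [set y; y^-1].
  have : y \in <[x]> by rewrite exG.
  case/cycleP=> k ey; have := yl; rewrite ey topk => ek.
  have -> : (x ^+ k)^-1 = (x^-1 * f) ^+ k.
    rewrite expgMn; last by apply: comm; rewrite ?groupV.
    rewrite expgVn -[in f ^+ k](odd_double_half k) (negPf ek) -mul2n add0n expgM f2.
    by rewrite expg1n mulg1.
  by apply: pset_pow2; rewrite -?eT // mulKVg.
have suby z : z \in cl y -> z = y \/ z = y^-1.
  by move=> zy; apply/set2P; apply: (pset_cl py _ zy); rewrite !inE eqxx.
case: (boolP (y^-1 \in cl y)) => [yv|nyv].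
  apply/eqP; rewrite eqEsubset; apply/andP; split.
    by apply/subsetP=> z /suby[]->; rewrite !inE eqxx ?orbT.
  by rewrite subUset !sub1set (mem_cl SP).
have ey : cl y = [set y].
  apply/eqP; rewrite eqEsubset sub1set (mem_cl SP) // andbT.
  apply/subsetP=> z zy; case: (suby z zy) => ez; first by rewrite ez inE.
  by rewrite -ez zy in nyv.
have p1 : is_pset G P [set y] by rewrite -ey; apply: (class_pset SP (cl_class SP Gy)).
have pyT := psetM SP p1 pT.
have Gyx : y * x \in G by rewrite groupM.
have nyx : y * x \notin tors n.-1 by rewrite groupMl.
have : (y * x)^-1 * f \in [set y] * T.
  apply: (pset_cl pyT (_ : y * x \in _)).
    by apply: mem_mulg; rewrite ?inE ?(mem_cl SP).
  by rewrite (tops _ Gyx nyx) !inE eqxx orbT.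
case/mulsgP=> u v; rewrite inE eT => /eqP-> /set2P[]->.
  move=> h; case: (sq4 _ Gyx nyx).
  by rewrite expg2 -{2}h mulKVg.
rewrite mulgA => /mulIg; rewrite comm ?groupV // => h.
have {}h : y^-1 = y.
  by move: h; rewrite invMg => /mulIg.
by rewrite h (mem_cl SP) in nyv.
Qed.

(** For n = 1 the first and second cases of [trivial_radical] coincide and are put
    into the second one here. *)
Lemma trivial_radical_classes :
  [\/ (1 < n)%N /\ T = G :\ 1,
      forall y, y \in G -> cl y = [set y]
    | (2 < n)%N /\ exists2 f, f \in tors 1 &
       (forall y, y \in tors n.-1 -> cl y = [set y; y^-1]) /\
       (forall a, a \in G -> a \notin tors n.-1 -> cl a = [set a; a^-1 * f])].
Proof.
case: (trivial_radical cycG cardG n_gt0 SP ne1 Ge ee tors1E Gx x_top radT).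
- move=> eT; have [n1|n1] := ltnP 1 n; first by constructor 1.
  have en : n = 1%N by move: n_gt0 n1; clear; lia.
  constructor 2; apply: discrete_of_singleton.
  have G1 z : z \in G -> (z == 1) || (z == e).
    by rewrite -tors1E -en (tors_top cycG cardG).
  have nx1 : x != 1 by apply: contraNneq x_top => ->; rewrite group1.
  have ex : x = e by have := G1 x Gx; rewrite (negPf nx1) => /eqP.
  rewrite eT; apply/setP=> z; rewrite !inE; apply/andP/eqP=> [[nz /G1]|->].
    by rewrite (negPf nz) ex => /eqP.
  by rewrite nx1.
- by move=> eT; constructor 2; apply: discrete_of_singleton.
case=> n2 eT; constructor 3; split=> //.
have l1 : 1 \in tors 1 by rewrite group1.
have le : e \in tors 1 by rewrite tors1E eqxx orbT.
by case: eT => eT; [exists 1 => //; apply: pair_classes; rewrite ?mulg1 | exists e => //; apply: pair_classes].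
Qed.

End TrivialRadicalClasses.

(** * The classes of the top layer in general *)

(** The two kinds of paired classes: x R together with either the inverse coset or
    the other coset of R that becomes inverse to it one step up the chain. *)
Definition mate (gT : finGroupType) (G : {group gT}) (s : bool) (r : nat) : {set gT} :=
  if s then torsion G r.+1 :\: torsion G r else torsion G r.

Definition fold_class (gT : finGroupType) (G : {group gT}) (s : bool) (r : nat) (x : gT) :=
  x *: torsion G r :|: x^-1 *: mate G s r.

Section PowerMorphism.

Variables (gT : finGroupType) (G : {group gT}) (m r : nat).
Hypotheses (cycG : cyclic G) (cardG : #|G| = (2 ^ m)%N) (le_rm : (r <= m)%N).

(** Kernel and image are members of the chain, so this map replaces the quotient by
    the subgroup of order 2^r. *)
Definition pow2 (x : gT) := x ^+ (2 ^ r).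

Lemma pow2M : {in G &, {morph pow2 : x y / x * y}}.
Proof. by move=> x y Gx Gy; apply: expgMn; exact: (commG cycG). Qed.

Definition pow2_morph := Morphism pow2M.

Lemma ker_pow2 : 'ker pow2_morph = torsion G r.
Proof. by apply/setP=> x; rewrite mem_tors // !inE. Qed.

Lemma card_pow2 : #|pow2_morph @* G| = (2 ^ (m - r))%N.
Proof.
have := card_preim_morphism (f := pow2_morph) (subxx _); rewrite morphimK // ker_pow2.
rewrite mulSGid ?tors_subG // cardG (card_tors cycG cardG le_rm) -{1}(subnKC le_rm) expnD.
by move/eqP; rewrite eqn_pmul2l ?expn_gt0 // => /eqP.
Qed.

Lemma tors_pow2 x i : x \in G ->
  (pow2 x \in torsion (pow2_morph @* G) i) = (x \in torsion G (r + i)).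
Proof.
move=> Gx; have fx : pow2 x \in pow2_morph @* G by apply: (mem_morphim pow2_morph).
rewrite !mem_tors ?(morphim_cyclic pow2_morph) // fx Gx /=.
by rewrite -expgM -expnD.
Qed.

End PowerMorphism.

Section Structure.

Variables (gT : finGroupType) (G : {group gT}) (m : nat).
Hypotheses (cycG : cyclic G) (cardG : #|G| = (2 ^ m)%N) (m_gt0 : (0 < m)%N).
Variable P : {set {set gT}}.
Hypothesis SP : schur G P.
Local Notation cl := (pblock P).
Local Notation tors := (torsion G).

Lemma top_exists : exists2 x, x \in G & x \notin tors m.-1.
Proof.
have : ~~ (tors m \subset tors m.-1).
  by rewrite (sub_torsE cycG cardG) // -ltnNge prednK.
by rewrite (tors_top cycG cardG) // => /subsetPn[x]; exists x.
Qed.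

(** Apply [trivial_radical_classes] to the image under [pow2] with r the exponent of
    the radical of T; preimages of classes are the products of classes with R. *)
Theorem structure : exists2 r, (r < m)%N & is_pset G P (tors r) /\
 [\/ (r.+1 < m)%N /\ (forall a, a \in G -> a \notin tors r -> cl a = G :\: tors r),
     (forall y, y \in G -> cl y * tors r = y *: tors r) /\
     (forall a, a \in G -> a \notin tors m.-1 -> cl a = a *: tors r)
   | (r.+2 < m)%N /\ exists s,
     (forall y, y \in tors m.-1 -> cl y * tors r = y *: tors r :|: y^-1 *: tors r) /\
     (forall a, a \in G -> a \notin tors m.-1 -> cl a = fold_class G s r a)].
Proof.
have [x Gx x_top] := top_exists.
have comm := commG cycG.
have PT := cl_class SP Gx; have pT := class_pset SP PT; set T := cl x in PT pT.
have Tx : x \in T := mem_cl SP Gx.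
have pR0 := pset_stab SP pT.
have gR : group_set [set g in G | g *: T == T].
  apply/group_setP; split; first by rewrite inE group1 lcoset1 eqxx.
  move=> g h; rewrite !inE => /andP[Gg /eqP eg] /andP[Gh /eqP eh].
  by rewrite groupM // lcosetM eh eg eqxx.
have [r le_r eR] := sub_tors cycG cardG (pset_subG pR0 : Group gR \subset G).
have {}eR : [set g in G | g *: T == T] = tors r := congr1 (@gval gT) eR.
have pR : is_pset G P (tors r) by rewrite -eR.
have radE g : g \in G -> (g \in tors r) = (g *: T == T) by move=> Gg; rewrite -eR inE Gg.
have lt_r : (r < m)%N.
  rewrite ltn_neqAle le_r andbT; apply: contraNneq x_top => er.
  have T1 : 1 \in T.
    have : x^-1 *: T == T by rewrite -radE ?groupV // er (tors_top cycG cardG).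
    by move/eqP <-; rewrite mem_lcoset invgK mulg1.
  have : x \in cl 1 by rewrite (cl_eq SP T1).
  have P1 : [set 1] \in P by case: SP.
  by rewrite (cl_def SP P1) ?inE // => /eqP->; rewrite group1.
exists r => //; split=> //.
have TR : T * tors r = T.
  apply/eqP; rewrite eqEsubset mulG_subl andbT; apply/subsetP=> _ /mulsgP[t g Tt rg ->].
  have Gg := torsG cycG rg; have Gt := subsetP (pset_subG pT) _ Tt.
  move: rg; rewrite radE // => /eqP <-.
  by rewrite (comm t g) // mem_lcoset mulKg.
have toptop a : a \in G -> a \notin tors m.-1 -> cl a * tors r = cl a.
  move=> Ga na; apply/eqP; rewrite eqEsubset mulG_subl andbT.
  have : a \in <[x]> by rewrite (top_gen cycG cardG m_gt0 Gx x_top).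
  case/cycleP=> k ea.
  have ok : odd k.
    move: na; rewrite ea (pow_tors cycG cardG) ?leq_pred //; last exact: (top_gen cycG cardG).
    by rewrite -subn1 subKn // expn1 dvdn2 negbK.
  have cop : coprime #|G| k by rewrite cardG coprimeXl // coprime2n.
  rewrite ea (cl_power SP cycG cop Gx); apply/subsetP=> _ /mulsgP[_ g /imsetP[t Tt ->] rg ->].
  have Gg := torsG cycG rg; have Gt := subsetP (pset_subG pT) _ Tt.
  apply/imsetP; exists (t * g ^+ expg_invn G k).
    by rewrite -/T -TR mem_mulg ?groupX.
  rewrite expgMn; last by apply: comm; rewrite ?groupX.
  by congr (_ * _); rewrite -expgM mulnC expgM (expgK cop Gg).
pose f := pow2_morph r cycG; pose H := (f @* G)%G.
have kerf : 'ker f = tors r := ker_pow2 r cycG.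
have cycH : cyclic H by apply: morphim_cyclic.
have cardH : #|H| = (2 ^ (m - r))%N := card_pow2 cycG cardG le_r.
have n0 : (0 < m - r)%N by rewrite subn_gt0.
have kP : is_pset G P ('ker f) by rewrite kerf.
have SQ : schur H (push f P) := schur_push SP kP.
have torsf z i : z \in G -> (f z \in torsion H i) = (z \in tors (r + i)) := @tors_pow2 _ _ r cycG z i.
have clf z : z \in G -> pblock (push f P) (f z) = f @: cl z := pblock_push SP kP (x := z).
have memf z y : z \in G -> y \in G -> (f z \in f @: cl y) = (z \in cl y * tors r).
  by move=> Gz Gy; rewrite -kerf; apply: mem_push => //; apply: (cl_subG SP Gy).
have f_top z : z \in G -> (f z \in torsion H (m - r).-1) = (z \in tors m.-1).
  by move=> Gz; rewrite torsf //; congr (z \in tors _); move: lt_r; clear; lia.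
have feq z y : z \in G -> y \in G -> (f z == f y) = (z \in y *: tors r).
  move=> Gz Gy; rewrite mem_lcoset -kerf; apply/eqP/idP=> [e|].
    by apply/kerP; rewrite ?groupM ?groupV // morphM ?groupV // morphV // e mulVg.
  case/(kerP _ (groupM (groupVr Gy) Gz)); rewrite morphM ?groupV // morphV // => e.
  by rewrite -(mulKVg (f y) (f z)) e mulg1.
have liftC (C : {set gT}) y : C \subset G -> y \in G ->
    (forall z, z \in G -> (f z \in pblock (push f P) (f y)) = (z \in C)) ->
    cl y * tors r = C.
  move=> sCG Gy h; apply/setP=> z; case Gz: (z \in G).
    by rewrite -memf // -clf // h.
  apply/idP/idP=> [|/(subsetP sCG)]; last by rewrite Gz.
  case/mulsgP=> c g yc rg ez; move: Gz; rewrite ez groupM //; last exact: torsG rg.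
  exact: subsetP (cl_subG SP Gy) _ yc.
have [e [ne1 He ee tors1H]] := involution cycH cardH n0.
have [u Gu fu] : exists2 u, u \in G & e = f u.
  by move: He; rewrite /= morphimEdom => /imsetP[u Gu ->]; exists u.
have uR : u \in tors r.+1 /\ u \notin tors r.
  split; first by rewrite -addn1 -torsf // -fu tors1H eqxx orbT.
  by move: ne1; rewrite fu -(morph1 f) feq // mem_lcoset invg1 mul1g.
have Hx : f x \in H by apply: mem_morphim.
have fx_top : f x \notin torsion H (m - r).-1 by rewrite f_top.
have radH : e *: pblock (push f P) (f x) != pblock (push f P) (f x).
  rewrite clf //; apply/eqP=> h; case: uR => _ /negP[].
  rewrite radE // eq_sym eqEcard card_lcoset leqnn andbT.
  apply/subsetP=> t Tt; have Gt := subsetP (pset_subG pT) _ Tt.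
  rewrite mem_lcoset -TR -memf ?groupM ?groupV // morphM ?groupV // morphV //.
  by rewrite -mem_lcoset -fu h memf // TR.
have sclG s a : a \in G -> fold_class G s r a \subset G.
  move=> Ga; rewrite subUset; apply/andP; split.
    by apply/subsetP=> _ /lcosetP[g rg ->]; rewrite groupM // (torsG cycG rg).
  apply/subsetP=> _ /lcosetP[g rg ->]; rewrite groupM ?groupV //.
  by move: rg; rewrite /mate; case: s => [/setDP[]|] /(torsG cycG).
case: (trivial_radical_classes cycH cardH n0 SQ ne1 He ee tors1H Hx fx_top radH).
- case=> n1 eT; constructor 1; split; first by move: n1 lt_r; clear; lia.
  have eTG : T = G :\: tors r.
    rewrite -TR; apply: liftC => //; first exact: subsetDl.
    move=> z Gz; rewrite eT !inE Gz andbT mem_morphim // andbT.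
    by rewrite -(morph1 f) feq // mem_lcoset invg1 mul1g.
  move=> a Ga na; rewrite -eTG; apply: (cl_eq SP); rewrite -/T eTG inE na Ga.
  by [].
- move=> h; constructor 2.
  have h1 y : y \in G -> cl y * tors r = y *: tors r.
    move=> Gy; apply: liftC => //.
      by apply/subsetP=> _ /lcosetP[g rg ->]; rewrite groupM // (torsG cycG rg).
    by move=> z Gz; rewrite h ?mem_morphim // inE feq.
  by split=> // a Ga na; rewrite -(toptop a) // h1.
case=> n2 [phi phi1 [hlow htop]]; constructor 3; split.
  by move: n2; clear; lia.
have [s hs] : exists s, forall z a, z \in G -> a \in G ->
    (f z == (f a)^-1 * phi) = (z \in a^-1 *: mate G s r).
  have sh z a w : z \in G -> a \in G -> w \in G -> (f z == (f a)^-1 * f w) = (a * z \in w *: tors r).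
    move=> Gz Ga Gw; rewrite -feq ?groupM // morphM //.
    by rewrite -(inj_eq (mulgI (f a))) mulKVg.
  move: phi1; rewrite tors1H => /orP[]/eqP->.
    exists false => z a Gz Ga; rewrite -(morph1 f) sh // lcoset1.
    by rewrite mem_lcoset invgK.
  exists true => z a Gz Ga; rewrite fu sh // [RHS]mem_lcoset invgK /mate.
  case: uR => u1 u0; apply/lcosetP/setDP=> [[g rg ->]|[h1 h2]].
    by split; [rewrite groupM // (tors_le cycG _ rg) | rewrite groupMr].
  exists (u^-1 * (a * z)); last by rewrite mulKVg.
  exact: (tors_diff cycG cardG).
exists s; split=> [y yl|a Ga na].
  have Gy := torsG cycG yl.
  have -> : y *: tors r :|: y^-1 *: tors r = fold_class G false r y by [].
  apply: liftC => // [|z Gz]; first exact: sclG.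
  rewrite hlow ?f_top // !inE feq // -morphV // feq ?groupV //.
rewrite -(toptop a) //; apply: liftC => // [|z Gz]; first exact: sclG.
by rewrite htop ?mem_morphim ?f_top // !inE feq // hs.
Qed.

End Structure.

(** * Extending Schur partitions from a subgroup *)

Section Extension.

Variable gT : finGroupType.
Implicit Types (H K R : {group gT}) (P : {set {set gT}}) (A B C : {set gT}).
Implicit Types (x y z w : gT) (c : gT -> {set gT}).

Definition restr P H := [set C in P | C \subset H].
Definition ext P H K c := P :|: [set c y | y in K :\: H].

(** The sets c y partition the complement of H in K. *)
Definition class_map H K c := [/\ forall y, y \in K :\: H -> y \in c y,
  forall y, y \in K :\: H -> c y \subset K :\: H
  & forall y z, y \in K :\: H -> z \in c y -> c z = c y].

Lemma conv_nil A B z (K : {group gT}) : A \subset K -> B \subset K -> z \notin K ->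
  conv A B z = 0%N.
Proof.
move=> sAK sBK nz; apply/eqP; rewrite cards_eq0; apply/eqP/setP=> a; rewrite !inE.
apply/negP=> /andP[Aa Baz]; case/negP: nz.
by rewrite -(mulKVg a z); exact: groupM (subsetP sAK _ Aa) (subsetP sBK _ Baz).
Qed.

Lemma pblock_restr K H P y : schur K P -> is_pset K P H -> y \in H ->
  pblock (restr P H) y = pblock P y.
Proof.
move=> SP pH Hy; have Ky := subsetP (pset_subG pH) _ Hy.
have tP : trivIset (restr P H).
  case: SP => /and3P[_ tP _] _ _ _; apply: trivIsetS tP.
  by apply/subsetP=> C; rewrite inE => /andP[].
apply: (def_pblock tP); last exact: (mem_cl SP).
rewrite inE (cl_class SP) //; apply/subsetP=> z; exact: (pset_cl pH Hy).
Qed.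

Lemma schur_restr K H P : schur K P -> is_pset K P H -> schur H (restr P H).
Proof.
move=> SP pH; split.
- exact: (pset_partition SP pH).
- by rewrite inE sub1set group1 andbT; case: SP.
- move=> C; rewrite !inE => /andP[PC sCH].
  have [_ _ h _] := SP; rewrite h //=.
  by apply/subsetP=> _ /imsetP[x Cx ->]; rewrite groupV (subsetP sCH).
move=> A B C; rewrite !inE => /andP[PA _] /andP[PB _] /andP[PC _].
by case: SP => _ _ _; apply.
Qed.

Section Ext.

Variables (H K : {group gT}) (P : {set {set gT}}) (c : gT -> {set gT}).
Hypotheses (sHK : H \subset K) (pP : partition P H) (cm : class_map H K c).

Lemma ext_partition : partition (ext P H K c) K.
Proof.
case: cm => c1 c2 c3; have /and3P[/eqP covP tP nP] := pP.
apply/and3P; split.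
- rewrite eqEsubset; apply/andP; split.
    apply/bigcupsP=> C /setUP[PC|/imsetP[y yK ->]].
      by apply: subset_trans sHK; apply: (class_sub pP).
    by apply: subset_trans (c2 y yK) _; apply: subsetDl.
  apply/subsetP=> y Ky; case: (boolP (y \in H)) => Hy.
    apply/bigcupP; exists (pblock P y); last by rewrite mem_pblock covP.
    by rewrite inE pblock_mem ?covP.
  have yK : y \in K :\: H by rewrite inE Hy.
  apply/bigcupP; exists (c y); last exact: c1.
  by rewrite inE imset_f ?orbT.
- apply/trivIsetP=> A B hA hB nAB.
  apply/pred0Pn=> -[z /andP[/= Az Bz]]; case/negP: nAB; apply/eqP.
  case/setUP: hA hB Az => [PA|/imsetP[y yK ->]] /setUP[PB|/imsetP[y' yK' eB]] Az.
  + by rewrite -(def_pblock tP PA Az) (def_pblock tP PB Bz).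
  + rewrite eB in Bz; have := subsetP (c2 y' yK') z Bz.
    by rewrite inE (subsetP (class_sub pP PA) z Az).
  + have := subsetP (c2 y yK) z Az.
    by rewrite inE (subsetP (class_sub pP PB) z Bz).
  by rewrite eB in Bz *; rewrite -(c3 y z) // (c3 y' z).
apply/negP=> /setUP[]; first by rewrite (negPf nP).
by case/imsetP=> y yK e; have := c1 y yK; rewrite -e inE.
Qed.

Lemma pblock_ext_out y : y \in K -> y \notin H -> pblock (ext P H K c) y = c y.
Proof.
move=> Ky Hy; have yK : y \in K :\: H by rewrite inE Hy.
have /and3P[_ tE _] := ext_partition; case: cm => c1 _ _.
by apply: (def_pblock tE); rewrite ?c1 // inE imset_f ?orbT.
Qed.

Lemma pblock_ext_in y : y \in H -> pblock (ext P H K c) y = pblock P y.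
Proof.
move=> Hy; have /and3P[_ tE _] := ext_partition.
have cy : y \in cover P by rewrite (cover_partition pP).
by apply: (def_pblock tE); rewrite ?mem_pblock // inE pblock_mem.
Qed.

Lemma restr_ext : restr (ext P H K c) H = P.
Proof.
case: cm => c1 c2 _.
apply/setP=> C; rewrite inE; apply/andP/idP=> [[/setUP[//|/imsetP[y yK ->]] sC]|PC].
  by have := c1 y yK => /(subsetP sC); move: yK; rewrite inE => /andP[/negPf->].
by rewrite inE PC (class_sub pP).
Qed.

End Ext.

Lemma ext_restr H K P c : schur K P -> is_pset K P H ->
  (forall y, y \in K -> y \notin H -> pblock P y = c y) ->
  P = ext (restr P H) H K c.
Proof.
move=> SP pH h; apply/setP=> C; apply/idP/setUP=> [PC|].
  have [x Cx] := class_nonempty SP PC; have Kx := subsetP (pset_subG (class_pset SP PC)) _ Cx.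
  case: (boolP (x \in H)) => Hx; [left|right].
    rewrite inE PC -(cl_def SP PC Cx); apply/subsetP=> z; exact: (pset_cl pH Hx).
  by apply/imsetP; exists x; rewrite ?inE ?Hx // -h // (cl_def SP PC Cx).
case=> [|/imsetP[y]]; first by rewrite inE => /andP[].
by rewrite inE => /andP[Hy Ky] ->; rewrite -h // (cl_class SP).
Qed.

(** The products of two old classes, and of an old and a new one outside the new
    layer, need no condition. *)
Lemma schur_ext H K P c :
    abelian K -> H \subset K -> schur H P -> class_map H K c ->
    (forall x, x \in K :\: H -> [set y^-1 | y in c x] = c x^-1) ->
    (forall A x z w, A \in P -> x \in K :\: H -> z \in K :\: H -> w \in c z ->
       conv A (c x) w = conv A (c x) z) ->
    (forall x y z w, x \in K :\: H -> y \in K :\: H -> z \in H ->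
       w \in pblock P z -> conv (c x) (c y) w = conv (c x) (c y) z) ->
    (forall x y z w, x \in K :\: H -> y \in K :\: H -> z \in K :\: H ->
       w \in c z -> conv (c x) (c y) w = conv (c x) (c y) z) ->
  schur K (ext P H K c).
Proof.
move=> abK sHK SP cm cV cAx cxH cxK.
have pP : partition P H by case: SP.
have pE := ext_partition sHK pP cm; have [c1 c2 c3] := cm.
have convC A B z : A \subset K -> B \subset K -> z \in K -> conv A B z = conv B A z.
  move=> sAK sBK Kz; have inj : injective (fun a => a^-1 * z).
    by move=> a b /mulIg/invg_inj.
  rewrite /conv -(card_imset _ inj); apply: eq_card => b; rewrite inE.
  have K1 a : a \in K -> (a^-1 * z)^-1 * z = a.
    move=> Ka; rewrite invMg invgK -mulgA (centsP abK a Ka z Kz) mulKg.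
    by [].
  apply/imsetP/andP=> [[a]|[Bb Ab]].
    by rewrite inE => /andP[Aa Ba] ->; rewrite K1 ?(subsetP sAK).
  by exists (b^-1 * z); rewrite ?inE ?K1 ?(subsetP sBK) // Ab.
have nK z : z \in K :\: H -> z \notin H by rewrite inE => /andP[].
have sP A : A \in P -> A \subset H by move/(class_sub pP).
have sPK A : A \in P -> A \subset K by move/sP/subset_trans; apply.
have scK x : x \in K :\: H -> c x \subset K.
  by move=> xK; apply: subset_trans (c2 x xK) _; apply: subsetDl.
have zero A x z : A \in P -> x \in K :\: H -> z \in H -> conv A (c x) z = 0%N.
  move=> PA xK Hz; apply/eqP; rewrite cards_eq0; apply/eqP/setP=> a; rewrite !inE.
  apply/negP=> /andP[Aa] /(subsetP (c2 x xK)); rewrite inE groupMr ?groupV //.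
    by rewrite (subsetP (sP A PA)).
have main A x z w : A \in P -> x \in K :\: H -> z \in K -> w \in pblock (ext P H K c) z ->
    conv A (c x) w = conv A (c x) z.
  move=> PA xK Kz; case: (boolP (z \in H)) => Hz.
    rewrite (pblock_ext_in sHK) // => wz.
    by rewrite !zero // (subsetP (cl_subG SP Hz)).
  rewrite (pblock_ext_out sHK) // => wz.
  by apply: cAx; rewrite // inE Hz.
split=> //.
- by rewrite inE; case: SP => _ -> _ _.
- move=> C /setUP[PC|/imsetP[y yK ->]]; rewrite inE.
    by case: SP => _ _ -> // _.
  rewrite cV // imset_f ?orbT // inE groupV nK //= groupV.
  by move: yK; rewrite inE => /andP[].
move=> A B C hA hB hC z w Cz Cw; apply/esym.
have Kz : z \in K by rewrite (subsetP (class_sub pE hC)).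
have Kw : w \in K by rewrite (subsetP (class_sub pE hC)).
have wz : w \in pblock (ext P H K c) z.
  by case/and3P: pE => _ tE _; rewrite (def_pblock tE hC Cz).
case/setUP: hA => [PA|/imsetP[x xK ->]]; case/setUP: hB => [PB|/imsetP[y yK ->]].
- case: (boolP (z \in H)) => Hz.
    rewrite (pblock_ext_in sHK) // in wz.
    by apply: (conv_class SP); rewrite ?(class_pset SP).
  rewrite (pblock_ext_out sHK) // in wz.
  have wK : w \in K :\: H by apply: (subsetP (c2 z _)); rewrite // inE Hz.
  by rewrite !(conv_nil (sP A PA) (sP B PB)) ?nK // inE Hz.
- exact: main.
- by rewrite !(convC (c x)) ?scK ?sPK //; apply: main.
case: (boolP (z \in H)) => Hz.
  by rewrite (pblock_ext_in sHK) // in wz; apply: cxH.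
by rewrite (pblock_ext_out sHK) // in wz; apply: cxK; rewrite // inE Hz.
Qed.

Lemma class_map_block H K : class_map H K (fun=> K :\: H).
Proof. by split. Qed.

(** Old elements permute the cosets of H, so all the counts are evident. *)
Lemma schur_ext_block H K P : abelian K -> H \subset K -> schur H P ->
  schur K (ext P H K (fun=> K :\: H)).
Proof.
move=> abK sHK SP; have pP : partition P H by case: SP.
have nK z : z \in K :\: H -> z \notin H by rewrite inE => /andP[].
have KK z : z \in K :\: H -> z \in K by rewrite inE => /andP[].
apply: schur_ext => //.
- move=> x _; apply/setP=> y; apply/imsetP/idP=> [[z zK ->]|yK].
    by rewrite inE !groupV -in_setD.
  by exists y^-1; rewrite ?invgK // inE !groupV -in_setD.
- move=> A x z w PA xK zK wz; have sA := subsetP (class_sub pP PA).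
  have E u : u \in K :\: H -> conv A (K :\: H) u = #|A|.
    move=> uK; apply: eq_card => a; rewrite !inE; case Aa: (a \in A) => //=.
    have Ha : a^-1 \in H by rewrite groupV sA.
    have Ka : a^-1 \in K by rewrite (subsetP sHK).
    by rewrite (groupMl _ Ha) (groupMl _ Ka) nK // KK.
  by rewrite !E.
- move=> x y z w xK yK Hz wz.
  have E u : u \in H -> conv (K :\: H) (K :\: H) u = #|K :\: H|.
    move=> Hu; apply: eq_card => a; rewrite !inE; case Ka: (a \in K); rewrite ?andbF //.
    case Ha: (a \in H) => //=.
    have Ku : u \in K by rewrite (subsetP sHK).
    by rewrite (groupMr _ Hu) (groupMr _ Ku) !groupV Ha Ka.
  by rewrite !E // (subsetP (cl_subG SP Hz)).
move=> x y z w xK yK zK wz.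
have E u : u \in K :\: H -> conv (K :\: H) (K :\: H) u = (#|K :\: H| - #|H|)%N.
  move=> uK; have Ku := KK u uK; have sub : u *: H \subset K :\: H.
    apply/subsetP=> _ /lcosetP[h Hh ->]; rewrite inE groupMr // nK //=.
    by rewrite groupM // (subsetP sHK).
  rewrite -(card_lcoset H u) -(cardsID (u *: H)) (setIidPr sub) addKn.
  apply: eq_card => a; rewrite !inE mem_lcoset -[in RHS]groupV invMg invgK.
  case Ka: (a \in K); rewrite ?andbF //=.
  have KaV : a^-1 \in K by rewrite groupV Ka.
  by rewrite (groupMl _ KaV) Ku !andbT andbC.
by rewrite !E.
Qed.

Section Cosets.

Variables (H K R : {group gT}) (P : {set {set gT}}).
Hypotheses (abK : abelian K) (sHK : H \subset K) (sRH : R \subset H).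
Hypothesis index2 : forall x y, x \in K :\: H -> y \in K :\: H -> x * y \in H.
Hypothesis SP : schur H P.

Let pP : partition P H. Proof. by case: SP. Qed.
Let nK z : z \in K :\: H -> z \notin H. Proof. by rewrite inE => /andP[]. Qed.
Let KK z : z \in K :\: H -> z \in K. Proof. by rewrite inE => /andP[]. Qed.
Let RH z : z \in R -> z \in H. Proof. exact: subsetP. Qed.
Let HK z : z \in H -> z \in K. Proof. exact: subsetP. Qed.
Let comm x y : x \in K -> y \in K -> x * y = y * x.
Proof. by move=> Kx Ky; apply: (centsP abK). Qed.

Let zeroK (A B : {set gT}) z : A \subset K :\: H -> B \subset K :\: H -> z \notin H ->
  conv A B z = 0%N.
Proof.
move=> sA sB nz; apply/eqP; rewrite cards_eq0; apply/eqP/setP=> a; rewrite !inE.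
apply/negP=> /andP[/(subsetP sA) Ka /(subsetP sB) Kaz].
by have := index2 Ka Kaz; rewrite mulKVg (negPf nz).
Qed.

Let conv_R (A B : {set gT}) z g : (forall u h, h \in R -> (u * h \in B) = (u \in B)) ->
  g \in R -> conv A B (z * g) = conv A B z.
Proof.
by move=> BR Rg; apply: eq_card => a; rewrite !inE mulgA BR.
Qed.

Lemma class_map_coset : class_map H K (fun x => x *: R).
Proof.
split=> [y _|y yK|y z yK]; rewrite ?lcoset_refl //; last by move/lcoset_eqP.
apply/subsetP=> _ /lcosetP[h Rh ->]; rewrite inE.
by rewrite (groupMr _ (RH Rh)) (groupMr _ (HK (RH Rh))) nK // KK.
Qed.

(** All the counts are invariant under R, whose cosets contain all classes. *)
Lemma schur_ext_coset : (forall y, y \in H -> pblock P y \subset y *: R) ->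
  schur K (ext P H K (fun x => x *: R)).
Proof.
move=> DP.
have cR x u h : h \in R -> (u * h \in x *: R) = (u \in x *: R).
  by move=> Rh; rewrite !mem_lcoset mulgA groupMr.
have [_ scK _] := class_map_coset.
apply: schur_ext => //; first exact: class_map_coset.
- move=> x xK; apply/setP=> y; rewrite mem_lcoset invgK; apply/imsetP/idP.
    case=> z; rewrite mem_lcoset => xz ->.
    have Kz : z \in K by rewrite -(mulKVg x z); exact: groupM (KK xK) (HK (RH xz)).
    by rewrite (comm (KK xK)) ?groupV // -groupV invMg invgK.
  have Kxv : x^-1 \in K by rewrite groupV KK.
  move=> xy; have Ky : y \in K.
    by rewrite -(mulKg x y); exact: groupM Kxv (HK (RH xy)).
  exists y^-1; rewrite ?invgK // mem_lcoset -groupV invMg !invgK.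
  by rewrite -(comm (KK xK) Ky).
- by move=> A x z _ PA xK zK /lcosetP[h Rh ->]; apply: conv_R => // *; apply: cR.
- move=> x y z w xK yK Hz /(subsetP (DP z Hz)) /lcosetP[h Rh ->].
  by apply: conv_R => // *; apply: cR.
move=> x y z w xK yK zK /(subsetP (scK z zK)) wK.
by rewrite !zeroK ?scK ?nK.
Qed.

Variable e : gT.
Hypotheses (He : e \in H) (Ree : e * e \in R) (pR : is_pset H P R).

Let c x := x *: R :|: (x^-1 * e) *: R.

Let Ke : e \in K. Proof. exact: HK. Qed.

Let cR x u h : h \in R -> (u * h \in c x) = (u \in c x).
Proof.
by move=> Rh; rewrite !inE !mem_lcoset !mulgA !(groupMr _ Rh).
Qed.

(** The involution that exchanges the two halves of a class. *)
Let cV x u : x \in K -> u \in K -> (u^-1 * e \in c x) = (u \in c x).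
Proof.
move=> Kx Ku; rewrite !inE !mem_lcoset orbC; congr (_ || _).
  have K1 : e^-1 * x \in K by rewrite groupM ?groupV.
  have K2 : u^-1 * e \in K by rewrite groupM ?groupV.
  by rewrite invMg invgK (comm K1 K2) mulgA mulgK -groupV invMg invgK.
rewrite -[LHS]groupV !invMg !invgK; congr (_ \in R).
by rewrite -!mulgA (comm Ku).
Qed.

Let scK x : x \in K :\: H -> c x \subset K :\: H.
Proof.
move=> xK; apply/subsetP=> z /setUP[] /lcosetP[h Rh ->].
  by rewrite inE (groupMr _ (RH Rh)) (groupMr _ (HK (RH Rh))) nK // KK.
rewrite inE (groupMr _ (RH Rh)) (groupMr _ (HK (RH Rh))).
by rewrite (groupMr _ He) (groupMr _ Ke) !groupV nK // KK.
Qed.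

Let c1 x : x \in c x.
Proof. by rewrite inE lcoset_refl. Qed.

Let ceq x y : x \in K :\: H -> y \in c x -> c y = c x.
Proof.
move=> xK yx; have Kx := KK xK; have Ky := KK (subsetP (scK xK) _ yx).
have cs z : z \in K -> z^-1 * e \in K by move=> Kz; rewrite groupM ?groupV.
have e1 z : z \in K -> (z *: R \subset c x) = (z \in c x).
  move=> Kz; apply/subsetP/idP=> [|zx _ /lcosetP[h Rh ->]]; last by rewrite cR.
  by apply; apply: lcoset_refl.
have sub z : z \in K -> z \in c x -> c z \subset c x.
  by move=> Kz zx; rewrite subUset !e1 ?cs // cV ?zx.
apply/eqP; rewrite eqEsubset sub //=.
have xy : x \in c y.
  move: yx; rewrite !inE !mem_lcoset => /orP[h|h]; apply/orP; [left|right].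
    by rewrite -groupV invMg invgK.
  by move: h; rewrite !invMg !invgK -!mulgA (comm Ky Kx).
have e2 z : z \in K -> (z *: R \subset c y) = (z \in c y).
  move=> Kz; apply/subsetP/idP=> [|zx _ /lcosetP[h Rh ->]]; last by rewrite cR.
  by apply; apply: lcoset_refl.
by rewrite subUset !e2 ?cs // cV // xy.
Qed.

Lemma class_map_fold : class_map H K (fun x => x *: R :|: (x^-1 * e) *: R).
Proof. by split=> [y _|y|y z]; [apply: c1 | apply: scK | apply: ceq]. Qed.

(** Counts in the new layer are invariant under R, so it remains to compare the
    count at z with that at z^-1 e or at z^-1.  The involution of the new classes
    turns one into the other, up to replacing an old class A by A^-1, and these
    two meet R-invariant sets equally. *)
Lemma schur_ext_fold :
    (forall y, y \in H -> pblock P y * R = y *: R :|: y^-1 *: R) ->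
  schur K (ext P H K (fun x => x *: R :|: (x^-1 * e) *: R)).
Proof.
move=> EP.
(* A R contains with a coset its inverse, and A meets its cosets equally *)
have sym A u : A \in P -> u \in K -> #|A :&: u *: R| = #|A^-1 :&: u *: R|.
  move=> PA Ku; have sA := subsetP (class_sub pP PA).
  have -> : #|A^-1 :&: u *: R| = #|A :&: u^-1 *: R|.
    rewrite -(card_imset _ invg_inj); apply: eq_card => a; rewrite inE mem_lcoset invgK.
    apply/imsetP/andP=> [[b]|[Aa ua]].
      rewrite !inE mem_lcoset => /andP[Ab ub] ->; split=> //.
      have Kb : b \in K by rewrite -groupV HK // sA.
      by rewrite (comm Ku) ?groupV // -groupV invMg invgK.
    have Ka : a \in K by rewrite HK // sA.
    exists a^-1; rewrite ?invgK // !inE invgK Aa mem_lcoset -groupV invMg !invgK.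
    by rewrite comm.
  have half v : v \in K -> (exists a, a \in A :&: v *: R) -> exists b, b \in A :&: v^-1 *: R.
    move=> Kv [a /setIP[Aa va]]; have Ha := sA a Aa; have Ka := HK Ha.
    have : a^-1 \in pblock P a * R by rewrite EP // !inE !lcoset_refl orbT.
    rewrite (cl_def SP PA Aa) => /mulsgP[b g Ab Rg eb].
    have Kb : b \in K by rewrite HK // sA.
    exists b; rewrite inE Ab mem_lcoset invgK.
    have -> : b = a^-1 * g^-1 by rewrite eb mulgK.
    rewrite mulgA groupMr ?groupV // -groupV invMg invgK.
    move: va; rewrite mem_lcoset comm ?groupV //.
  have eq2 v a b : a \in A :&: v *: R -> b \in A :&: v^-1 *: R ->
      #|A :&: v *: R| = #|A :&: v^-1 *: R|.
    move=> /setIP[Aa /lcoset_eqP <-] /setIP[Ab /lcoset_eqP <-].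
    exact: (card_class_coset SP pR).
  have KuV : u^-1 \in K by rewrite groupV.
  have [e0|/set0Pn[a ua]] := eqVneq (A :&: u *: R) set0.
    have [e0'|/set0Pn hb] := eqVneq (A :&: u^-1 *: R) set0; first by rewrite e0 e0'.
    by have [a] := half _ KuV hb; rewrite invgK e0 inE.
  have [b ub] := half u Ku (ex_intro _ a ua); exact: eq2 ua ub.
have cnt (B W : {set gT}) : (forall u h, h \in R -> (u * h \in W) = (u \in W)) ->
    (\sum_(u in W) #|B :&: u *: R| = #|B :&: W| * #|R|)%N.
  move=> WR; transitivity (\sum_(u in W) \sum_(a in B) (a \in u *: R))%N.
    apply: eq_bigr => u _; rewrite -sum1_card big_mkcond [RHS]big_mkcond /=.
    by apply: eq_bigr => a _; rewrite inE; case: (a \in B); case: (_ \in _).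
  rewrite exchange_big /= -sum_nat_const big_mkcond [RHS]big_mkcond /=.
  apply: eq_bigr => a _; rewrite inE; case: (a \in B) => //=.
  transitivity #|W :&: a *: R|.
    rewrite -sum1_card big_mkcond [RHS]big_mkcond /=.
    apply: eq_bigr => u _; rewrite inE !mem_lcoset; case: (u \in W) => //=.
    by rewrite -groupV invMg invgK; case: (_ \in _).
  case: ifP => aW.
    rewrite -(card_lcoset R a); apply: eq_card => u; rewrite inE andb_idl //.
    by case/lcosetP=> h Rh ->; rewrite WR.
  apply/eqP; rewrite cards_eq0; apply/eqP/setP=> u; rewrite !inE.
  by apply/negP=> /andP[Wu /lcosetP[h Rh eu]]; rewrite eu WR // aW in Wu.
have symW A (W : {set gT}) : A \in P -> W \subset K ->
    (forall u h, h \in R -> (u * h \in W) = (u \in W)) -> #|A :&: W| = #|A^-1 :&: W|.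
  move=> PA sWK WR; apply/eqP; rewrite -(eqn_pmul2r (cardG_gt0 R)) -!cnt //.
  by apply/eqP; apply: eq_bigr => u Wu; apply: sym => //; apply: (subsetP sWK).
have memK x u : x \in K :\: H -> u \in c x -> u \in K.
  by move=> xK /(subsetP (scK xK))/KK.
apply: (@schur_ext H K P c) => //.
- move=> x xK; have Kx := KK xK.
  have E y : y \in K -> (y^-1 \in c x^-1) = (y \in c x).
    move=> Ky; rewrite !inE !mem_lcoset; congr (_ || _).
      by rewrite -groupV !invMg !invgK (comm Ky) ?groupV.
    rewrite -groupV !invMg !invgK.
    have -> : y * (x * e) = (e * e) * (e^-1 * x * y).
      rewrite (comm Ky) ?groupM // -!mulgA mulKVg mulgA (comm Kx Ke) -mulgA.
      by [].
    by rewrite (groupMl _ Ree).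
  apply/setP=> y; apply/imsetP/idP=> [[z zx ->]|yx].
    by rewrite E // (memK x).
  have xKV : x^-1 \in K :\: H by rewrite inE !groupV -in_setD.
  by exists y^-1; rewrite ?invgK // -E ?groupV ?(memK _ _ xKV yx) // invgK.
- move=> A x z w PA xK zK wz; have sA := subsetP (class_sub pP PA).
  have Kx := KK xK; have Kz := KK zK.
  case/setUP: wz => /lcosetP[h Rh ->]; rewrite conv_R //; try by move=> *; apply: cR.
  pose W := [set a in K | a * z \in c x].
  have inW a : (a \in W) = (a \in K) && (a * z \in c x) by apply: in_set.
  have WR u g : g \in R -> (u * g \in W) = (u \in W).
    move=> Rg; have Kg := HK (RH Rg); rewrite !inW (groupMr _ Kg).
    case Ku: (u \in K) => //=.
    by rewrite -mulgA (comm Kg Kz) mulgA cR.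
  have sWK : W \subset K by apply/subsetP=> a; rewrite inW => /andP[].
  have -> : conv A (c x) (z^-1 * e) = #|A :&: W|.
    apply: eq_card => a; rewrite in_set in_setI inW; case Aa: (a \in A) => //=.
    have Ka : a \in K by rewrite HK // sA.
    rewrite Ka /= -[RHS]cV ?groupM //; congr (_ \in c x).
    by rewrite invMg mulgA (comm (groupVr Ka)) ?groupV.
  rewrite (symW A W) // -(card_imset _ invg_inj); apply: eq_card => a.
  rewrite in_set; apply/imsetP/andP=> [[b]|[Aa aW]].
    by rewrite in_setI inW inE => /andP[Ab /andP[Kb bz]] ->; rewrite invgK.
  have Ka : a \in K by rewrite HK // sA.
  by exists a^-1; rewrite ?invgK // in_setI inW inE invgK Aa groupV Ka.
- move=> x y z w xK yK Hz wz; have Kx := KK xK; have Ky := KK yK; have Kz := HK Hz.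
  have : w \in pblock P z * R.
    by rewrite -[w]mulg1 mem_mulg.
  rewrite EP // => /setUP[]/lcosetP[h Rh ->]; rewrite conv_R //; try by move=> *; apply: cR.
  have phiK a : a \in K -> (a^-1 * e)^-1 * e = a.
    by move=> Ka; rewrite invMg invgK -mulgA (comm Ka Ke) mulKg.
  have inj : {in K &, injective (fun a => a^-1 * e)}.
    by move=> a b Ka Kb /mulIg/invg_inj.
  have E a : a \in c x -> (a^-1 * z^-1 \in c y) = ((a^-1 * e)^-1 * z \in c y).
    move=> ax; have Ka := memK x a xK ax.
    rewrite -[LHS]cV ?groupM ?groupV // !invMg !invgK.
    have -> : z * a * e = e^-1 * a * z * (e * e).
      rewrite (comm Kz Ka) -!mulgA (mulgA z) (comm (groupVr Ke)) ?groupM //.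
      by rewrite -!mulgA mulgV mulg1.
    by rewrite cR.
  rewrite /conv -(card_in_imset (f := fun a => a^-1 * e)); last first.
    by move=> a b /setIdP[ax _] /setIdP[bx _]; apply: inj; apply: (memK x).
  apply: eq_card => b; rewrite in_set; apply/imsetP/andP=> [[a]|[bx bz]].
    case/setIdP=> ax az ->; have Ka := memK x a xK ax.
    by rewrite cV // ax -E // az.
  have Kb := memK x b xK bx.
  exists (b^-1 * e); last by rewrite phiK.
  by rewrite in_set cV // bx E ?cV // phiK.
move=> x y z w xK yK zK /(subsetP (scK zK)) wK.
by rewrite !zeroK ?scK ?nK.
Qed.

End Cosets.

End Extension.

(** * Counting by the type of the top layer *)

(** The key of an element of X tells which of the images it lies in. *)
Lemma card_disjoint_images (J aT rT : finType) (kT : Type) (X : {set rT})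
    (Y : J -> {set aT}) (g : J -> aT -> rT) (key : rT -> kT) (t : J -> kT) :
    injective t ->
    (forall j p, p \in Y j -> g j p \in X /\ key (g j p) = t j) ->
    (forall j, {in Y j &, injective (g j)}) ->
    (forall q, q \in X -> exists j, exists2 p, p \in Y j & q = g j p) ->
  #|X| = (\sum_j #|Y j|)%N.
Proof.
move=> injt gX injg surj; pose S := [set jp : J * aT | jp.2 \in Y jp.1].
have -> : X = (fun jp => g jp.1 jp.2) @: S.
  apply/setP=> q; apply/idP/imsetP=> [/surj[j [p Yp ->]]|[[j p]]].
    by exists (j, p); rewrite ?inE.
  by rewrite inE /= => Yp ->; have [] := gX j p Yp.
rewrite card_in_imset; last first.
  move=> [j p] [j' p']; rewrite !inE /= => Yp Yp' e.
  have ej : j = j'.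
    by apply: injt; rewrite -(gX j p Yp).2 -(gX j' p' Yp').2 e.
  by rewrite -ej in Yp' e *; rewrite (injg j p p').
rewrite -sum1_card (eq_bigl (fun jp : J * aT => true && (jp.2 \in Y jp.1))); last first.
  by move=> jp; rewrite inE.
rewrite -(pair_big_dep xpredT (fun j p => p \in Y j) (fun _ _ => 1%N)) /=.
by apply: eq_bigr => j _; rewrite sum1_card.
Qed.

Section Counting.

Variables (gT : finGroupType) (G : {group gT}) (N : nat).
Hypotheses (cycG : cyclic G) (cardG : #|G| = (2 ^ N)%N).
Local Notation tors := (torsion G).
Implicit Types (m r a : nat) (P Q : {set {set gT}}).

(** All groups are members of the chain of a fixed G, so that partitions of smaller
    groups are subsets of partitions of larger ones. *)
Definition schur_parts m := [set P | schur_partition (tors m) P].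

Definition discrete_over m r :=
  [set P in schur_parts m | [forall y in tors m, pblock P y * tors r == y *: tors r]].

Definition symmetric_over m r := [set P in schur_parts m |
  [forall y in tors m, pblock P y * tors r == y *: tors r :|: y^-1 *: tors r]].

Lemma schur_partsP m P : reflect (schur (tors m) P) (P \in schur_parts m).
Proof. by rewrite inE; apply: schur_partitionP. Qed.

Lemma discrete_overP m r P : reflect (schur (tors m) P /\
    forall y, y \in tors m -> pblock P y * tors r = y *: tors r) (P \in discrete_over m r).
Proof.
rewrite inE; apply: (iffP andP) => [[/schur_partsP SP /forall_inP h]|[SP h]].
  by split=> // y /h/eqP.
by split; [apply/schur_partsP | apply/forall_inP => y /h/eqP].
Qed.

Lemma symmetric_overP m r P : reflect (schur (tors m) P /\
    forall y, y \in tors m -> pblock P y * tors r = y *: tors r :|: y^-1 *: tors r)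
  (P \in symmetric_over m r).
Proof.
rewrite inE; apply: (iffP andP) => [[/schur_partsP SP /forall_inP h]|[SP h]].
  by split=> // y /h/eqP.
by split; [apply/schur_partsP | apply/forall_inP => y /h/eqP].
Qed.

Lemma cyclic_tors m : cyclic (tors m).
Proof. exact: cyclicS (tors_subG cycG m) cycG. Qed.

Lemma tors_mul r r' : (r <= r')%N -> tors r * tors r' = tors r'.
Proof. by move=> le; rewrite mulSGid // torsS. Qed.

Lemma lcoset_mul y r r' : (r <= r')%N -> y *: tors r * tors r' = y *: tors r'.
Proof. by move=> le; rewrite -mulgA tors_mul. Qed.

Lemma discrete_over_mono m r r' P : (r <= r')%N -> P \in discrete_over m r -> P \in discrete_over m r'.
Proof.
move=> le /discrete_overP[SP h]; apply/discrete_overP; split=> // y ym.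
by rewrite -{1}(tors_mul le) mulgA h // lcoset_mul.
Qed.

Lemma symmetric_over_mono m r r' P : (r <= r')%N -> P \in symmetric_over m r -> P \in symmetric_over m r'.
Proof.
move=> le /symmetric_overP[SP h]; apply/symmetric_overP; split=> // y ym.
by rewrite -{1}(tors_mul le) mulgA h // mulUg !lcoset_mul.
Qed.

Section Last.

Variable m : nat.
Hypotheses (m_gt0 : (0 < m)%N) (le_mN : (m <= N)%N).

Let cardK : #|tors m| = (2 ^ m)%N. Proof. exact: (card_tors cycG cardG le_mN). Qed.
Let leP : (m.-1 <= m)%N. Proof. exact: leq_pred. Qed.

Lemma top_mul x y : x \in tors m -> x \notin tors m.-1 -> y \in tors m -> y \notin tors m.-1 ->
  x^-1 * y \in tors m.-1.
Proof.
by move=> xm nx ym ny; apply: (tors_diff cycG cardG); rewrite ?prednK.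
Qed.

Lemma top_sq x i : x \in tors m -> x \notin tors m.-1 -> x ^+ 2 \in tors i -> (m <= i.+1)%N.
Proof.
move=> xm nx; rewrite (sq_tors cycG) ?(torsG cycG xm) // => xi.
by rewrite leqNgt; apply: contra nx => lt; apply: (tors_le cycG _ xi); move: lt; clear; lia.
Qed.

(** For the subgroup of index 2, being discrete modulo it only says that it is a
    union of classes. *)
Lemma discrete_over_top P : schur (tors m) P ->
  (P \in discrete_over m m.-1) = is_pset (tors m) P (tors m.-1).
Proof.
move=> SP; apply/discrete_overP/is_psetP=> [[_ h]|[_ h]].
  split=> [|y yl]; first exact: (torsS cycG).
  apply: subset_trans (mulG_subl (tors m.-1) _) _.
  by rewrite h ?(tors_le cycG leP) // lcoset_id.
split=> // y ym; case: (boolP (y \in tors m.-1)) => yl.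
  rewrite lcoset_id //; apply/eqP; rewrite eqEsubset mul_subG ?h //=.
  apply/subsetP=> z zl; rewrite -(mulKVg y z) mem_mulg ?(mem_cl SP) //.
  by rewrite groupM ?groupV.
apply/eqP; rewrite eqEsubset; apply/andP; split; last first.
  by rewrite mulSg // sub1set (mem_cl SP).
apply/subsetP=> _ /mulsgP[z g zy gl ->]; rewrite mem_lcoset mulgA groupMr //.
have zm := subsetP (cl_subG SP ym) z zy.
apply: top_mul => //; apply: contra yl => zl.
by apply: (subsetP (h z zl)); rewrite (cl_eq SP zy) (mem_cl SP).
Qed.

Lemma symmetric_over_top : symmetric_over m m.-1 = discrete_over m m.-1.
Proof.
have e y : y \in tors m -> y *: tors m.-1 :|: y^-1 *: tors m.-1 = y *: tors m.-1.
  move=> ym; suff -> : y^-1 *: tors m.-1 = y *: tors m.-1 by rewrite setUid.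
  apply/lcoset_eqP; rewrite mem_lcoset -invMg groupV -expg2.
  by rewrite (sq_tors cycG) ?prednK // (torsG cycG ym).
by apply/setP=> P; apply/symmetric_overP/discrete_overP=> -[SP h]; split=> // y ym; rewrite h ?e.
Qed.

Lemma restr_discrete_over r P : P \in discrete_over m r -> is_pset (tors m) P (tors m.-1) ->
  restr P (tors m.-1) \in discrete_over m.-1 r.
Proof.
move=> /discrete_overP[SP h] pa; apply/discrete_overP; split; first exact: schur_restr SP pa.
by move=> y yl; rewrite (pblock_restr SP pa) // h // (tors_le cycG leP).
Qed.

Lemma restr_symmetric_over r P : P \in symmetric_over m r -> is_pset (tors m) P (tors m.-1) ->
  restr P (tors m.-1) \in symmetric_over m.-1 r.
Proof.
move=> /symmetric_overP[SP h] pa; apply/symmetric_overP; split; first exact: schur_restr SP pa.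
by move=> y yl; rewrite (pblock_restr SP pa) // h // (tors_le cycG leP).
Qed.

Lemma structure_tors P : schur (tors m) P ->
 exists2 r, (r < m)%N & is_pset (tors m) P (tors r) /\
 [\/ (r.+1 < m)%N /\
       (forall y, y \in tors m -> y \notin tors r -> pblock P y = tors m :\: tors r),
     (forall y, y \in tors m -> pblock P y * tors r = y *: tors r) /\
     (forall y, y \in tors m -> y \notin tors m.-1 -> pblock P y = y *: tors r)
   | (r.+2 < m)%N /\ exists s,
     (forall y, y \in tors m.-1 -> pblock P y * tors r = y *: tors r :|: y^-1 *: tors r) /\
     (forall y, y \in tors m -> y \notin tors m.-1 -> pblock P y = fold_class G s r y)].
Proof.
move=> SP; have [r lt_r] := structure (cyclic_tors m) cardK m_gt0 SP.
have e i : (i <= m)%N -> torsion (tors m) i = tors i by apply: tors_tors.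
rewrite !e ?(ltnW lt_r) // => -[pr h]; exists r => //; split=> //.
case: h => [[? h]|[h1 h2]|[lt2 [s [h1 h2]]]]; [constructor 1|constructor 2|constructor 3];
  split=> //.
exists s; split=> // y ym ny; rewrite h2 // /fold_class /mate !e ?(ltnW lt_r) //.
Qed.

End Last.

End Counting.

Section TopLayer.

Variables (gT : finGroupType) (G : {group gT}) (N m : nat).
Hypotheses (cycG : cyclic G) (cardG : #|G| = (2 ^ N)%N).
Hypotheses (m_gt0 : (0 < m)%N) (le_mN : (m <= N)%N).
Local Notation tors := (torsion G).
Local Notation schur_parts := (schur_parts G).
Local Notation discrete_over := (discrete_over G).
Local Notation symmetric_over := (symmetric_over G).
Local Notation fold_cl := (fold_class G).
Implicit Types (r a : nat) (s : bool) (P Q : {set {set gT}}) (x y z : gT).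

Let sHK : tors m.-1 \subset tors m. Proof. exact: (torsS cycG (leq_pred m)). Qed.
Let abK : abelian (tors m). Proof. exact: cyclic_abelian (cyclic_tors cycG m). Qed.
Let index2 x y : x \in tors m :\: tors m.-1 -> y \in tors m :\: tors m.-1 ->
  x * y \in tors m.-1.
Proof.
move=> /setDP[xm nx] /setDP[ym ny].
by rewrite -[x]invgK; apply: (top_mul cycG cardG) => //; rewrite groupV.
Qed.

Lemma ext_map_eq (c c' : gT -> {set gT}) P (H K : {group gT}) :
  c =1 c' -> ext P H K c = ext P H K c'.
Proof. by move=> e; rewrite /ext (eq_imset _ e). Qed.

Lemma class_map_eq (c c' : gT -> {set gT}) (H K : {group gT}) :
  c =1 c' -> class_map H K c -> class_map H K c'.
Proof.
by move=> e [h1 h2 h3]; split=> [y|y|y z]; rewrite -!e; [apply: h1|apply: h2|apply: h3].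
Qed.

(** Both kinds of pairs are of the form treated in [schur_ext_fold]. *)
Lemma fold_rep s r : (r + s <= N)%N -> exists e, [/\ e \in tors (r + s), e * e \in tors r,
  forall y, fold_cl s r y = y *: tors r :|: (y^-1 * e) *: tors r &
  s -> e \notin tors r].
Proof.
case: s => /= le; last first.
  exists 1; rewrite mulg1 !group1; split=> // y.
  by rewrite /fold_cl /fold_class /mate mulg1.
rewrite addn1 in le *.
have : ~~ (tors r.+1 \subset tors r) by rewrite (sub_torsE cycG cardG) // ltnn.
case/subsetPn=> e e1 e0; exists e; split=> //.
  by rewrite -expg2 (sq_tors cycG) // (torsG cycG e1).
move=> y; rewrite /fold_class /mate lcosetM; congr (_ :|: _ * _).
apply/setP=> z; rewrite mem_lcoset; apply/setDP/idP=> [[z1 z0]|ez].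
  exact: (tors_diff cycG cardG).
rewrite -(mulKVg e z); split; last by rewrite (groupMr _ ez).
by rewrite groupM // (tors_le cycG _ ez).
Qed.

Definition ext_coset r P := ext P (tors m.-1) (tors m) (fun x => x *: tors r).
Definition ext_fold s r P := ext P (tors m.-1) (tors m) (fold_cl s r).
Definition ext_block a P := ext P (tors a) (tors m) (fun=> tors m :\: tors a).

Lemma ext_coset_spec r P : (r < m)%N -> P \in discrete_over m.-1 r ->
  [/\ schur (tors m) (ext_coset r P),
      forall y, y \in tors m.-1 -> pblock (ext_coset r P) y = pblock P y,
      forall y, y \in tors m -> y \notin tors m.-1 -> pblock (ext_coset r P) y = y *: tors r
    & restr (ext_coset r P) (tors m.-1) = P].
Proof.
move=> lt_r /discrete_overP[SP hP]; have pP : partition P (tors m.-1) by case: SP.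
have sR : tors r \subset tors m.-1 by apply: (torsS cycG); move: lt_r; clear; lia.
have cm := class_map_coset sHK sR.
split.
- apply: (schur_ext_coset abK sHK sR index2 SP) => y yl.
  by rewrite -hP // mulG_subl.
- by move=> y; apply: (pblock_ext_in sHK pP cm).
- by move=> y; apply: (pblock_ext_out sHK pP cm).
exact: (restr_ext pP cm).
Qed.

Lemma ext_fold_spec s r P : (r + s < m)%N -> P \in symmetric_over m.-1 r ->
  [/\ schur (tors m) (ext_fold s r P),
      forall y, y \in tors m.-1 -> pblock (ext_fold s r P) y = pblock P y,
      forall y, y \in tors m -> y \notin tors m.-1 -> pblock (ext_fold s r P) y = fold_cl s r y
    & restr (ext_fold s r P) (tors m.-1) = P].
Proof.
move=> lt_r /symmetric_overP[SP hP]; have pP : partition P (tors m.-1) by case: SP.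
have le_r : (r <= m.-1)%N by move: lt_r; clear; lia.
have sR : tors r \subset tors m.-1 by apply: (torsS cycG).
have [e [er ee fE _]] := fold_rep (leq_trans (ltnW lt_r) le_mN).
have He : e \in tors m.-1 by apply: (tors_le cycG _ er); move: lt_r; clear; lia.
have pR : is_pset (tors m.-1) P (tors r).
  apply/is_psetP; split=> // y yr; apply: subset_trans (mulG_subl (tors r) _) _.
  rewrite hP ?(tors_le cycG le_r yr) // !lcoset_id ?groupV // setUid.
  exact: subxx.
have cm : class_map (tors m.-1) (tors m) (fold_cl s r).
  apply: class_map_eq (class_map_fold abK sHK sR He) => y.
  by rewrite fE.
split.
- rewrite /ext_fold (ext_map_eq _ _ _ fE).
  exact: (schur_ext_fold abK sHK sR index2 SP He ee pR).
- by move=> y; apply: (pblock_ext_in sHK pP cm).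
- by move=> y; apply: (pblock_ext_out sHK pP cm).
exact: (restr_ext pP cm).
Qed.

Lemma ext_block_spec a P : (a < m)%N -> P \in schur_parts a ->
  [/\ schur (tors m) (ext_block a P),
      forall y, y \in tors m -> y \notin tors a -> pblock (ext_block a P) y = tors m :\: tors a
    & restr (ext_block a P) (tors a) = P].
Proof.
move=> lt_a /schur_partsP SP; have pP : partition P (tors a) by case: SP.
have sH : tors a \subset tors m by apply: (torsS cycG); apply: ltnW.
have cm := class_map_block (tors a) (tors m).
split; first exact: schur_ext_block.
  by move=> y; apply: (pblock_ext_out sH pP cm).
exact: (restr_ext pP cm).
Qed.

(** The complement of the top layer is a union of classes when the top layer is. *)
Lemma pset_below P : schur (tors m) P ->
    (forall y, y \in tors m -> y \notin tors m.-1 -> pblock P y \subset tors m :\: tors m.-1) ->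
  is_pset (tors m) P (tors m.-1).
Proof.
move=> SP h; apply/is_psetP; split=> // y yl; apply/subsetP=> z zy.
have ym := subsetP sHK y yl; have zm := subsetP (cl_subG SP ym) z zy.
apply/negPn/negP=> nz; have /subsetP/(_ y) := h z zm nz.
by rewrite (cl_eq SP zy) (mem_cl SP) // inE yl => /(_ isT).
Qed.

Lemma coset_sub r y : (r < m)%N -> y \in tors m -> y \notin tors m.-1 ->
  y *: tors r \subset tors m :\: tors m.-1.
Proof.
move=> lt_r ym ny; apply/subsetP=> _ /lcosetP[g gr ->].
have gl : g \in tors m.-1 by apply: (tors_le cycG _ gr); move: lt_r; clear; lia.
by rewrite inE groupMr // ny /= groupM // (subsetP sHK).
Qed.

Lemma fold_sub s r y : (r + s < m)%N -> y \in tors m -> y \notin tors m.-1 ->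
  fold_cl s r y \subset tors m :\: tors m.-1.
Proof.
move=> lt_r ym ny; have [e [er _ -> _]] := fold_rep (leq_trans (ltnW lt_r) le_mN).
have lr : (r < m)%N by move: lt_r; clear; lia.
have el : e \in tors m.-1 by apply: (tors_le cycG _ er); move: lt_r; clear; lia.
rewrite subUset !coset_sub //; last by rewrite groupMr // groupV.
by rewrite groupM ?groupV // (subsetP sHK).
Qed.

Variant last_layer P : Prop :=
  | LastBlock a of (a < m.-1)%N & restr P (tors a) \in schur_parts a & P = ext_block a (restr P (tors a))
  | LastCoset r of (r < m)%N & is_pset (tors m) P (tors m.-1)
      & restr P (tors m.-1) \in discrete_over m.-1 r & P = ext_coset r (restr P (tors m.-1))
      & forall y, y \in tors m -> y \notin tors m.-1 -> pblock P y = y *: tors r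
  | LastFold s r of (r.+2 < m)%N & is_pset (tors m) P (tors m.-1)
      & restr P (tors m.-1) \in symmetric_over m.-1 r & P = ext_fold s r (restr P (tors m.-1))
      & forall y, y \in tors m -> y \notin tors m.-1 -> pblock P y = fold_cl s r y.

(** The last layer determines the partition from its restriction, and the
    restriction satisfies the condition under which it extends. *)
Lemma last_layerP P : schur (tors m) P -> last_layer P.
Proof.
move=> SP; have [r lt_r [pr h]] := structure_tors cycG cardG m_gt0 le_mN SP.
case: h => [[lt1 h]|[h1 h2]|[lt2 [s [h1 h2]]]].
- apply: (@LastBlock _ r); first by move: lt1; clear; lia.
    by apply/schur_partsP; apply: schur_restr SP pr.
  exact: ext_restr.
- have pl : is_pset (tors m) P (tors m.-1).
    by apply: pset_below => // y ym ny; rewrite h2 // coset_sub.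
  apply: (@LastCoset _ r) => //; last exact: ext_restr.
  by apply: (restr_discrete_over cycG) => //; apply/discrete_overP.
have lt_rs : (r + s < m)%N by case: s lt2 {h2} => /=; clear; lia.
have pl : is_pset (tors m) P (tors m.-1).
  by apply: pset_below => // y ym ny; rewrite h2 // fold_sub.
apply: (@LastFold _ s r) => //; last exact: ext_restr.
apply/symmetric_overP; split; first exact: schur_restr SP pl.
by move=> y yl; rewrite (pblock_restr SP pl) // h1.
Qed.

(** The two cosets are distinct, as y^2 is outside the subgroup of order 2^(r+s). *)
Lemma card_fold s r y : (r.+1 + s < m)%N -> y \in tors m -> y \notin tors m.-1 ->
  #|fold_cl s r y| = (2 ^ r.+1)%N.
Proof.
move=> lt_r ym ny.
have le_N : (r + s <= N)%N by move: lt_r le_mN; clear; lia.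
have [e [er _ -> _]] := fold_rep le_N.
rewrite cardsU !card_lcoset (card_tors cycG cardG); last by move: lt_r le_mN; clear; lia.
suff -> : y *: tors r :&: (y^-1 * e) *: tors r = set0.
  by rewrite cards0 subn0 expnS mul2n addnn.
apply/setP=> z; rewrite !inE !mem_lcoset; apply/negP=> /andP[h1 h2].
have : y ^+ 2 \in tors (r + s).
  have Gy := torsG cycG ym.
  have h3 : (y^-1 * e)^-1 * z * (y^-1 * z)^-1 \in tors r by rewrite groupM // groupV.
  have : e^-1 * y ^+ 2 \in tors r.
    by move: h3; rewrite !invMg !invgK mulgA mulgK expg2 mulgA.
  by move/(tors_le cycG (leq_addr s r)); rewrite groupMl ?groupV.
by move/(top_sq cycG ym ny); move: lt_r; clear; lia.
Qed.

End TopLayer.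

Ltac natlia :=
  repeat match goal with
  | H : ?T |- _ => lazymatch T with
      | is_true (leq _ _) => fail
      | @eq nat _ (expn _ _) => clear H
      | @eq nat _ _ => fail
      | nat => fail
      | bool => fail
      | ordinal _ => fail
      | _ => clear H
      end
  end; lia.

Section TopLayerCounts.

Variables (gT : finGroupType) (G : {group gT}) (N m : nat).
Hypotheses (cycG : cyclic G) (cardG : #|G| = (2 ^ N)%N).
Hypotheses (m_gt0 : (0 < m)%N) (le_mN : (m <= N)%N).
Local Notation tors := (torsion G).
Local Notation schur_parts := (schur_parts G).
Local Notation discrete_over := (discrete_over G).
Local Notation symmetric_over := (symmetric_over G).
Local Notation fold_cl := (fold_class G).
Implicit Types (r a : nat) (s : bool) (P Q : {set {set gT}}) (x y z : gT).

Let sHK : tors m.-1 \subset tors m. Proof. exact: (torsS cycG (leq_pred m)). Qed.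

Lemma top_witness : exists2 x, x \in tors m & x \notin tors m.-1.
Proof.
apply/subsetPn; rewrite (sub_torsE cycG cardG) // -ltnNge prednK //.
Qed.

Let coset_spec := ext_coset_spec cycG cardG m_gt0.
Let fold_spec := ext_fold_spec cycG cardG m_gt0 le_mN.
Let block_spec := @ext_block_spec _ G m cycG.

Let E_D P r : (r < m)%N -> P \in symmetric_over m r -> P \in discrete_over m m.-1.
Proof. by move=> lt_r h; rewrite -symmetric_over_top //; apply: (symmetric_over_mono cycG _ h); natlia. Qed.

Let D_D P r : (r < m)%N -> P \in discrete_over m r -> P \in discrete_over m m.-1.
Proof. by move=> lt_r; apply: (discrete_over_mono cycG); natlia. Qed.

Let ext_top Q P : schur (tors m) Q -> schur (tors m.-1) P ->
  (forall y, y \in tors m.-1 -> pblock Q y = pblock P y) -> Q \in discrete_over m m.-1.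
Proof.
move=> SQ SP h; rewrite (discrete_over_top cycG cardG) //; apply/is_psetP; split=> // y yl.
by rewrite h // (cl_subG SP yl).
Qed.

Let block_not_top Q a : (a < m.-1)%N -> schur (tors m) Q ->
  (forall y, y \in tors m -> y \notin tors a -> pblock Q y = tors m :\: tors a) ->
  Q \notin discrete_over m m.-1.
Proof.
move=> lt_a SQ h; have [x xm nx] := top_witness.
rewrite (discrete_over_top cycG cardG) //; apply/negP=> pl.
have : ~~ (tors m.-1 \subset tors a).
  by rewrite (sub_torsE cycG cardG) -?ltnNge //; natlia.
case/subsetPn=> y yl ny; have ym := subsetP sHK y yl.
have /negP[] := nx; apply: (pset_cl pl yl).
rewrite h // inE xm andbT; apply: contra nx; apply: (tors_le cycG).
exact: ltnW.
Qed.

(** The subgroup of index 2 fails to be a union of classes exactly when the top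
    layer lies in a class meeting lower layers. *)
Lemma card_schur_parts_rec : #|schur_parts m| = (\sum_(a < m.-1) #|schur_parts a| + #|discrete_over m m.-1|)%N.
Proof.
have sD : discrete_over m m.-1 \subset schur_parts m by apply/subsetP=> P /discrete_overP[SP _]; apply/schur_partsP.
rewrite -(cardsID (discrete_over m m.-1) (schur_parts m)) (setIidPr sD) addnC; congr (_ + _)%N.
have [x xm nx] := top_witness.
have nxa a : (a < m.-1)%N -> x \notin tors a.
  by move=> lt_a; apply: contra nx; apply: (tors_le cycG); apply: ltnW.
apply: (card_disjoint_images (g := fun (a : 'I_m.-1) P => ext_block G m a P)
  (key := fun Q => pblock Q x) (t := fun a : 'I_m.-1 => tors m :\: tors a)).
- move=> a b /(congr1 (fun X => tors m :\: X)); rewrite !setDDr !setDv !set0U.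
  have la (i : 'I_m.-1) : (i <= m)%N by move: (ltn_ord i); natlia.
  rewrite !(setIidPr _) ?(torsS cycG) // => e.
  apply: val_inj; apply: (tors_inj cycG cardG); rewrite ?(leq_trans (la _)) //.
  exact: val_inj.
- move=> a P YP; have lt_a := ltn_ord a.
  have [|SQ h _] := block_spec _ YP; first by natlia.
  rewrite h ?nxa //; split=> //; rewrite inE; apply/andP; split; last exact/schur_partsP.
  exact: (block_not_top lt_a).
- move=> a P Q YP YQ e; have lt_a := ltn_ord a.
  have lm : (a < m)%N by natlia.
  have [_ _ <-] := block_spec lm YP; have [_ _ <-] := block_spec lm YQ.
  by rewrite e.
move=> Q /setDP[/schur_partsP SQ nQ].
case: (last_layerP cycG cardG m_gt0 le_mN SQ) => [a lt_a Ra eQ|r _ pl|s r _ pl].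
- by exists (Ordinal lt_a); exists (restr Q (tors a)).
- by rewrite (discrete_over_top cycG cardG) // pl in nQ.
by rewrite (discrete_over_top cycG cardG) // pl in nQ.
Qed.

Let coset_inj x r r' : (r < m)%N -> (r' < m)%N -> x *: tors r = x *: tors r' -> r = r'.
Proof.
move=> lr lr' /(congr1 (fun X : {set gT} => #|X|)); rewrite !card_lcoset.
rewrite !(card_tors cycG cardG) ?(leq_trans (ltnW _) le_mN) //.
by move/eqP; rewrite eqn_exp2l // => /eqP.
Qed.

Let fold_inj x s s' r r' : (r.+1 + s < m)%N -> (r'.+1 + s' < m)%N -> x \in tors m ->
  x \notin tors m.-1 -> fold_cl s r x = fold_cl s' r' x -> s = s' /\ r = r'.
Proof.
move=> lr lr' xm nx e.
have er : r = r'.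
  have := congr1 (fun X : {set gT} => #|X|) e.
  rewrite !(card_fold cycG cardG le_mN) // => /eqP.
  by rewrite eqn_exp2l // eqSS => /eqP.
split=> //; rewrite -er in e lr'.
have nC r0 : (r0.+1 < m)%N -> x^-1 \notin x *: tors r0.
  move=> lr0; rewrite mem_lcoset -invMg groupV -expg2; apply/negP.
  by move/(top_sq cycG xm nx); natlia.
have inF : (x^-1 \in fold_cl false r x) by rewrite inE lcoset_refl orbT.
have inT : (r.+1 < m)%N -> (x^-1 \in fold_cl true r x) = false.
  move=> l1; rewrite inE (negPf (nC r l1)) /= mem_lcoset mulVg /mate.
  by rewrite inE group1.
have l1 : (r.+1 < m)%N by move: lr; clear; natlia.
case: s s' e {lr lr'} => -[] // e; last by rewrite e inT in inF.
by rewrite -e inT in inF.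
Qed.

Let coset_fold x s r r' : (r < m)%N -> (r'.+1 + s < m)%N -> x \in tors m ->
  x \notin tors m.-1 -> x *: tors r = fold_cl s r' x -> (r'.+2 < m)%N -> False.
Proof.
move=> lr lr' xm nx e lr2.
have er : r = r'.+1.
  have := congr1 (fun X : {set gT} => #|X|) e.
  rewrite card_lcoset (card_fold cycG cardG le_mN) // (card_tors cycG cardG); last by natlia.
  by move/eqP; rewrite eqn_exp2l // => /eqP.
have le_N : (r' + s <= N)%N by natlia.
have [f [fr _ fE _]] := fold_rep cycG cardG le_N.
have : x^-1 * f \in x *: tors r.
  by rewrite e fE inE lcoset_refl orbT.
rewrite mem_lcoset mulgA -invMg groupMr; last first.
  by apply: (tors_le cycG _ fr); rewrite er; natlia.
by rewrite groupV -expg2 => /(top_sq cycG xm nx); natlia.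
Qed.

(** The types of top layers are told apart by the class of a fixed generator. *)
Lemma card_discrete_over_top_rec : #|discrete_over m m.-1| =
  (\sum_(r < m) #|discrete_over m.-1 r| + 2 * \sum_(r < m - 2) #|symmetric_over m.-1 r|)%N.
Proof.
have [x xm nx] := top_witness.
have lt2 (r : 'I_(m - 2)) : (r.+2 < m)%N by move: (ltn_ord r); natlia.
have lts (s : bool) (r : 'I_(m - 2)) : (r.+1 + s < m)%N by move: (lt2 r); case: s => /=; natlia.
have lts' (s : bool) (r : 'I_(m - 2)) : (r + s < m)%N by move: (lt2 r); case: s => /=; natlia.
pose J := ('I_m + bool * 'I_(m - 2))%type.
rewrite (card_disjoint_images (J := J)
  (Y := fun j => match j with inl r => discrete_over m.-1 r | inr sr => symmetric_over m.-1 sr.2 end)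
  (g := fun j P => match j with inl r => ext_coset G m r P | inr sr => ext_fold G m sr.1 sr.2 P end)
  (key := fun Q => pblock Q x)
  (t := fun j => match j with inl r => x *: tors r | inr sr => fold_cl sr.1 sr.2 x end)).
- rewrite big_sumType /=; congr (_ + _)%N.
  rewrite -(pair_big xpredT xpredT (fun (_ : bool) (r : 'I_(m - 2)) => #|symmetric_over m.-1 r|)) /=.
  by rewrite sum_nat_const card_bool.
- move=> [r|[s r]] [r'|[s' r']] /= e.
  + by congr inl; apply: val_inj; apply: coset_inj e.
  + by case: (coset_fold (ltn_ord r) (lts s' r') xm nx e (lt2 r')).
  + by case: (coset_fold (ltn_ord r') (lts s r) xm nx (esym e) (lt2 r)).
  by have [-> /val_inj->] := fold_inj (lts s r) (lts s' r') xm nx e.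
- move=> [r|[s r]] P /= YP.
    have [SQ h1 h2 _] := coset_spec (ltn_ord r) YP; rewrite h2 //; split=> //.
    by have /discrete_overP[SP _] := YP; apply: ext_top SQ SP h1.
  have [SQ h1 h2 _] := fold_spec (lts' s r) YP; rewrite h2 //; split=> //.
  by have /symmetric_overP[SP _] := YP; apply: ext_top SQ SP h1.
- move=> [r|[s r]] P Q /= YP YQ e.
    have [_ _ _ <-] := coset_spec (ltn_ord r) YP; have [_ _ _ <-] := coset_spec (ltn_ord r) YQ.
    by rewrite e.
  have [_ _ _ <-] := fold_spec (lts' s r) YP; have [_ _ _ <-] := fold_spec (lts' s r) YQ.
  by rewrite e.
move=> Q DQ; have [SQ _] := discrete_overP _ _ _ _ DQ.
case: (last_layerP cycG cardG m_gt0 le_mN SQ) => [a lt_a Ra eQ|r lt_r pl Rr eQ _|s r lt_r pl Rr eQ _].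
- have lm : (a < m)%N by natlia.
  have [S' h _] := block_spec lm Ra; rewrite -eQ in h.
  by rewrite (negPf (block_not_top lt_a SQ h)) in DQ.
- by exists (inl (Ordinal lt_r)); exists (restr Q (tors m.-1)).
have lr : (r < m - 2)%N by natlia.
by exists (inr (s, Ordinal lr)); exists (restr Q (tors m.-1)).
Qed.

(** Discreteness modulo R excludes paired classes in the top layer and bounds their
    radical by R. *)
Lemma card_discrete_over_rec r : (r.+1 < m)%N ->
  #|discrete_over m r| = (\sum_(r' < r.+1) #|discrete_over m.-1 r'|)%N.
Proof.
move=> lt_r; have [x xm nx] := top_witness.
have ltm (r' : 'I_r.+1) : (r' < m)%N by move: (ltn_ord r'); natlia.
apply: (card_disjoint_images (g := fun (r' : 'I_r.+1) P => ext_coset G m r' P)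
  (key := fun Q => pblock Q x) (t := fun r' : 'I_r.+1 => x *: tors r')).
- by move=> a b /coset_inj e; apply: val_inj; apply: e.
- move=> r' P YP; have [SQ h1 h2 _] := coset_spec (ltm r') YP; rewrite h2 //; split=> //.
  have le_r : (r' <= r)%N by rewrite -ltnS.
  have /discrete_overP[SP hP] := discrete_over_mono cycG le_r YP.
  apply/discrete_overP; split=> // y ym; case: (boolP (y \in tors m.-1)) => yl.
    by rewrite h1 // hP.
  by rewrite h2 // (lcoset_mul cycG).
- move=> r' P Q YP YQ e.
  by have [_ _ _ <-] := coset_spec (ltm r') YP; have [_ _ _ <-] := coset_spec (ltm r') YQ; rewrite e.
move=> Q DQ; have [SQ hQ] := discrete_overP _ _ _ _ DQ.
have DQ' := D_D (ltnW lt_r) DQ.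
have sub : pblock Q x \subset x *: tors r by rewrite -hQ // mulG_subl.
case: (last_layerP cycG cardG m_gt0 le_mN SQ) =>
  [a lt_a Ra eQ|r' lt_r' pl Rr eQ hx|s r' lt_r' pl Rr eQ hx].
- have lm : (a < m)%N by natlia.
  have [S' h _] := block_spec lm Ra; rewrite -eQ in h.
  by rewrite (negPf (block_not_top lt_a SQ h)) in DQ'.
- have lr : (r' < r.+1)%N.
    move: sub; rewrite hx // => /subset_leq_card; rewrite !card_lcoset.
    by rewrite !(card_tors cycG cardG) ?leq_exp2l //; natlia.
  by exists (Ordinal lr); exists (restr Q (tors m.-1)).
have le_N : (r' + s <= N)%N by case: (s); natlia.
have [f [fr _ fE _]] := fold_rep cycG cardG le_N.
have : x^-1 * f \in x *: tors r.
  by apply: (subsetP sub); rewrite hx // fE inE lcoset_refl orbT.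
rewrite mem_lcoset mulgA -invMg => /(tors_le cycG (_ : r <= m - 2)%N) h.
have : (x * x)^-1 * f \in tors (m - 2) by apply: h; natlia.
rewrite groupMr; last by apply: (tors_le cycG _ fr); case: (s) => /=; natlia.
by rewrite groupV -expg2 => /(top_sq cycG xm nx); natlia.
Qed.

(** For r = m - 2 the undivided top layer is also x R u x^-1 R, and it is counted as
    such; this makes the recursion uniform. *)
Lemma card_symmetric_over_rec r : (r.+1 < m)%N ->
  #|symmetric_over m r| = (\sum_(r' < r.+1) #|symmetric_over m.-1 r'| + \sum_(r' < r) #|symmetric_over m.-1 r'|)%N.
Proof.
move=> lt_r; have [x xm nx] := top_witness.
pose J := ('I_r.+1 + 'I_r)%type.
have ltF (r' : 'I_r.+1) : (r'.+1 + false < m)%N by move: (ltn_ord r'); natlia.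
have ltT (r' : 'I_r) : (r'.+1 + true < m)%N by move: (ltn_ord r'); natlia.
have ltF' (r' : 'I_r.+1) : (r' + false < m)%N by move: (ltn_ord r'); natlia.
have ltT' (r' : 'I_r) : (r' + true < m)%N by move: (ltn_ord r'); natlia.
rewrite (card_disjoint_images (J := J)
  (Y := fun j => match j with inl r' => symmetric_over m.-1 r' | inr r' => symmetric_over m.-1 r' end)
  (g := fun j P => match j with inl r' => ext_fold G m false r' P | inr r' => ext_fold G m true r' P end)
  (key := fun Q => pblock Q x)
  (t := fun j => match j with inl r' => fold_cl false r' x | inr r' => fold_cl true r' x end)).
- by rewrite big_sumType.
- move=> [r1|r1] [r2|r2] /= e.
  + by have [_ /val_inj->] := fold_inj (ltF r1) (ltF r2) xm nx e.
  + by have [] := fold_inj (ltF r1) (ltT r2) xm nx e.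
  + by have [] := fold_inj (ltT r1) (ltF r2) xm nx e.
  by have [_ /val_inj->] := fold_inj (ltT r1) (ltT r2) xm nx e.
- have gen (s : bool) (r' : nat) P : (r' + s < m)%N -> (r' + s <= r)%N -> P \in symmetric_over m.-1 r' ->
      ext_fold G m s r' P \in symmetric_over m r /\ pblock (ext_fold G m s r' P) x = fold_cl s r' x.
    move=> l1 le_r YP; have [SQ h1 h2 _] := fold_spec l1 YP; rewrite h2 //; split=> //.
    have le_r' : (r' <= r)%N by natlia.
    have /symmetric_overP[SP hP] := symmetric_over_mono cycG le_r' YP.
    apply/symmetric_overP; split=> // y ym; case: (boolP (y \in tors m.-1)) => yl.
      by rewrite h1 // hP.
    have le_N : (r' + s <= N)%N by natlia.
    have [f [fr _ fE _]] := fold_rep cycG cardG le_N.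
    rewrite h2 // fE mulUg !(lcoset_mul cycG) // lcosetM lcoset_id //.
    exact: (tors_le cycG le_r).
  by move=> [r'|r'] P /= YP; apply: gen => //; move: (ltn_ord r'); rewrite ?addn0 ?addn1 ?ltnS.
- move=> [r'|r'] P Q /= YP YQ e.
    have [_ _ _ <-] := fold_spec (ltF' r') YP; have [_ _ _ <-] := fold_spec (ltF' r') YQ.
    by rewrite e.
  have [_ _ _ <-] := fold_spec (ltT' r') YP; have [_ _ _ <-] := fold_spec (ltT' r') YQ.
  by rewrite e.
move=> Q EQ; have [SQ hQ] := symmetric_overP _ _ _ _ EQ.
have DQ' := E_D (ltnW lt_r) EQ.
have sub : pblock Q x \subset x *: tors r :|: x^-1 *: tors r by rewrite -hQ // mulG_subl.
have nC : x^-1 \notin x *: tors r.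
  rewrite mem_lcoset -invMg groupV -expg2; apply/negP.
  by move/(top_sq cycG xm nx); natlia.
have cU : (#|x *: tors r :|: x^-1 *: tors r| <= 2 ^ r.+1)%N.
  rewrite -(card_fold cycG cardG le_mN (s := false) (r := r) _ xm nx) //.
  by rewrite addn0.
case: (last_layerP cycG cardG m_gt0 le_mN SQ) =>
  [a lt_a Ra eQ|r' lt_r' pl Rr eQ hx|s r' lt_r' pl Rr eQ hx].
- have lm : (a < m)%N by natlia.
  have [S' h _] := block_spec lm Ra; rewrite -eQ in h.
  by rewrite (negPf (block_not_top lt_a SQ h)) in DQ'.
(* the top layer is one class, the union of the cosets of x and x^-1 *)
- have x1 : x^-1 \in x *: tors r' * tors r.
    by rewrite -hx // hQ // inE lcoset_refl orbT.
  have er' : r' = m.-1.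
    have : x^-1 \in x *: tors (maxn r' r).
      apply: subsetP x1; rewrite -mulgA mulgS // mul_subG // torsS //.
        exact: leq_maxl.
      exact: leq_maxr.
    rewrite mem_lcoset -invMg groupV -expg2 => /(top_sq cycG xm nx); natlia.
  have er : r = (m - 2)%N.
    have := leq_trans (subset_leq_card sub) cU.
    rewrite hx // card_lcoset (card_tors cycG cardG) ?leq_exp2l //; natlia.
  have eh y : y \in tors m -> y \notin tors m.-1 -> pblock Q y = fold_cl false r y.
    move=> ym ny; rewrite hx // /fold_class /mate -hQ // hx // -mulgA.
    by rewrite mulGSid // er'; apply: (torsS cycG); natlia.
  exists (inl ord_max); exists (restr Q (tors m.-1)); last exact: ext_restr.
  exact: (restr_symmetric_over cycG).
have lr : (r' <= r)%N.
  have := leq_trans (subset_leq_card sub) cU.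
  by rewrite hx // (card_fold cycG cardG le_mN) ?leq_exp2l // ; case: (s) => /=; natlia.
case: s eQ hx => eQ hx; last first.
  by exists (inl (Ordinal (lr : (r' < r.+1)%N))); exists (restr Q (tors m.-1)).
have lr1 : (r' < r)%N.
  rewrite ltn_neqAle lr andbT; apply/eqP=> er.
  have le_N : (r' + true <= N)%N by natlia.
  have [f [fr _ fE nf]] := fold_rep cycG cardG le_N.
  have : x^-1 * f \in x *: tors r :|: x^-1 *: tors r.
    by apply: (subsetP sub); rewrite hx // fE inE lcoset_refl orbT.
  rewrite inE !mem_lcoset invgK mulKVg -er (negPf (nf isT)) orbF mulgA -invMg.
  move/(tors_le cycG (leq_addr true r')); rewrite groupMr // groupV -expg2.
  by move/(top_sq cycG xm nx); natlia.
by exists (inr (Ordinal lr1)); exists (restr Q (tors m.-1)).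
Qed.

End TopLayerCounts.

(** * The counting function of the cyclic 2-groups *)

Section Base.

Variables (gT : finGroupType) (G : {group gT}).
Hypothesis cycG : cyclic G.

Lemma discrete_over_full m : discrete_over G m m = schur_parts G m.
Proof.
apply/setP=> P; apply/discrete_overP/schur_partsP=> [[]//|SP]; split=> // y ym.
have sub := cl_subG SP ym.
rewrite lcoset_id //; apply/eqP; rewrite eqEsubset mul_subG //=.
apply/subsetP=> z zm; rewrite -(mulKVg y z) mem_mulg ?(mem_cl SP) //.
by rewrite groupM ?groupV.
Qed.

Lemma card_schur_parts0 : #|schur_parts G 0| = 1%N.
Proof.
have l0 : torsion G 0 = 1 :> {set gT} by rewrite tors0.
suff -> : schur_parts G 0 = [set [set [set 1]]] by rewrite cards1.
apply/setP=> P; apply/schur_partsP/set1P=> [SP|->].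
  have h C : C \in P -> C = [set 1].
    move=> PC; have [x Cx] := class_nonempty SP PC.
    have sC := pset_subG (class_pset SP PC); rewrite l0 in sC.
    apply/eqP; rewrite eqEsubset sC /= sub1set.
    by have := subsetP sC x Cx; rewrite inE => /eqP <-.
  apply/setP=> C; rewrite inE; apply/idP/eqP=> [/h//|->].
  by case: SP.
split.
- rewrite l0; apply/and3P; split.
  + by rewrite /cover big_set1.
  + by apply/trivIsetP=> A B; rewrite !inE => /eqP-> /eqP->; rewrite eqxx.
  by rewrite inE eq_sym; apply/set0Pn; exists 1; rewrite inE.
- by rewrite inE.
- by move=> C; rewrite !inE => /eqP->; rewrite imset_set1 invg1.
by move=> A B C _ _ /set1P-> z w /set1P-> /set1P->.
Qed.

End Base.

Lemma cyclic_Zp_group k : cyclic (Zp_group k).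
Proof.
rewrite /= /Zp; case: ifP => k1; last exact: cyclic1.
by apply/cyclicP; exists (Zp1 : 'Z_k); apply: Zp_cycle.
Qed.

(** Cyclic groups of equal order are isomorphic, so one group serves for all
    k <= N. *)
Lemma Omega_tors N k : (k <= N)%N ->
  Omega k%:Z = #|schur_parts (Zp_group (2 ^ N)) k|.
Proof.
move=> le; rewrite /Omega size_schur_rings /schur_parts.
apply: card_schur_isog.
have cN := cyclic_Zp_group (2 ^ N).
have cardN : #|Zp_group (2 ^ N)| = (2 ^ N)%N by rewrite /= card_Zp ?expn_gt0.
rewrite (isog_cyclic_card _ (cyclic_Zp_group (2 ^ k))).
rewrite (cyclic_tors cN) /= (card_tors cN cardN le) card_Zp ?expn_gt0 //.
Qed.

Local Open Scope ring_scope.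

Lemma Omega_recurrence (p : nat) : (0 < p)%N ->
  (Omega p.+1)%:R = \sum_(1 <= k < p.+2)
    layer_coef (fun i => catalan i + schroeder i) k * (Omega (p.+1 - k)%N)%:R
    - (catalan p + schroeder p) :> rat.
Proof.
move=> p0; pose N := p.+1; pose G := Zp_group (2 ^ N).
have cG : cyclic G := cyclic_Zp_group _.
have cardG : #|G| = (2 ^ N)%N by rewrite /G /= card_Zp ?expn_gt0.
have Om k : (k <= N)%N -> Omega k = #|schur_parts G k| by apply: Omega_tors.
rewrite Om //.
have := @count_recurrence N (fun m => #|schur_parts G m|) (fun m r => #|discrete_over G m r|)
  (fun m r => #|symmetric_over G m r|) _ _ _ _ _ _ _ p p0 (leqnn _).
move=> ->.
- congr (_ - _); apply: eq_big_nat => k _; congr (_ * _%:R).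
  by rewrite Om // leq_subr.
- exact: card_schur_parts0.
- by move=> m /andP[m0 le]; apply: (card_schur_parts_rec cG cardG).
- by move=> m /andP[m0 le]; apply: (card_discrete_over_top_rec cG cardG).
- by move=> m r le lt; apply: (card_discrete_over_rec cG cardG) => //; lia.
- by move=> m r le lt; apply: (card_symmetric_over_rec cG cardG) => //; lia.
- by move=> m /andP[m0 le]; rewrite (symmetric_over_top cG).
by move=> m _; rewrite discrete_over_full.
Qed.

Lemma Omega0 : Omega 0 = 1%N.
Proof. by rewrite (@Omega_tors 0 0) // card_schur_parts0 // cyclic_Zp_group. Qed.

Lemma Omega1 : Omega 1 = 1%N.
Proof.
have cG := cyclic_Zp_group (2 ^ 1).
have cardG : #|Zp_group (2 ^ 1)| = (2 ^ 1)%N by rewrite /= card_Zp.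
rewrite (@Omega_tors 1 1) // (card_schur_parts_rec cG cardG) // big_ord0.
rewrite (card_discrete_over_top_rec cG cardG) // big_ord1 big_ord0 /= discrete_over_full //.
by rewrite card_schur_parts0.
Qed.

Theorem theorem6p7 :
  [/\ Omega 0 = 1%N, Omega 1 = 1%N, Omega 2 = 3%N & Omega 3 = 10%N] /\
  forall n : nat, (2 <= n)%N ->
    (Omega n%:Z)%:R =
      \sum_(1 <= k < 4) 2%:R ^+ k * (Omega (n%:Z - k%:Z))%:R
      - (catalan (n - 1)%N + schroeder (n - 1)%N)
      + \sum_(4 <= k < n.+1)
          (catalan (k - 1)%N + schroeder (k - 1)%N
           - \sum_(1 <= j < (k - 3).+1) (catalan j + schroeder j))
          * (Omega (n%:Z - k%:Z))%:R :> rat.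
Proof. exact: recurrence_shape (erefl _) Omega0 Omega1 Omega_recurrence. Qed.
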